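(* Consider the linear regression model, kernel matrix $P=P(\eta)$, cost functions and notation described in the context. Assume the noise is Gaussian, $V\sim\mathcal N(0,\sigma^2I_N)$, and: (A1) the minimizers $\hat\eta_{\mathrm{EB}},\hat\eta_{\mathrm{Sy}},\hat\eta_{\mathrm{EEB}},\hat\eta_{\mathrm{MSEy}}$ (defined in the context) are interior points of $\Omega$; (A2) $P$ is positive definite and $\Phi^T\Phi/N\to\Sigma$ almost surely as $N\to\infty$, with $\Sigma\in\mathbb{R}^{n\times n}$ positive definite; (A3) the sets of minimizers $\eta_b^*$ of $W_b$ and $\eta_y^*$ of $W_y$ over $\Omega$ each consist of isolated points; (A5) $\Omega$ is an open subset of $\mathbb{R}^p$ (so that $\eta_b^*$ and $\eta_y^*$ are interior points of $\Omega$). Then, as $N\to\infty$, $$\sqrt N(\hat\eta_{\mathrm{EB}}-\eta_b^* )\xrightarrow{d}\mathcal N\left(0,\ A_b(\eta_b^* )^{-1}B_b(\eta_b^* )A_b(\eta_b^* )^{-1}\right),$$ where $A_b(\eta_b^* )$ and $B_b(\eta_b^* )$ are the matrices with $(k,l)$ entries $$A_b(\eta_b^* )_{k,l}=\left.\left\{\theta_0^T\frac{\partial^2P^{-1}}{\partial\eta_k\partial\eta_l}\theta_0+\operatorname{Tr}\left(\frac{\partial P^{-1}}{\partial\eta_l}\frac{\partial P}{\partial\eta_k}\right)+\operatorname{Tr}\left(P^{-1}\frac{\partial^2P}{\partial\eta_k\partial\eta_l}\right)\right\}\right|_{\eta_b^*},$$ $$B_b(\eta_b^* )_{k,l}=4\sigma^2\left.\left\{\theta_0^T\frac{\partial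 P^{-1}}{\partial\eta_k}\Sigma^{-1}\frac{\partial P^{-1}}{\partial\eta_l}\theta_0\right\}\right|_{\eta_b^*}.$$
   Context: Model: $Y=\Phi\theta_0+V$, with $Y\in\mathbb{R}^N$, $\Phi\in\mathbb{R}^{N\times n}$ of full column rank $n$, $N>n$, true parameter $\theta_0\in\mathbb{R}^n$, and $V\in\mathbb{R}^N$ having i.i.d. entries of mean $0$ and variance $\sigma^2>0$. Dependence on $N$ is suppressed in the notation. Kernel matrix: $P=P(\eta)\in\mathbb{R}^{n\times n}$ is a (symmetric) kernel matrix parameterized by a hyper-parameter $\eta\in\Omega\subset\mathbb{R}^p$. Notation: $Q=\Phi P\Phi^T+\sigma^2I_N$, $\hat\theta^{\mathrm R}(\eta)=P\Phi^TQ^{-1}Y$; $\|\cdot\|_2$ is the Euclidean norm; $\xrightarrow{d}$ denotes convergence in distribution. Cost functions and minimizers over $\eta\in\Omega$: - $\hat\eta_{\mathrm{EB}}$ minimizes $\mathcal F_{\mathrm{EB}}=Y^TQ^{-1}Y+\log\det Q$; - $\hat\eta_{\mathrm{Sy}}$ minimizes $\mathcal F_{\mathrm{Sy}}=\|Y-\Phi\hat\theta^{\mathrm R}(\eta)\|_2^2+2\sigma^2\operatorname{Tr}(\Phi P\Phi^TQ^{-1})$; - $\hat\eta_{\mathrm{EEB}}$ minimizes $\theta_0^T\Phi^TQ^{-1}\Phi\theta_0+\sigma^2\operatorname{Tr}(Q^{-1})+\log\det Q$; - $\hat\eta_{\mathrm{MSEy}}$ minimizes $\sigma^4\theta_0^T\Phi^TQ^{-2}\Phi\theta_0+\sigma^6\operatorname{Tr}(Q^{-2})-2\sigma^4\operatorname{Tr}(Q^{-1})+2N\sigma^2$.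 Limit functions: $W_b(\eta)=\theta_0^TP^{-1}\theta_0+\log\det P$ and $W_y(\eta)=\sigma^4\theta_0^TP^{-T}\Sigma^{-1}P^{-1}\theta_0-2\sigma^4\operatorname{Tr}(\Sigma^{-1}P^{-1})$; $\eta_b^*=\arg\min_{\eta\in\Omega}W_b$ and $\eta_y^*=\arg\min_{\eta\in\Omega}W_y$.
   Formalization: Added: with probability tending to 1 the EB minimizer lies in a compact subset of Ω where η_b* is the only minimizer of W_b (else it may run to infinity or to another minimizer); A_b(η_b* ) is invertible; P is C² on Ω; Φ is independent of V; the EB minimizer is measurable. *)

(* Defs.v *)
From HB Require Import structures.
From mathcomp Require Import all_boot all_order all_algebra.
From mathcomp Require Import all_classical all_reals all_analysis.

Set Implicit Arguments.
Unset Strict Implicit.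
Unset Printing Implicit Defensive.

Import Order.TTheory GRing.Theory Num.Theory.
Import numFieldNormedType.Exports.

Local Open Scope classical_set_scope.
Local Open Scope ring_scope.

Section Matrices.
Context {R : realType}.

Definition quad n (A : 'M[R]_n) (x : 'cV[R]_n) : R := (x^T *m A *m x) 0 0.

Definition posdef n (A : 'M[R]_n) : Prop :=
  A^T = A /\ forall x : 'cV[R]_n, x != 0 -> 0 < quad A x.

(* The library norm on matrices is the sup norm. *)
Definition norm2 m (x : 'cV[R]_m) : R := Num.sqrt (\sum_i (x i 0) ^+ 2).

End Matrices.

Section Calculus.
Context {R : realType} {p : nat} {W : normedModType R}.

Definition partial (k : 'I_p) (f : 'rV[R]_p -> W) (eta : 'rV[R]_p) : W :=
  'D_(delta_mx 0 k) f eta.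

(* Continuity of f itself follows from that of its first partials. *)
Definition C2_on (Omega : set 'rV[R]_p) (f : 'rV[R]_p -> W) : Prop :=
  forall eta, Omega eta -> forall k : 'I_p,
    [/\ derivable f eta (delta_mx 0 k),
        {for eta, continuous (partial k f)} &
        forall l : 'I_p, derivable (partial k f) eta (delta_mx 0 l) /\
          {for eta, continuous (partial l (partial k f))}].

Definition argmin (Omega : set 'rV[R]_p) (F : 'rV[R]_p -> R) : set 'rV[R]_p :=
  [set eta | Omega eta /\ forall x, Omega x -> F eta <= F x].

End Calculus.

Section Probability.
Context {R : realType}.

Definition borel_rV (p : nat) := g_sigma_algebraType (@open 'rV[R]_p).

(* normal_prob m 0 is not the Dirac mass at m in the library. *)
Definition normal_law (m v : R) (B : set R) : \bar R :=
  if v == 0 then \d_m B else normal_prob m (Num.sqrt v) B.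

(* Gaussian law N(m, C), with C possibly singular: every linear functional of
   the vector is normal. *)
Definition is_gaussian p (mu : probability (borel_rV p) R)
    (m : 'rV[R]_p) (C : 'M[R]_p) : Prop :=
  [/\ C^T = C, forall a, 0 <= quad C a &
      forall (a : 'cV[R]_p) (B : set R), measurable B ->
        mu [set x : 'rV[R]_p | B ((x *m a) 0 0)] =
        normal_law ((m *m a) 0 0) (quad C a) B].

Context {d : measure_display} {T : measurableType d}.

Definition cvg_in_distribution p (Pr : probability T R)
    (X : nat -> T -> 'rV[R]_p) (mu : probability (borel_rV p) R) : Prop :=
  forall f : 'rV[R]_p -> R, continuous f -> (exists M, forall x, `|f x| <= M) ->
    (fun N => \int[Pr]_w (f (X N w))%:E)%E @ \oo -->
    (\int[mu]_x (f x)%:E)%E.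

(* The product rule for every subfamily is included, taking A i = setT. *)
Definition mutually_independent (I : finType) (Pr : probability T R)
    (X : I -> T -> R) : Prop :=
  forall A : I -> set R, (forall i, measurable (A i)) ->
    Pr [set w | forall i, A i (X i w)] =
    (\big[*%E/1%E]_(i : I) Pr (X i @^-1` A i))%E.

(* Independence of the vectors (X i)_i and (Y j)_j; measurable rectangles form a
   generating pi-system. *)
Definition independent_families (I J : finType) (Pr : probability T R)
    (X : I -> T -> R) (Y : J -> T -> R) : Prop :=
  forall (A : I -> set R) (B : J -> set R),
    (forall i, measurable (A i)) -> (forall j, measurable (B j)) ->
    Pr ([set w | forall i, A i (X i w)] `&` [set w | forall j, B j (Y j w)]) =
    (Pr [set w | forall i, A i (X i w)] * Pr [set w | forall j, B j (Y j w)])%E.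

(* V ~ N(0, sigma^2 I_N) *)
Definition white_gaussian N (Pr : probability T R) (sigma : R)
    (V : T -> 'cV[R]_N) : Prop :=
  [/\ forall i, measurable_fun setT (fun w => V w i 0),
      forall (i : 'I_N) (B : set R), measurable B ->
        Pr [set w | B (V w i 0)] = normal_prob 0 sigma B &
      mutually_independent Pr (fun i w => V w i 0)].

End Probability.

Section CostFunctions.
Context {R : realType} {N n : nat}.
Variables (Phi : 'M[R]_(N, n)) (sigma : R).

Definition Qmx (P : 'M[R]_n) : 'M[R]_N :=
  Phi *m P *m Phi^T + (sigma ^+ 2)%:M.

Definition theta_R (Y : 'cV[R]_N) (P : 'M[R]_n) : 'cV[R]_n :=
  P *m Phi^T *m invmx (Qmx P) *m Y.

Definition F_EB (Y : 'cV[R]_N) (P : 'M[R]_n) : R :=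
  quad (invmx (Qmx P)) Y + ln (\det (Qmx P)).

Definition F_Sy (Y : 'cV[R]_N) (P : 'M[R]_n) : R :=
  norm2 (Y - Phi *m theta_R Y P) ^+ 2 +
  2 * sigma ^+ 2 * \tr (Phi *m P *m Phi^T *m invmx (Qmx P)).

Definition F_EEB (theta0 : 'cV[R]_n) (P : 'M[R]_n) : R :=
  quad (invmx (Qmx P)) (Phi *m theta0) +
  sigma ^+ 2 * \tr (invmx (Qmx P)) + ln (\det (Qmx P)).

Definition F_MSEy (theta0 : 'cV[R]_n) (P : 'M[R]_n) : R :=
  let Qi := invmx (Qmx P) in
  sigma ^+ 4 * quad (Qi *m Qi) (Phi *m theta0) +
  sigma ^+ 6 * \tr (Qi *m Qi) - 2 * sigma ^+ 4 * \tr Qi +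
  2 * N%:R * sigma ^+ 2.

End CostFunctions.

Section Limits.
Context {R : realType} {p n : nat}.
Variables (P : 'rV[R]_p -> 'M[R]_n) (theta0 : 'cV[R]_n).
Variables (sigma : R) (Sigma : 'M[R]_n).

Definition Pinv (eta : 'rV[R]_p) : 'M[R]_n := invmx (P eta).

Definition W_b (eta : 'rV[R]_p) : R :=
  quad (Pinv eta) theta0 + ln (\det (P eta)).

Definition W_y (eta : 'rV[R]_p) : R :=
  sigma ^+ 4 * quad ((Pinv eta)^T *m invmx Sigma *m Pinv eta) theta0 -
  2 * sigma ^+ 4 * \tr (invmx Sigma *m Pinv eta).

Definition A_b (eta : 'rV[R]_p) : 'M[R]_p :=
  \matrix_(k, l)
    (quad (partial k (partial l Pinv) eta) theta0 +
     \tr (partial l Pinv eta *m partial k P eta) +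
     \tr (Pinv eta *m partial k (partial l P) eta)).

Definition B_b (eta : 'rV[R]_p) : 'M[R]_p :=
  \matrix_(k, l)
    (4 * sigma ^+ 2 *
     quad (partial k Pinv eta *m invmx Sigma *m partial l Pinv eta) theta0).

End Limits.

(* Main.v *)
(* With G = Phi^T Phi and theta = G^-1 Phi^T Y, the cost F_EB equals, up to a
   term independent of the kernel, h(eta) = theta^T S^-1 theta + log det S with
   S = P(eta) + sigma^2 G^-1. As G^-1 -> 0 and theta -> theta0, h tends to W_b, so
   the estimator, confined to K, converges to eta_b. Expanding the first-order
   condition at (eta_b, theta0, 0) gives
     sqrt N (eta_EB - eta_b) = - sqrt N (theta - theta0)^T D A_b^-1 + o(1),
   where D is the mixed derivative in (theta, eta). Conditionally on Phi the leading
   term is Gaussian, with a covariance converging almost surely. Convergence of its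
   one-dimensional projections yields convergence in law by the Cramer-Wold device,
   in which trigonometric polynomials are dense by Stone's theorem. *)
Require Import Defs.
From HB Require Import structures.
From mathcomp Require Import all_boot all_order all_algebra.
From mathcomp Require Import all_classical all_reals all_analysis.
From mathcomp Require Import measurable_realfun ring lra.

Set Implicit Arguments.
Unset Strict Implicit.
Unset Printing Implicit Defensive.

Import Order.TTheory GRing.Theory Num.Theory.
Import numFieldNormedType.Exports.

Local Open Scope classical_set_scope.
Local Open Scope ring_scope.

(** * Positive definite matrices and the reduced cost *)

(** All randomness enters the reduced cost through the pair [(theta, M)] with [M = sigma^2 G^-1].
    With [M] as a free variable, the expansion becomes a deterministic statement near
    [(eta_b, theta0, 0)], uniform over samples. The two components are of different size:
    [sqrt N * |M|] tends to 0 almost surely, so a fixed constant in front of [|M|] is harmless,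
    whereas [sqrt N * |theta - theta0|] is only bounded in probability and must carry an arbitrarily
    small factor. The expansion holds only for samples of full rank with the estimator in [K] and
    the pair close to its limit. The other samples are absorbed by bounded truncated errors: their
    mean dominates the difference of the two expectations, and its limit vanishes with the
    truncation parameter. Inverses are written with [adjinv], rational in the entries and defined
    everywhere, which serves both differentiability near a point and measurability over all samples.
    The limit law is constructed, as the image of a noise vector of size [n] under a matrix built
    from a Cholesky factor of [Sigma^-1]. *)

Lemma det_add1_mulC (R : comNzRingType) m n (A : 'M[R]_(m, n)) (B : 'M[R]_(n, m)) :
  \det (1%:M + A *m B) = \det (1%:M + B *m A).
Proof.
(* Sylvester's identity: one block matrix is eliminated from either diagonal block, and the two
   factorizations have the two determinants. *)
have EB : block_mx 1%:M 0 B 1%:M *m block_mx 1%:M (- A) 0 (1%:M + B *m A) =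
          block_mx 1%:M (- A) B 1%:M.
  by rewrite mulmx_block !mulmx1 !mul1mx !mul0mx !addr0 mulmxN addrCA addNr addr0.
have EA : block_mx 1%:M (- A) 0 1%:M *m block_mx (1%:M + A *m B) 0 B 1%:M =
          block_mx 1%:M (- A) B 1%:M.
  by rewrite mulmx_block !mulmx1 !mul1mx !mul0mx !add0r mulNmx addrK.
have := congr1 determinant (etrans EA (esym EB)).
by rewrite !det_mulmx !(det_ublock, det_lblock) !det1 !mul1r !mulr1.
Qed.

Section PosDef.
Context {R : realType}.

Lemma quadD n (A B : 'M[R]_n) x : quad (A + B) x = quad A x + quad B x.
Proof. by rewrite /quad mulmxDr mulmxDl mxE. Qed.

Lemma quadZ n c (A : 'M[R]_n) x : quad (c *: A) x = c * quad A x.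
Proof. by rewrite /quad -scalemxAr -scalemxAl mxE. Qed.

Lemma quadN n (A : 'M[R]_n) (x : 'cV[R]_n) : quad A (- x) = quad A x.
Proof.
have E : (- x)^T = - x^T by apply/matrixP => i j; rewrite !mxE.
by rewrite /quad E mulNmx mulNmx mulmxN opprK.
Qed.

Lemma quad_mul n m (A : 'M[R]_m) (B : 'M[R]_(m, n)) x :
  quad (B^T *m A *m B) x = quad A (B *m x).
Proof. by rewrite /quad trmx_mul !mulmxA. Qed.

Lemma quad1 n (x : 'cV[R]_n) : quad 1%:M x = \sum_i x i 0 ^+ 2.
Proof. by rewrite /quad mulmx1 mxE; apply: eq_bigr => i _; rewrite mxE expr2. Qed.

Lemma quad_gram n m (L : 'M[R]_(m, n)) x :
  quad (L^T *m L) x = \sum_i (L *m x) i 0 ^+ 2.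
Proof. by rewrite -quad1 -quad_mul mulmx1. Qed.

Lemma quad_gram_ge0 n m (L : 'M[R]_(m, n)) x : 0 <= quad (L^T *m L) x.
Proof. by rewrite quad_gram sumr_ge0// => i _; exact: sqr_ge0. Qed.

Lemma scalar_trmx (x : 'M[R]_1) : x^T 0 0 = x 0 0.
Proof. by rewrite mxE. Qed.

(** A nonzero row of the left kernel would give a nonzero vector on which the form vanishes. *)
Lemma posdef_unit n (A : 'M[R]_n) : posdef A -> A \in unitmx.
Proof.
move=> [sA pA]; rewrite -row_free_unit -kermx_eq0; apply/eqP/row_matrixP => i.
rewrite row0; apply/eqP; apply: contraT => nz.
have : row i (kermx A) *m A = 0 by rewrite -row_mul mulmx_ker row0.
set u := row i _ in nz * => uA.
have ut : u^T != 0 by rewrite -[0]trmx0 (inj_eq (@trmx_inj _ _ _)).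
move: (pA _ ut).
by rewrite /quad trmxK uA mul0mx mxE ltxx => ->.
Qed.

Lemma posdef_gram n m (L : 'M[R]_(m, n)) : \rank L = n -> posdef (L^T *m L).
Proof.
move=> rL; split; first by rewrite trmx_mul trmxK.
move=> x xn0; rewrite lt_neqAle quad_gram_ge0 andbT eq_sym.
apply: contra xn0; rewrite quad_gram psumr_eq0; last by move=> *; exact: sqr_ge0.
move=> /allP Lx0.
have {}Lx0 : L *m x = 0.
  by apply/colP => i; have := Lx0 i (mem_index_enum _); rewrite /= sqrf_eq0 => /eqP ->; rewrite mxE.
have fL : row_free L^T by rewrite /row_free mxrank_tr rL.
have : x^T *m L^T = 0 by rewrite -trmx_mul Lx0 trmx0.
move/eqP; rewrite -(mul0mx 1 L^T) (inj_eq (row_free_inj fL)) => /eqP x0.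
by rewrite -[x]trmxK x0 trmx0.
Qed.

Lemma posdefD n (A B : 'M[R]_n) : posdef A -> posdef B -> posdef (A + B).
Proof.
move=> [sA pA] [sB pB]; split; first by rewrite linearD/= sA sB.
by move=> x x0; rewrite quadD addr_gt0 ?pA ?pB.
Qed.

Lemma posdefZ n c (A : 'M[R]_n) : 0 < c -> posdef A -> posdef (c *: A).
Proof.
move=> c0 [sA pA]; split; first by rewrite linearZ/= sA.
by move=> x x0; rewrite quadZ mulr_gt0 ?pA.
Qed.

Lemma posdef_inv n (A : 'M[R]_n) : posdef A -> posdef (invmx A).
Proof.
move=> pA; have uA := posdef_unit pA; case: pA => sA pA.
have sI : (invmx A)^T = invmx A by rewrite trmx_inv sA.
split => // x x0.
have -> : quad (invmx A) x = quad A (invmx A *m x).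
  by rewrite -quad_mul sI mulVmx// mul1mx.
apply: pA; apply: contra x0 => /eqP /(congr1 (mulmx A)).
by rewrite mulmxA mulmxV// mul1mx mulmx0 => ->.
Qed.

(* Cholesky factorization, by elimination of the first row and column. *)
Lemma posdef_factor n (A : 'M[R]_n) : posdef A -> exists L : 'M[R]_n, L^T *m L = A.
Proof.
elim: n A => [|n IH] A pA.
  by exists 0; apply/matrixP => -[].
move: A pA; rewrite -[n.+1]/(1 + n)%N => A [sA pA].
set a := A 0 0; set b := dlsubmx A; set D := drsubmx A.
have bE : ursubmx A = b^T by rewrite /b -[in RHS]sA -trmx_ursub trmxK.
have aE : ulsubmx A = a%:M.
  by rewrite [LHS]mx11_scalar mxE mxE; congr (A _ _)%:M; apply: val_inj.
have AE : A = block_mx a%:M b^T b D by rewrite -bE -aE submxK.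
have sD : D^T = D by rewrite /D trmx_drsub sA.
have a0 : 0 < a.
  have /pA : delta_mx 0 0 != 0 :> 'cV[R]_(1 + n).
    by apply/eqP => /matrixP /(_ 0 0) /eqP; rewrite !mxE eqxx oner_eq0.
  by rewrite /quad trmx_delta -rowE -colE !mxE.
have [L LE] : exists L : 'M[R]_n, L^T *m L = D - a^-1 *: (b *m b^T).
  apply: IH; split; first by rewrite linearB linearZ/= sD trmx_mul trmxK.
  (* The first entry of this vector minimizes the form for given [x]; the value left is that of the
     Schur complement. *)
  move=> x x0; have := pA (col_mx (- a^-1 *: (b^T *m x)) x).
  rewrite col_mx_eq0 (negbTE x0) andbF => /(_ isT); rewrite /quad AE.
  rewrite tr_col_mx mul_row_block mul_row_col [(_ *: _)^T]linearZ/= trmx_mul trmxK.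
  have -> : - a^-1 *: (x^T *m b) *m a%:M + x^T *m b = 0.
    by rewrite -scalemxAl mul_mx_scalar scalerA mulNr mulVf ?gt_eqF// scaleN1r addNr.
  by rewrite mul0mx add0r mulmxBr -scalemxAr !mulmxA -scalemxAl scaleNr addrC.
exists (block_mx (Num.sqrt a)%:M ((Num.sqrt a)^-1 *: b^T) 0 L).
have sa : Num.sqrt a != 0 by rewrite gt_eqF// sqrtr_gt0.
rewrite tr_block_mx mulmx_block [(_ *: _)^T]linearZ/= trmxK tr_scalar_mx trmx0 !mul0mx mulmx0 !addr0 AE.
congr block_mx.
- by rewrite -scalar_mxM -expr2 sqr_sqrtr// ltW.
- by rewrite mul_scalar_mx scalerA mulfV// scale1r.
- by rewrite mul_mx_scalar scalerA mulfV// scale1r.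
- by rewrite LE -scalemxAr -scalemxAl scalerA -invfM -expr2 sqr_sqrtr ?ltW// addrC subrK.
Qed.

(** The factorization makes the determinant a square, and invertibility makes it nonzero. *)
Lemma posdef_det_gt0 n (A : 'M[R]_n) : posdef A -> 0 < \det A.
Proof.
move=> pA; have := posdef_unit pA; have [L <-] := posdef_factor pA.
by rewrite unitmxE unitfE det_mulmx det_tr -expr2 lt_neqAle sqr_ge0 andbT eq_sym.
Qed.

End PosDef.

(* Total version of [invmx]: an everywhere rational function of the entries. *)
Definition adjinv (R : realType) n (A : 'M[R]_n) : 'M[R]_n := (\det A)^-1 *: \adj A.

Lemma adjinvE (R : realType) n (A : 'M[R]_n) : A \in unitmx -> adjinv A = invmx A.
Proof. by rewrite /invmx => ->. Qed.

(** For positive definite [S] this is, up to a constant, minus twice the log-density at [theta] of a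
    centred Gaussian vector with covariance [S]. *)
Definition eb_crit (R : realType) n (theta : 'cV[R]_n) (S : 'M[R]_n) : R :=
  quad (adjinv S) theta + ln (\det S).

Section Reduction.
Context {R : realType} {N n : nat}.
Variables (Phi : 'M[R]_(N, n)) (sigma : R) (P : 'M[R]_n).
Hypotheses (sigma_gt0 : 0 < sigma) (rPhi : \rank Phi = n) (pP : posdef P).

Let G := Phi^T *m Phi.
Let S := P + sigma ^+ 2 *: invmx G.
Let s2 := sigma ^+ 2.
Let s2_gt0 : 0 < s2. Proof. by rewrite exprn_gt0. Qed.
Let s2_neq0 : s2 != 0. Proof. by rewrite gt_eqF. Qed.
Let pG : posdef G. Proof. exact: posdef_gram. Qed.
Let uG : G \in unitmx. Proof. exact: posdef_unit. Qed.
Let pS : posdef S.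
Proof. by apply: posdefD => //; apply: posdefZ => //; exact: posdef_inv. Qed.
Let uS : S \in unitmx. Proof. exact: posdef_unit. Qed.
Let H := Phi *m invmx G *m Phi^T.

(** [H] is the orthogonal projection onto the column space of [Phi]. On its complement [Qmx] is
    multiplication by [s2]; on the column space it acts through [S], because
    [Qmx *m Phi = Phi *m S *m G]. The two partial inverses add up. *)
Lemma Qmx_inv :
  Qmx Phi sigma P \in unitmx /\
  invmx (Qmx Phi sigma P) = s2^-1 *: (1%:M - H) +
    (invmx G *m Phi^T)^T *m invmx S *m (invmx G *m Phi^T).
Proof.
set X := RHS; have QX : Qmx Phi sigma P *m X = 1%:M.
  have PH : Phi^T *m (1%:M - H) = 0.
    by rewrite mulmxBr mulmx1 /H !mulmxA mulmxV// mul1mx subrr.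
  have GT : (invmx G *m Phi^T)^T = Phi *m invmx G.
    by rewrite trmx_mul trmxK trmx_inv; congr (_ *m invmx _); case: pG.
  rewrite mulmxDr; have -> : Qmx Phi sigma P *m (s2^-1 *: (1%:M - H)) = 1%:M - H.
    rewrite -scalemxAr /Qmx mulmxDl -[_ *m Phi^T *m _]mulmxA PH mulmx0 add0r mul_scalar_mx.
    by rewrite scalerA mulVf// scale1r.
  rewrite GT; have -> : Qmx Phi sigma P *m (Phi *m invmx G *m invmx S *m (invmx G *m Phi^T)) = H.
    rewrite /Qmx !mulmxA mulmxDl mul_scalar_mx.
    have -> : Phi *m P *m Phi^T *m Phi + sigma ^+ 2 *: Phi = Phi *m S *m G.
      rewrite -[RHS]mulmxA mulmxDl mulmxDr -scalemxAl mulVmx// !mulmxA; congr (_ + _).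
      by rewrite -scalemxAr mulmx1.
    by rewrite mulmxK// mulmxK.
  by rewrite subrK.
have [uQ _] := mulmx1_unit QX; split => //.
by rewrite -[RHS]mul1mx -(mulVmx uQ) -mulmxA QX mulmx1.
Qed.

(** Sylvester's identity passes from size [N] to size [n], where [1 + s2^-1 G P] factors as
    [s2^-1 G S]. *)
Lemma det_Qmx : \det (Qmx Phi sigma P) = s2 ^+ N * \det (s2^-1 *: G) * \det S.
Proof.
have -> : Qmx Phi sigma P = s2 *: (1%:M + (s2^-1 *: Phi *m P) *m Phi^T).
  by rewrite scalerDr -!scalemxAl scalerA mulfV// scale1r scalemx1 addrC.
rewrite detZ det_add1_mulC -mulrA -det_mulmx; congr (_ * \det _).
have -> : s2^-1 *: G *m S = s2^-1 *: (G *m P) + 1%:M.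
  rewrite /S mulmxDr -scalemxAr -!scalemxAl mulmxV// scalerA mulfV// scale1r //.
by rewrite addrC -!scalemxAl -scalemxAr mulmxA.
Qed.

Lemma F_EB_reduce Y : F_EB Phi sigma Y P =
  quad (s2^-1 *: (1%:M - H)) Y + ln (s2 ^+ N * \det (s2^-1 *: G)) +
  eb_crit (invmx G *m Phi^T *m Y) S.
Proof.
rewrite /F_EB /eb_crit adjinvE// (proj2 Qmx_inv) quadD quad_mul det_Qmx lnM ?posrE.
- by rewrite addrACA.
- by rewrite mulr_gt0 ?exprn_gt0// posdef_det_gt0//; apply: posdefZ; rewrite ?invr_gt0.
- exact: posdef_det_gt0.
Qed.

End Reduction.

(** * Calculus with matrices *)

Section MxDiff.
Context {R : realType} {V : normedModType R}.

(** Entrywise form, so that the scalar rules reach products, determinants and cofactors; [mx_diffP]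
    identifies it with differentiability. *)
Definition mx_diff m n (f : V -> 'M[R]_(m, n)) (x : V) :=
  forall i j, differentiable (fun y => f y i j : R) x.

Lemma differentiable_bigsum (I : Type) (r : seq I) (Q : pred I) (F : I -> V -> R) x :
  (forall i, differentiable (F i) x) ->
  differentiable (fun y => \sum_(i <- r | Q i) F i y) x.
Proof.
move=> dF; rewrite -fct_sumE; elim/big_ind : _ => // g h dg dh.
exact: differentiableD.
Qed.

Lemma differentiable_bigprod (I : Type) (r : seq I) (F : I -> V -> R) x :
  (forall i, differentiable (F i) x) ->
  differentiable (fun y => \prod_(i <- r) F i y) x.
Proof.
move=> dF; elim: r => [|i r IH].
  under [X in differentiable X _]boolp.eq_fun do rewrite big_nil.
  exact: differentiable_cst.
under [X in differentiable X _]boolp.eq_fun do rewrite big_cons.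
exact: (differentiableM (dF i) IH).
Qed.

Lemma mx_diff_cst m n (A : 'M[R]_(m, n)) x : mx_diff (cst A) x.
Proof. by move=> i j; exact: differentiable_cst. Qed.

Lemma mx_diffD m n (f g : V -> 'M[R]_(m, n)) x :
  mx_diff f x -> mx_diff g x -> mx_diff (fun y => f y + g y) x.
Proof.
move=> df dg i j; under [X in differentiable X _]boolp.eq_fun do rewrite mxE.
exact: (differentiableD (df i j) (dg i j)).
Qed.

Lemma mx_diffN m n (f : V -> 'M[R]_(m, n)) x :
  mx_diff f x -> mx_diff (fun y => - f y) x.
Proof.
move=> df i j; under [X in differentiable X _]boolp.eq_fun do rewrite mxE.
exact: (differentiableN (df i j)).
Qed.

Lemma mx_diffZ m n (k : V -> R) (f : V -> 'M[R]_(m, n)) x :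
  differentiable k x -> mx_diff f x -> mx_diff (fun y => k y *: f y) x.
Proof.
move=> dk df i j; under [X in differentiable X _]boolp.eq_fun do rewrite mxE.
exact: (differentiableM dk (df i j)).
Qed.

Lemma mx_diffM m n q (f : V -> 'M[R]_(m, n)) (g : V -> 'M[R]_(n, q)) x :
  mx_diff f x -> mx_diff g x -> mx_diff (fun y => f y *m g y) x.
Proof.
move=> df dg i j; under [X in differentiable X _]boolp.eq_fun do rewrite mxE.
apply: differentiable_bigsum => k; exact: (differentiableM (df i k) (dg k j)).
Qed.

Lemma mx_diff_tr m n (f : V -> 'M[R]_(m, n)) x :
  mx_diff f x -> mx_diff (fun y => (f y)^T) x.
Proof.
by move=> df i j; under [X in differentiable X _]boolp.eq_fun do rewrite mxE; exact: df.
Qed.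

Lemma differentiable_mxtrace n (f : V -> 'M[R]_n) x :
  mx_diff f x -> differentiable (fun y => \tr (f y) : R) x.
Proof. by move=> df; apply: differentiable_bigsum => i; exact: df. Qed.

Lemma differentiable_det n (f : V -> 'M[R]_n) x :
  mx_diff f x -> differentiable (fun y => \det (f y) : R) x.
Proof.
move=> df; apply: differentiable_bigsum => s.
apply: (@differentiableM _ _ (cst _)); first exact: differentiable_cst.
by apply: differentiable_bigprod => i; exact: df.
Qed.

Lemma mx_diff_adj n (f : V -> 'M[R]_n) x :
  mx_diff f x -> mx_diff (fun y => \adj (f y)) x.
Proof.
move=> df i j; under [X in differentiable X _]boolp.eq_fun do rewrite mxE /cofactor.
apply: (@differentiableM _ _ (cst _)); first exact: differentiable_cst.
apply: differentiable_det => k l.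
under [X in differentiable X _]boolp.eq_fun do rewrite !mxE.
exact: df.
Qed.

Lemma mx_diff_adjinv n (f : V -> 'M[R]_n) x :
  mx_diff f x -> f x \in unitmx -> mx_diff (fun y => adjinv (f y)) x.
Proof.
move=> df; rewrite unitmxE unitfE => u; apply: mx_diffZ; last exact: mx_diff_adj.
by apply: differentiableV => //; exact: differentiable_det.
Qed.

Lemma differentiable_ln (f : V -> R) x :
  differentiable f x -> 0 < f x -> differentiable (fun y => ln (f y)) x.
Proof.
move=> df f0; apply: (differentiable_comp df).
by apply/derivable1_diffP; have [] := is_derive1_ln f0.
Qed.

Lemma differentiable_quad n (f : V -> 'M[R]_n) (g : V -> 'cV[R]_n) x :
  mx_diff f x -> mx_diff g x -> differentiable (fun y => quad (f y) (g y) : R) x.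
Proof.
move=> df dg; apply: (mx_diffM (mx_diffM (mx_diff_tr dg) df) dg).
Qed.

Lemma differentiable_eb_crit n (f : V -> 'M[R]_n) (g : V -> 'cV[R]_n) x :
  mx_diff f x -> mx_diff g x -> 0 < \det (f x) ->
  differentiable (fun y => eb_crit (g y) (f y)) x.
Proof.
move=> df dg f0; apply: differentiableD.
  apply: differentiable_quad => //; apply: mx_diff_adjinv => //.
  by rewrite unitmxE unitfE gt_eqF.
by apply: differentiable_ln => //; exact: differentiable_det.
Qed.

Lemma mx_diff_derivable m n (f : V -> 'M[R]_(m, n)) x v :
  mx_diff f x -> derivable f x v.
Proof. by move=> df; apply/derivable_mxP => i j; exact/diff_derivable/df. Qed.

Lemma mx_diffP m n (f : V -> 'M[R]_(m, n)) x : mx_diff f x <-> differentiable f x.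
Proof.
split=> [df|df i j]; last first.
  apply: (@differentiable_comp _ _ _ _ f (fun A : 'M[R]_(m, n) => A i j)) => //.
  exact: differentiable_coord.
have -> : f = (fun y => \sum_i \sum_j f y i j *: delta_mx i j).
  by apply/funext => y; rewrite -matrix_sum_delta.
rewrite -fct_sumE; apply: differentiable_sum => i.
rewrite -fct_sumE; apply: differentiable_sum => j.
exact: differentiableZl.
Qed.

Lemma derive_entry m n (f : V -> 'M[R]_(m, n)) x v i j :
  derivable f x v -> ('D_v f x) i j = 'D_v (fun y => f y i j : R) x.
Proof. by move=> df; rewrite derive_mx// mxE. Qed.

Lemma derive_mulmx m n q (f : V -> 'M[R]_(m, n)) (g : V -> 'M[R]_(n, q)) x v :
  derivable f x v -> derivable g x v ->
  derivable (fun y => f y *m g y) x v /\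
  'D_v (fun y => f y *m g y) x = 'D_v f x *m g x + f x *m 'D_v g x.
Proof.
move=> df dg; have dfi := iffLR (derivable_mxP _ _ _) df.
have dgi := iffLR (derivable_mxP _ _ _) dg.
have E i j : (fun y => (f y *m g y) i j) =
    \sum_k ((fun y => f y i k : R) * (fun y => g y k j)) :> (V -> R).
  by apply/funext => y; rewrite mxE fct_sumE.
have d1 : derivable (fun y => f y *m g y) x v.
  by apply/derivable_mxP => i j; rewrite E; apply: derivable_sum => k; exact: derivableM.
split => //; apply/matrixP => i j; rewrite derive_entry// E derive_sum; last first.
  by move=> k; exact: derivableM.
rewrite !mxE -big_split; apply: eq_bigr => k _ /=.
rewrite deriveM// !derive_entry// addrC; congr (_ + _).
by rewrite [LHS]mulrC.
Qed.

Lemma derive_mxtrace n (f : V -> 'M[R]_n) x v :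
  derivable f x v ->
  derivable (fun y => \tr (f y) : R) x v /\ 'D_v (fun y => \tr (f y) : R) x = \tr ('D_v f x).
Proof.
move=> df; have dfi := iffLR (derivable_mxP _ _ _) df.
have -> : (fun y => \tr (f y)) = \sum_k (fun y => f y k k) :> (V -> R).
  by apply/funext => y; rewrite fct_sumE.
split; first exact: derivable_sum.
by rewrite derive_sum//; apply: eq_bigr => k _; rewrite derive_entry.
Qed.

(** Obtained by differentiating [f y *m adjinv (f y) = 1], an identity that holds only near [x],
    where the determinant stays nonzero. *)
Lemma derive_adjinv n (f : V -> 'M[R]_n) x v :
  differentiable f x -> f x \in unitmx ->
  'D_v (fun y => adjinv (f y)) x = - (adjinv (f x) *m 'D_v f x *m adjinv (f x)).
Proof.
move=> df u; have mf := iffRL (mx_diffP f x) df.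
have dI : derivable (fun y => adjinv (f y)) x v by exact/mx_diff_derivable/mx_diff_adjinv.
have df' : derivable f x v by exact: diff_derivable.
have [_ E] := derive_mulmx df' dI.
have : 'D_v (fun y => f y *m adjinv (f y)) x = 0.
  rewrite -(derive_cst (1%:M : 'M[R]_n) x v); apply: near_eq_derive.
  have dc : {for x, continuous (fun y => \det (f y) : R)}.
    by apply: differentiable_continuous; exact: differentiable_det.
  have d0 : \det (f x) != 0 by move: u; rewrite unitmxE unitfE.
  move/cvgr_neq0 : dc => /(_ d0); apply: filterS => y fy.
  by rewrite adjinvE ?unitmxE ?unitfE// mulmxV// unitmxE unitfE.
rewrite E => /eqP; rewrite addrC addr_eq0 => /eqP /(congr1 (mulmx (adjinv (f x)))).
by rewrite mulmxA {1}adjinvE// mulVmx// mul1mx mulmxN mulmxA.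
Qed.

End MxDiff.

Section Jacobi.
Context {R : realType}.

(** In the expansion along row [i], a change of the entry [(i, j)] leaves the cofactors of that row
    alone, so the determinant is affine in this entry. *)
Lemma derive_det_delta n (A : 'M[R]_n) i j :
  'D_(delta_mx i j) (fun B : 'M[R]_n => \det B : R) A = cofactor A i j.
Proof.
rewrite /derive; apply: lim_near_cst => //; near=> h.
have h0 : h != 0 by near: h; exact: nbhs_dnbhs_neq.
rewrite /= (expand_det_row _ i) [\det A](expand_det_row _ i) -sumrB (bigD1 j)//= big1 => [|k kj].
  rewrite !mxE !eqxx addr0 /cofactor.
  have -> : row' i (col' j (h *: delta_mx i j + A)) = row' i (col' j A).
    by apply/matrixP => k l; rewrite !mxE eq_sym (negbTE (neq_lift _ _)) mulr0 add0r.
  by rewrite mulr1 -mulrBl addrK /GRing.scale /= mulrA mulVf// mul1r.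
rewrite !mxE (negbTE kj) andbF mulr0 add0r -mulrBr /cofactor.
have -> : row' i (col' k (h *: delta_mx i j + A)) = row' i (col' k A).
  by apply/matrixP => a b; rewrite !mxE eq_sym (negbTE (neq_lift _ _)) mulr0 add0r.
by rewrite subrr mulr0.
Unshelve. all: by end_near. Qed.

Context {V : normedModType R}.

(** Jacobi's formula: the chain rule, with the increment decomposed over the elementary matrices. *)
Lemma derive_det n (f : V -> 'M[R]_n) x v : differentiable f x ->
  'D_v (fun y => \det (f y) : R) x = \tr (\adj (f x) *m 'D_v f x).
Proof.
move=> df; have mf := iffRL (mx_diffP f x) df.
have ddet : differentiable (fun B : 'M[R]_n => \det B : R) (f x).
  by apply: differentiable_det => i j; exact: differentiable_coord.
rewrite deriveE; last exact: differentiable_det.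
rewrite (diff_comp df ddet) /= -(deriveE v df).
rewrite {1}['D_v f x]matrix_sum_delta linear_sum /mxtrace /=.
under [RHS]eq_bigr do rewrite mxE.
rewrite [RHS]exchange_big; apply: eq_bigr => i _ /=; rewrite linear_sum.
apply: eq_bigr => j _ /=; rewrite linearZ/= -deriveE// derive_det_delta mxE.
by rewrite /GRing.scale/= mulrC.
Qed.

Lemma derive_ln_det n (f : V -> 'M[R]_n) x v : differentiable f x ->
  0 < \det (f x) ->
  'D_v (fun y => ln (\det (f y)) : R) x = \tr (adjinv (f x) *m 'D_v f x).
Proof.
move=> df f0; have mf := iffRL (mx_diffP f x) df.
have ddet : differentiable (fun y => \det (f y) : R) x by exact: differentiable_det.
have [dln lnE] := is_derive1_ln f0.
have {}dln : differentiable (@ln R) (\det (f x)) by exact/derivable1_diffP.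
rewrite deriveE; last exact: differentiable_ln.
rewrite (diff_comp ddet dln) /= -(deriveE v ddet) derive_det//.
rewrite -[X in 'd _ _ X]mulr1 -[X in 'd _ _ X]/(_ *: (1 : R)) linearZ/= -deriveE// lnE.
by rewrite /adjinv -scalemxAl mxtraceZ /GRing.scale/= mulrC.
Qed.

Lemma derive_quad n (f : V -> 'M[R]_n) (t : 'cV[R]_n) x v : derivable f x v ->
  derivable (fun y => quad (f y) t : R) x v /\
  'D_v (fun y => quad (f y) t : R) x = quad ('D_v f x) t.
Proof.
move=> df.
have [d1 E1] := derive_mulmx (derivable_cst (t^T) x v) df.
have [d2 E2] := derive_mulmx d1 (derivable_cst t x v).
split; first exact: (iffLR (derivable_mxP _ _ _) d2).
rewrite /quad -(derive_entry 0 0 d2) E2 E1 !derive_cst mul0mx add0r mulmx0 addr0.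
by [].
Qed.

Lemma derive_eb_crit n (f : V -> 'M[R]_n) t x v : differentiable f x ->
  0 < \det (f x) ->
  'D_v (fun y => eb_crit t (f y)) x =
  - quad (adjinv (f x) *m 'D_v f x *m adjinv (f x)) t + \tr (adjinv (f x) *m 'D_v f x).
Proof.
move=> df f0; have mf := iffRL (mx_diffP f x) df.
have u : f x \in unitmx by rewrite unitmxE unitfE gt_eqF.
have [d1 E1] := derive_quad t (mx_diff_derivable (mx_diff_adjinv mf u) : derivable _ x v).
have d2 : derivable (fun y => ln (\det (f y)) : R) x v.
  by apply: diff_derivable; apply: differentiable_ln => //; exact: differentiable_det.
rewrite [LHS](deriveD d1 d2) E1 derive_adjinv// derive_ln_det//; congr (_ + _).
by rewrite -scaleN1r quadZ mulN1r.
Qed.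

End Jacobi.

(** * Mean value theorem along a line and symmetry of second derivatives *)

Section LineCalculus.
Context {R : realType} {V : normedModType R}.
Implicit Types (f : V -> R) (x u v : V).

Lemma is_derive_line f x v s : derivable f (s *: v + x) v ->
  is_derive s (1 : R) (fun s => f (s *: v + x)) ('D_v f (s *: v + x)).
Proof.
move=> df.
have E : (fun h : R => h^-1 *: (((fun s => f (s *: v + x)) \o shift s) (h *: (1 : R)) -
    f (s *: v + x))) =
  (fun h => h^-1 *: ((f \o shift (s *: v + x)) (h *: v) - f (s *: v + x))).
  apply/funext => h /=; congr (_ *: (f _ - _)).
  by rewrite addrA -scalerDl; congr ((_ + _) *: _ + _); exact: mulr1.
by apply: DeriveDef; rewrite ?/derivable ?/derive E.
Qed.

Lemma mvt_line f x v t : (forall s, `|s| <= `|t| -> derivable f (s *: v + x) v) ->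
  exists2 c, `|c| <= `|t| & f (t *: v + x) - f x = t * 'D_v f (c *: v + x).
Proof.
move=> df; have [t0|/ltW t0] := leP 0 t.
  have [||c] := @MVT_segment _ (fun s => f (s *: v + x)) (fun s => 'D_v f (s *: v + x)) 0 t t0.
  - move=> s; rewrite in_itv/= => /andP[s0 st]; apply: is_derive_line; apply: df.
    by move: s0 st => /ltW s0 /ltW st; rewrite !ger0_norm.
  - apply: derivable_within_continuous => s; rewrite in_itv/= => /andP[s0 st].
    have [] // := @is_derive_line f x v s _; apply: df.
    by rewrite !ger0_norm.
  rewrite in_itv/= => /andP[c0 ct] E; exists c; first by rewrite !ger0_norm.
  by move: E; rewrite scale0r add0r subr0 mulrC.
have [||c] := @MVT_segment _ (fun s => f (s *: v + x)) (fun s => 'D_v f (s *: v + x)) t 0 t0.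
- move=> s; rewrite in_itv/= => /andP[s0 st]; apply: is_derive_line; apply: df.
  by move: s0 st => /ltW s0 /ltW st; rewrite !ler0_norm ?lerN2.
- apply: derivable_within_continuous => s; rewrite in_itv/= => /andP[s0 st].
  have [] // := @is_derive_line f x v s _; apply: df.
  by rewrite !ler0_norm ?lerN2.
rewrite in_itv/= => /andP[c0 ct] E; exists c; first by rewrite !ler0_norm ?lerN2.
by rewrite -opprB; move: E; rewrite scale0r !add0r => ->; rewrite mulrN opprK mulrC.
Qed.

Lemma diff_eps {W : normedModType R} (f : V -> W) x e : 0 < e -> differentiable f x ->
  \forall h \near 0, `|f (h + x) - f x - 'd f x h| <= e * `|h|.
Proof.
move=> e0 /diff_locallyP[_ /eqaddoP /(_ _ e0)]; apply: filterS => h.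
by rewrite /= opprD addrA.
Qed.

Lemma derivable_shift f w x u :
  derivable (fun y => f (w + y)) x u = derivable f (w + x) u.
Proof.
rewrite /derivable; apply: (f_equal (fun q : R -> R => cvg (q @ 0^'))); apply/funext => h /=.
by congr (_ *: (f _ - _)); rewrite addrCA.
Qed.

Lemma derive_shift f w x u : 'D_u (fun y => f (w + y)) x = 'D_u f (w + x).
Proof.
rewrite /derive; apply: (f_equal (fun q : R -> R => lim (q @ 0^'))); apply/funext => h /=.
by congr (_ *: (f _ - _)); rewrite addrCA.
Qed.

(** The mean value theorem along [u] is applied to [y |-> f (t v + y) - f y]; the two values of
    ['D_u f] that appear are then linearized at [x]. Differentiability of ['D_u f] at the single
    point [x] suffices for this. *)
Lemma young_half f x u v e : 0 < e ->
  (\forall y \near x, derivable f y u) -> differentiable ('D_u f) x ->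
  \forall t \near (0 : R), `|f (t *: u + t *: v + x) - f (t *: v + x) - f (t *: u + x) + f x
     - t ^+ 2 * 'D_v ('D_u f) x| <= e * t ^+ 2.
Proof.
move=> e0 df ddf.
(* [|t| * c0] bounds every [a u + b v] with [|a|, |b| <= |t|]; the summand 1 makes [c0] positive.
   The tolerance [e / (2 * c0)] is spent twice, once for each value of ['D_u f]. *)
set c0 := `|u| + `|v| + 1.
have c00 : 0 < c0 by rewrite ltr_wpDl ?addr_ge0.
have e1 : 0 < e / (2 * c0) by rewrite divr_gt0// mulr_gt0.
have : \forall h \near (0 : V), derivable f (h + x) u /\
    `|'D_u f (h + x) - 'D_u f x - 'd ('D_u f) x h| <= e / (2 * c0) * `|h|.
  near=> h; split; last by near: h; exact: diff_eps.
  near: h; move: df; rewrite (near_shift 0) subr0; exact.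
move=> /nbhs_norm0P[r /= r0 Hr].
near=> t.
have tr : `|t| * c0 < r.
  rewrite -ltr_pdivlMr//; near: t; have rc0 : 0 < r / c0 by exact: divr_gt0.
  exact: (@pseudometric_normed_Zmodule.nbhs0_lt _ R _ rc0).
have sm a b : `|a| <= `|t| -> `|b| <= `|t| -> `|a *: u + b *: v| <= `|t| * c0.
  move=> at_ bt; rewrite (le_trans (ler_normD _ _))// !normrZ.
  rewrite /c0 -addrA !mulrDr !lerD ?ler_wpM2r// ler_wpDr ?ler_wpM2r// mulr_ge0//.
have sm' a b : `|a| <= `|t| -> `|b| <= `|t| -> `|a *: u + b *: v| < r.
  by move=> *; exact: le_lt_trans (sm _ _ _ _) tr.
have t0 : `|0 : R| <= `|t| by rewrite normr0.
pose g : V -> R := (fun y => f (t *: v + y)) - f.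
have gE y : g y = f (t *: v + y) - f y by [].
have gd s : `|s| <= `|t| -> derivable g (s *: u + x) u /\
   'D_u g (s *: u + x) = 'D_u f (s *: u + t *: v + x) - 'D_u f (s *: u + x).
  move=> st.
  have [d1 _] := Hr _ (sm' _ _ st (lexx _)).
  have := Hr _ (sm' _ _ st t0); rewrite scale0r addr0 => -[d2 _].
  have E : t *: v + (s *: u + x) = s *: u + t *: v + x by rewrite addrCA addrA.
  rewrite -E in d1 *; have d3 : derivable (fun y => f (t *: v + y)) (s *: u + x) u.
    by rewrite derivable_shift.
  split; first exact: (derivableB d3 d2).
  by rewrite (deriveB d3 d2) derive_shift.
have [c ct] := @mvt_line g x u t (fun s st => (gd s st).1).
rewrite (gd _ ct).2 !gE => E.
have -> : f (t *: u + t *: v + x) - f (t *: v + x) - f (t *: u + x) + f x =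
    t * ('D_u f (c *: u + t *: v + x) - 'D_u f (c *: u + x)).
  rewrite -E (addrCA (t *: v)) -(addrA (t *: u)); ring.
have [_ H1] := Hr _ (sm' _ _ ct (lexx _)).
have [_ H2] := Hr _ (sm' _ _ ct t0).
rewrite scale0r addr0 in H2.
rewrite expr2 -mulrA -mulrBr normrM -expr2 -[t ^+ 2]ger0_norm ?sqr_ge0// normrX expr2 mulrCA.
rewrite ler_wpM2l//.
have -> : t * 'D_v ('D_u f) x = 'd ('D_u f) x (c *: u + t *: v) - 'd ('D_u f) x (c *: u).
  by rewrite -linearB/= addrAC subrr add0r linearZ/= -deriveE.
have -> a b a0 b0 : a - b - (a0 - b0) = (a - 'D_u f x - a0) - (b - 'D_u f x - b0) :> R.
  by rewrite !opprB; ring.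
rewrite (le_trans (ler_normB _ _))//.
have -> : e * `|t| = e / (2 * c0) * (`|t| * c0) + e / (2 * c0) * (`|t| * c0).
  by field; rewrite gt_eqF.
apply: lerD; [apply: (le_trans H1) | apply: (le_trans H2)]; rewrite ler_wpM2l ?(ltW e1)//.
  exact: sm.
by have := sm _ _ ct t0; rewrite scale0r addr0.
Unshelve. all: by end_near. Qed.

Lemma close_of_common_square (L L' a b e s : R) : L = L' -> 0 < s ->
  `|L - s * a| <= e / 2 * s -> `|L' - s * b| <= e / 2 * s -> `|a - b| <= e.
Proof.
move=> <- s0 H1 H2; rewrite -(ler_pM2r s0) -[X in _ * X <= _](gtr0_norm s0) -normrM.
have -> : (a - b) * s = (L - s * b) - (L - s * a) by ring.
by rewrite (le_trans (ler_normB _ _))// (splitr e) mulrDl lerD.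
Qed.

(** The second difference of [f] with steps [t u] and [t v] is symmetric in [u] and [v], and divided
    by [t ^+ 2] it approaches both mixed derivatives. *)
Lemma young f x u v :
  (\forall y \near x, derivable f y u) -> (\forall y \near x, derivable f y v) ->
  differentiable ('D_u f) x -> differentiable ('D_v f) x ->
  'D_v ('D_u f) x = 'D_u ('D_v f) x.
Proof.
move=> du dv ddu ddv; apply/eqP; rewrite -subr_eq0 -normr_le0; apply/ler_addgt0Pr => e e0.
rewrite add0r; have e2 : 0 < e / 2 by rewrite divr_gt0.
have A1 := nbhs_dnbhs (young_half v e2 du ddu).
have A2 := nbhs_dnbhs (young_half u e2 dv ddv).
have [t [[t0 H1] H2]] := filter_ex (filterI (filterI (nbhs_dnbhs_neq (0 : R)) A1) A2).
have t2 : 0 < t ^+ 2 by rewrite exprn_even_gt0.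
apply: (close_of_common_square _ t2 H1 H2).
by rewrite [t *: v + t *: u]addrC; ring.
Qed.

End LineCalculus.

Section C1.
Context {R : realType} {p : nat}.
Local Notation e_ k := (delta_mx 0 k : 'rV[R]_p).

Lemma normr_mx_le m n (A : 'M[R]_(m, n)) (c : R) : 0 <= c ->
  (forall i j, `|A i j| <= c) -> `|A| <= c.
Proof.
by move=> c0 H; rewrite [leLHS]/Num.norm/= mx_normrE; apply: bigmax_le => // -[i j] _ /=.
Qed.

Lemma normr_entry_le m n (A : 'M[R]_(m, n)) i j : `|A i j| <= `|A|.
Proof.
rewrite [leRHS]/Num.norm/= mx_normrE.
by apply: (le_bigmax _ (fun ij : 'I_m * 'I_n => `|A ij.1 ij.2|) (i, j)).
Qed.

(* The increment is split along the coordinate path [tr j], which stays in the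
   ball of radius [`|h|]. *)
Lemma C1_differentiable (f : 'rV[R]_p -> R) x :
  (\forall y \near x, forall k, derivable f y (e_ k)) ->
  (forall k, {for x, continuous ('D_(e_ k) f)}) -> differentiable f x.
Proof.
move=> df cf.
pose L := fun h : 'rV[R]_p => \sum_k h 0 k * 'D_(e_ k) f x.
have Llin : linear L.
  move=> a u v; rewrite /L scaler_sumr -big_split; apply: eq_bigr => k _ /=.
  by rewrite !mxE mulrDl /GRing.scale/= mulrA.
pose LL : {linear 'rV[R]_p -> R} := HB.pack L (GRing.isLinear.Build _ _ _ _ L Llin).
have Lcont : continuous LL.
  move=> h; apply: differentiable_continuous; rewrite /LL/= /L.
  apply: differentiable_bigsum => k.
  by apply: (@differentiableM _ _ (fun h : 'rV[R]_p => h 0 k) (cst _)) => //;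
    exact: differentiable_coord.
have main : f \o shift x = cst (f x) + LL +o_ 0 id.
  apply/eqaddoP => e e0.
  (* The error is shared among [p] coordinate steps; [p.+1] keeps the denominator positive when
     [p = 0]. *)
  have e1 : 0 < e / (p.+1)%:R by rewrite divr_gt0// ltr0n.
  have : \forall y \near x, forall k, derivable f y (e_ k) /\
      `|'D_(e_ k) f y - 'D_(e_ k) f x| <= e / (p.+1)%:R.
    near=> y => k; split; first by move: k; near: y.
    move: k; near: y; apply: filter_forall => k.
    have /cvgr_dist_le /(_ _ e1) := cf k; apply: filterS => y.
    by rewrite distrC.
  move=> /nbhs_normP[r /= r0 Hr].
  near=> h.
  have hr : `|h| < r by near: h; exact: (@pseudometric_normed_Zmodule.nbhs0_lt _ 'rV[R]_p _ r0).
  pose tr j : 'rV[R]_p := \row_k (if (k < j)%N then h 0 k else 0).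
  have tr0 : tr 0%N = 0 by apply/rowP => k; rewrite !mxE.
  have trp : tr p = h by apply/rowP => k; rewrite !mxE ltn_ord.
  have trS (j : 'I_p) : tr j.+1 = h 0 j *: e_ j + tr j.
    apply/rowP => k; rewrite !mxE ltnS leq_eqVlt eqxx /=.
    have [->|kj] := eqVneq k j; first by rewrite eqxx ltnn mulr1 addr0.
    by rewrite -val_eqE in kj; rewrite (negbTE kj) mulr0 add0r.
  have near_tr (j : 'I_p) c : `|c| <= `|h 0 j| -> `|c *: e_ j + tr j| <= `|h|.
    move=> ch; apply: normr_mx_le => // i k; rewrite (ord1 i) !mxE eqxx /=.
    have [->|kj] := eqVneq k j.
      by rewrite ltnn mulr1 addr0 (le_trans ch)// normr_entry_le.
    by rewrite mulr0 add0r; case: ifP => _; rewrite ?normr0// normr_entry_le.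
  have step (j : 'I_p) : `|f (tr j.+1 + x) - f (tr j + x) - h 0 j * 'D_(e_ j) f x| <=
      e / (p.+1)%:R * `|h|.
    have Hr' c : `|c| <= `|h 0 j| -> derivable f (c *: e_ j + (tr j + x)) (e_ j) /\
      `|'D_(e_ j) f (c *: e_ j + (tr j + x)) - 'D_(e_ j) f x| <= e / (p.+1)%:R.
      move=> ch; apply: Hr => /=; rewrite addrA opprD addrCA subrr addr0 normrN.
      exact: le_lt_trans (near_tr _ _ ch) hr.
    have [c ch] := @mvt_line _ _ f (tr j + x) (e_ j) (h 0 j) (fun s sh => (Hr' s sh).1).
    rewrite trS -(addrA (h 0 j *: _)) => ->; rewrite -mulrBr normrM mulrC ler_pM//.
      exact: (Hr' c ch).2.
    exact: normr_entry_le.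
  have -> : (f \o shift x - (cst (f x) + LL)) h =
      \sum_(j < p) (f (tr j.+1 + x) - f (tr j + x) - h 0 j * 'D_(e_ j) f x).
    rewrite sumrB -/(L h) -(big_mkord xpredT (fun j => f (tr j.+1 + x) - f (tr j + x))).
    by rewrite telescope_sumr// tr0 trp add0r /= opprD addrA.
  rewrite (le_trans (ler_norm_sum _ _ _))//.
  rewrite (le_trans (ler_sum _ (fun j _ => step j)))// sumr_const card_ord -[leLHS]mulr_natl mulrA.
  rewrite ler_wpM2r// mulrCA ler_piMr ?(ltW e0)// ler_pdivrMr ?ltr0n// mul1r ler_nat.
  exact: leqnSn.
apply/diff_locallyP; rewrite (diff_unique Lcont main); split => //.
Unshelve. all: by end_near. Qed.

End C1.

Section NearEq.
Context {R : realType} {V W : normedModType R}.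

Lemma near_eq_differentiable (f g : V -> W) x :
  (\near x, f x = g x) -> differentiable f x -> differentiable g x.
Proof.
move=> fg df; have fgx := nbhs_singleton fg.
have [cf /eqaddoP fo] := iffLR (diff_locallyP _ _) df.
have go : g \o shift x = cst (g x) + 'd f x +o_ 0 id.
  apply/eqaddoP => e /fo; move: fg; rewrite (near_shift 0) subr0 => fg.
  apply: filterS2 fg => y /= fgy.
  by rewrite !fctE fgx /= fgy.
apply/diff_locallyP; rewrite (diff_unique cf go); split => //.
Qed.

Lemma differentiable_fst x : differentiable (fst : V * W -> V) x.
Proof. by apply: linear_differentiable => y; exact: cvg_fst. Qed.

Lemma differentiable_snd x : differentiable (snd : V * W -> W) x.
Proof. by apply: linear_differentiable => y; exact: cvg_snd. Qed.

Lemma min_derive0 (f : V -> R) (U : set V) x v : nbhs x U ->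
  (forall y, U y -> derivable f y v) -> (forall y, U y -> f x <= f y) ->
  'D_v f x = 0.
Proof.
move=> Ux df fmin.
have : nbhs (0 : R) [set t | U (t *: v + x)].
  have : (fun t : R => t *: v + x) @ (0 : R) --> 0 *: v + x.
    by apply: cvgD; [apply: cvgZr_tmp; exact: cvg_id|exact: cvg_cst].
  by rewrite scale0r add0r; apply.
move=> /nbhs_normP[r /= r0 Hr].
have HU t : t \in `](- r), r[ -> U (t *: v + x).
  by rewrite in_itv/= -ltr_norml => tr; apply: Hr => /=; rewrite sub0r normrN.
have r00 : (0 : R) \in `](- r), r[ by rewrite in_itv/= oppr_lt0 r0.
have D0 := is_derive_line (df _ (HU _ r00)).
have [|||_] := @derive1_at_min _ (fun t : R => f (t *: v + x)) (- r) r 0 _ _ r00.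
- by rewrite ge0_cp // ltW.
- by move=> t tr; have [] := is_derive_line (df _ (HU _ tr)).
- by move=> t tr; rewrite scale0r add0r; apply: fmin; exact: HU.
by case: D0 => _ -> ; rewrite scale0r add0r.
Qed.

End NearEq.

Lemma derivable_entry (R : realType) (V : normedModType R) m n (f : V -> 'M[R]_(m, n)) x v i j :
  derivable f x v -> derivable (fun y => f y i j : R) x v.
Proof. by move=> /derivable_mxP; exact. Qed.

Lemma differentiable_entry (R : realType) (V : normedModType R) m n (f : V -> 'M[R]_(m, n)) x i j :
  differentiable f x -> differentiable (fun y => f y i j : R) x.
Proof. by move=> /mx_diffP; exact. Qed.

Section MxC1.
Context {R : realType} {p : nat}.
Local Notation e_ k := (delta_mx 0 k : 'rV[R]_p).
Variables (Omega : set 'rV[R]_p) (oO : open Omega).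

Lemma open_near (Q : 'rV[R]_p -> Prop) x : Omega x ->
  (forall y, Omega y -> Q y) -> \near x, Q x.
Proof. by move=> Ox H; apply: filterS (open_nbhs_nbhs (conj oO Ox)) => y; exact: H. Qed.

Lemma mx_C1_differentiable m n (f : 'rV[R]_p -> 'M[R]_(m, n)) :
  (forall x, Omega x -> forall k, derivable f x (e_ k) /\ {for x, continuous (partial k f)}) ->
  forall x, Omega x -> differentiable f x.
Proof.
move=> C1 x Ox; apply/mx_diffP => i j; apply: C1_differentiable.
  apply: open_near Ox _ => y Oy k; apply: derivable_entry.
  exact: (C1 y Oy k).1.
move=> k; have [d c] := C1 x Ox k.
have E : \forall y \near x, partial k f y i j = 'D_(e_ k) (fun y => f y i j : R) y.
  apply: open_near Ox _ => y Oy; exact: (derive_entry i j (C1 y Oy k).1).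
have cc : (fun y => partial k f y i j) @ x --> partial k f x i j.
  apply: (cvg_comp (partial k f) (fun A : 'M[R]_(m, n) => A i j) c).
  exact: coord_continuous.
move: cc; rewrite (nbhs_singleton E) => cc; apply: cvg_trans cc.
by move=> A; apply: filterS2 E => y /= ->.
Qed.

Lemma mx_young n (f : 'rV[R]_p -> 'M[R]_n) k l x : Omega x ->
  (forall y, Omega y -> differentiable f y) ->
  (forall k y, Omega y -> differentiable (partial k f) y) ->
  partial k (partial l f) x = partial l (partial k f) x.
Proof.
move=> Ox df ddf; apply/matrixP => i j.
have dk k' : derivable (partial k' f) x (e_ k).
  by apply: diff_derivable; exact: ddf.
have dl k' : derivable (partial k' f) x (e_ l).
  by apply: diff_derivable; exact: ddf.
have Ekl : partial k (partial l f) x i j = 'D_(e_ k) (fun y => partial l f y i j : R) x.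
  exact: (derive_entry i j (dk l)).
have Elk : partial l (partial k f) x i j = 'D_(e_ l) (fun y => partial k f y i j : R) x.
  exact: (derive_entry i j (dl k)).
apply: (etrans Ekl); apply: (etrans _ (esym Elk)).
have E k' : \forall y \near x, partial k' f y i j = 'D_(e_ k') (fun y => f y i j : R) y.
  apply: open_near Ox _ => y Oy.
  have d1 : derivable f y (e_ k') by apply: diff_derivable; exact: df.
  exact: (derive_entry i j d1).
apply: (etrans (near_eq_derive _ (E l))); apply: (etrans _ (esym (near_eq_derive _ (E k)))).
apply: young.
- apply: open_near Ox _ => y Oy; apply: diff_derivable; apply: differentiable_entry.
  exact: df.
- apply: open_near Ox _ => y Oy; apply: diff_derivable; apply: differentiable_entry.
  exact: df.
- by apply: (near_eq_differentiable (E l)); apply: differentiable_entry; exact: ddf.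
- by apply: (near_eq_differentiable (E k)); apply: differentiable_entry; exact: ddf.
Qed.

Lemma derive_sym n (f : 'rV[R]_p -> 'M[R]_n) k x : Omega x ->
  (forall y, Omega y -> (f y)^T = f y) -> derivable f x (e_ k) ->
  (partial k f x)^T = partial k f x.
Proof.
move=> Ox sf df; apply/matrixP => i j; rewrite mxE.
have E a b : partial k f x a b = 'D_(e_ k) (fun y => f y a b : R) x.
  exact: (derive_entry a b df).
rewrite !E.
apply: near_eq_derive; apply: open_near => // y Oy.
by rewrite -{1}(sf y Oy) mxE.
Qed.

End MxC1.

Section PairModule.
Context {R : pzRingType} {V W : lmodType R}.

Lemma pairD (a c : V) (b d : W) : (a, b) + (c, d) = (a + c, b + d). Proof. by []. Qed.

Lemma pairZ (r : R) (a : V) (b : W) : r *: (a, b) = (r *: a, r *: b). Proof. by []. Qed.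

End PairModule.

Section Product.
Context {R : realType} {V W X : normedModType R}.

Lemma derive_left (f : V * W -> X) a b v :
  'D_(v, 0) f (a, b) = 'D_v (fun y => f (y, b)) a.
Proof.
rewrite /derive; apply: (f_equal (fun q : R -> X => lim (q @ 0^'))); apply/funext => h /=.
by congr (_ *: (f (_, _) - _)); rewrite /= scaler0 add0r.
Qed.

Lemma derive_right (f : V * W -> X) a b w :
  'D_(0, w) f (a, b) = 'D_w (fun y => f (a, y)) b.
Proof.
rewrite /derive; apply: (f_equal (fun q : R -> X => lim (q @ 0^'))); apply/funext => h /=.
by congr (_ *: (f (_, _) - _)); rewrite /= scaler0 add0r.
Qed.

End Product.

Lemma derive_trmx (R : realType) (V : normedModType R) m n (f : V -> 'M[R]_(m, n)) x v :
  derivable f x v ->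
  derivable (fun y => (f y)^T) x v /\ 'D_v (fun y => (f y)^T) x = ('D_v f x)^T.
Proof.
move=> df; have dT : derivable (fun y => (f y)^T) x v.
  apply/derivable_mxP => i j.
  have -> : (fun y => (f y)^T i j) = (fun y => f y j i) by apply/funext => y; rewrite mxE.
  exact: derivable_entry.
split => //; apply/matrixP => i j; rewrite mxE (derive_entry i j dT) (derive_entry j i df).
have E : (fun y => (f y)^T i j) = (fun y => f y j i) by apply/funext => y; rewrite mxE.
exact: (f_equal (fun q : V -> R => 'D_v q x) E).
Qed.

Lemma derive_quad_var (R : realType) n (B : 'M[R]_n) (t u : 'cV[R]_n) : B^T = B ->
  'D_u (fun t => quad B t : R) t = (u^T *m (2 *: (B *m t))) 0 0.
Proof.
move=> sB; have did : derivable (fun y : 'cV[R]_n => y) t u by exact: derivable_id.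
have [dT ET] := derive_trmx did.
have [d1 E1] := derive_mulmx dT (derivable_cst B t u).
have [d2 E2] := derive_mulmx d1 did.
rewrite /quad -(derive_entry 0 0 d2) E2 E1 ET derive_id derive_cst mulmx0 addr0.
have -> : (u^T *m (2 *: (B *m t))) 0 0 = 2 * (u^T *m B *m t) 0 0.
  by rewrite -scalemxAr [LHS]mxE mulmxA.
rewrite [LHS]mxE mulrDl mul1r; congr (_ + _).
by rewrite -scalar_trmx !trmx_mul trmxK sB mulmxA.
Qed.

(** Cyclicity of the trace. With [A] the inverse kernel and [B], [C] two partial derivatives of the
    kernel, it makes the middle term of [A_b] symmetric in its indices. *)
Lemma mxtrace_sandwichC (R : comNzRingType) n (A B C : 'M[R]_n) :
  \tr (- (A *m B *m A) *m C) = \tr (- (A *m C *m A) *m B).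
Proof.
rewrite !mulNmx -!scaleN1r !mxtraceZ; congr (_ * _).
by rewrite -[A *m B *m A *m C]mulmxA mxtrace_mulC mulmxA.
Qed.

(** * Gradient of the reduced cost and its differential at the limit point *)

Section Criterion.
Context {R : realType} {n p : nat}.
Local Notation e_ k := (delta_mx 0 k : 'rV[R]_p).
Variables (theta0 : 'cV[R]_n) (Omega : set 'rV[R]_p) (P : 'rV[R]_p -> 'M[R]_n).
Hypotheses (oO : open Omega) (P_C2 : C2_on Omega P).
Hypothesis pP : forall eta, Omega eta -> posdef (P eta).
Local Notation Z := ('rV[R]_p * ('cV[R]_n * 'M[R]_n))%type.

Lemma kernel_diff eta : Omega eta -> differentiable P eta.
Proof.
by apply: (mx_C1_differentiable oO) => x Ox k; have [] := P_C2 Ox k.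
Qed.

Lemma kernel_partial_diff k eta : Omega eta -> differentiable (partial k P) eta.
Proof.
by apply: (mx_C1_differentiable oO) => x Ox l; have [_ _ /(_ l)] := P_C2 Ox k.
Qed.

Lemma PinvE eta : Omega eta -> Pinv P eta = adjinv (P eta).
Proof. by move=> Oe; rewrite /Pinv adjinvE//; apply: posdef_unit; exact: pP. Qed.

Lemma adjinv_kernel_diff eta : Omega eta -> differentiable (fun y => adjinv (P y)) eta.
Proof.
move=> Oe; apply/mx_diffP; apply: mx_diff_adjinv; first exact/mx_diffP/kernel_diff.
exact/posdef_unit/pP.
Qed.

Lemma Pinv_diff eta : Omega eta -> differentiable (Pinv P) eta.
Proof.
move=> Oe; apply: (near_eq_differentiable _ (adjinv_kernel_diff Oe)).
by apply: (open_near oO Oe) => y Oy; rewrite PinvE.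
Qed.

Lemma partial_Pinv l eta : Omega eta ->
  partial l (Pinv P) eta = - (adjinv (P eta) *m partial l P eta *m adjinv (P eta)).
Proof.
move=> Oe.
have E : \forall y \near eta, Pinv P y = adjinv (P y) by exact: (open_near oO Oe PinvE).
apply: (etrans (near_eq_derive _ E)).
exact: (derive_adjinv _ (kernel_diff Oe) (posdef_unit (pP Oe))).
Qed.

Lemma partial_Pinv_diff l eta : Omega eta -> differentiable (partial l (Pinv P)) eta.
Proof.
move=> Oe; pose f y := - (adjinv (P y) *m partial l P y *m adjinv (P y)).
have df : differentiable f eta.
  have dA := iffRL (mx_diffP _ _) (adjinv_kernel_diff Oe).
  have dD := iffRL (mx_diffP _ _) (kernel_partial_diff l Oe).
  by apply/mx_diffP; apply: mx_diffN; exact: (mx_diffM (mx_diffM dA dD) dA).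
apply: (near_eq_differentiable _ df).
by apply: (open_near oO Oe) => y Oy; rewrite partial_Pinv.
Qed.

(** The [l]-th partial derivative in [eta] of [eb_crit theta (P eta + M)], as a function of
    [z = (eta, (theta, M))]. In this explicit form, its differentiability in all variables follows
    from that of [P] and of its first partials. *)
Definition eb_grad (l : 'I_p) (z : Z) : R :=
  - quad (adjinv (P z.1 + z.2.2) *m partial l P z.1 *m adjinv (P z.1 + z.2.2)) z.2.1
  + \tr (adjinv (P z.1 + z.2.2) *m partial l P z.1).

Lemma eb_grad_min l eta theta M : Omega eta ->
  (forall y, Omega y -> posdef (P y + M)) ->
  (forall y, Omega y -> eb_crit theta (P eta + M) <= eb_crit theta (P y + M)) ->
  eb_grad l (eta, (theta, M)) = 0.
Proof.
move=> Oe pPM emin.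
have dPM y : Omega y -> differentiable (fun y => P y + M) y.
  by move=> Oy; exact: (differentiableD (kernel_diff Oy) (differentiable_cst M y)).
have dcrit y : Omega y -> derivable (fun y => eb_crit theta (P y + M)) y (e_ l).
  move=> Oy; apply: diff_derivable.
  apply: (@differentiable_eb_crit _ _ _ (fun y => P y + M) (cst theta)).
  - exact: (iffRL (mx_diffP _ _) (dPM y Oy)).
  - exact: mx_diff_cst.
  - exact/posdef_det_gt0/pPM.
have := min_derive0 (open_nbhs_nbhs (conj oO Oe)) dcrit emin.
have -> : 'D_(e_ l) (fun y => eb_crit theta (P y + M)) eta = eb_grad l (eta, (theta, M)).
  apply: (etrans (derive_eb_crit theta _ (dPM _ Oe) (posdef_det_gt0 (pPM _ Oe)))).
  have -> : 'D_(e_ l) (fun y => P y + M) eta = partial l P eta.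
    have dp : derivable P eta (e_ l) by apply: diff_derivable; exact: kernel_diff.
    by apply: (etrans (deriveD dp (derivable_cst M eta (e_ l)))); rewrite derive_cst addr0.
  by [].
by [].
Qed.

Lemma shifted_kernel_diff (z : Z) : Omega z.1 -> mx_diff (fun z : Z => P z.1 + z.2.2) z.
Proof.
move=> Oz; apply: mx_diffD; apply/mx_diffP.
  exact: (differentiable_comp (differentiable_fst z) (kernel_diff Oz)).
exact: (differentiable_comp (differentiable_snd z) (differentiable_snd z.2)).
Qed.

Lemma eb_grad_diff l (z : Z) : Omega z.1 -> P z.1 + z.2.2 \in unitmx ->
  differentiable (eb_grad l) z.
Proof.
move=> Oz uz.
have dA : mx_diff (fun z : Z => adjinv (P z.1 + z.2.2)) z.
  exact: (mx_diff_adjinv (shifted_kernel_diff Oz) uz).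
have dD : mx_diff (fun z : Z => partial l P z.1) z.
  apply/mx_diffP.
  exact: (differentiable_comp (differentiable_fst z) (kernel_partial_diff l Oz)).
have dt : mx_diff (fun z : Z => z.2.1) z.
  apply/mx_diffP.
  exact: (differentiable_comp (differentiable_snd z) (differentiable_fst z.2)).
apply: differentiableD.
  apply: differentiableN.
  exact: (differentiable_quad (mx_diffM (mx_diffM dA dD) dA) dt).
exact: (differentiable_mxtrace (mx_diffM dA dD)).
Qed.

Lemma eb_crit_continuous (z : Z) : Omega z.1 -> 0 < \det (P z.1 + z.2.2) ->
  {for z, continuous (fun z : Z => eb_crit z.2.1 (P z.1 + z.2.2))}.
Proof.
move=> Oz dz; apply: differentiable_continuous.
apply: (@differentiable_eb_crit _ _ _ (fun z : Z => P z.1 + z.2.2) (fun z : Z => z.2.1)) => //.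
  exact: shifted_kernel_diff.
apply/mx_diffP.
exact: (differentiable_comp (differentiable_snd z) (differentiable_fst z.2)).
Qed.

Section AtPoint.
Variables (eta : 'rV[R]_p) (Oeta : Omega eta).

(** Column [l] is the gradient in [theta] of [eb_grad l] at [(eta, theta0, 0)]; the factor 2 is that
    of a symmetric quadratic form. *)
Definition eb_cross : 'M[R]_(n, p) :=
  \matrix_(i, l) (2 * (partial l (Pinv P) eta *m theta0) i 0).

(** Differentiating the trace of [P^-1] times the [l]-th partial of [P] along direction [k] puts [k]
    on the inverse, the opposite of the order in [A_b]; this is the form that the differential of
    [eb_grad] produces. *)
Lemma A_bE k l : A_b P theta0 eta k l =
  quad (partial k (partial l (Pinv P)) eta) theta0 +
  \tr (partial k (Pinv P) eta *m partial l P eta) +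
  \tr (Pinv P eta *m partial k (partial l P) eta).
Proof.
have E : \tr (partial l (Pinv P) eta *m partial k P eta) =
    \tr (partial k (Pinv P) eta *m partial l P eta).
  apply: (etrans (f_equal (fun B => \tr (B *m partial k P eta)) (partial_Pinv l Oeta))).
  apply: (etrans _ (esym (f_equal (fun B => \tr (B *m partial l P eta)) (partial_Pinv k Oeta)))).
  exact: mxtrace_sandwichC.
rewrite [LHS]mxE.
exact: (f_equal2 +%R (f_equal2 +%R erefl E) erefl).
Qed.

(** Symmetry of second derivatives is used for both [P] and its inverse. The result identifies the
    transpose of [D A^-1] as [A^-1 D^T], whence the sandwich form of the limit covariance. *)
Lemma A_b_sym : (A_b P theta0 eta)^T = A_b P theta0 eta.
Proof.
apply/matrixP => l k; rewrite mxE; apply: (etrans (A_bE k l)); rewrite [RHS]mxE.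
have E1 := @mx_young _ _ _ oO _ (Pinv P) k l _ Oeta (fun y Oy => Pinv_diff Oy)
  (fun k y Oy => partial_Pinv_diff k Oy).
have E2 := @mx_young _ _ _ oO _ P k l _ Oeta (fun y Oy => kernel_diff Oy)
  (fun k y Oy => kernel_partial_diff k Oy).
exact: (f_equal2 +%R (f_equal2 +%R (f_equal (fun B => quad B theta0) E1) erefl)
  (f_equal (fun B => \tr (Pinv P eta *m B)) E2)).
Qed.

Let z0 : Z := (eta, (theta0, 0)).
Let uz0 : P z0.1 + z0.2.2 \in unitmx.
Proof. by rewrite /= addr0; exact/posdef_unit/pP. Qed.
Let dg l : differentiable (eb_grad l) z0. Proof. exact: eb_grad_diff. Qed.

Lemma eb_gradE l y t : Omega y ->
  eb_grad l (y, (t, 0)) = quad (partial l (Pinv P) y) t + \tr (Pinv P y *m partial l P y).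
Proof.
move=> Oy; rewrite /eb_grad/= addr0 partial_Pinv// PinvE//; congr (_ + _).
by rewrite -[in RHS]scaleN1r quadZ mulN1r.
Qed.

Lemma diff_eb_grad_eta l k : 'd (eb_grad l) z0 (e_ k, 0) = A_b P theta0 eta k l.
Proof.
rewrite -deriveE// derive_left.
have E : \forall y \near eta, eb_grad l (y, (theta0, 0)) =
    quad (partial l (Pinv P) y) theta0 + \tr (Pinv P y *m partial l P y).
  by apply: (open_near oO Oeta) => y; exact: eb_gradE.
apply: (etrans (near_eq_derive _ E)).
have d1 : derivable (partial l (Pinv P)) eta (e_ k).
  by apply: diff_derivable; exact: partial_Pinv_diff.
have d2 : derivable (Pinv P) eta (e_ k) by apply: diff_derivable; exact: Pinv_diff.
have d3 : derivable (partial l P) eta (e_ k).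
  by apply: diff_derivable; exact: kernel_partial_diff.
have [q1 Q1] := derive_quad theta0 d1.
have [m1 M1] := derive_mulmx d2 d3.
have [t1 T1] := derive_mxtrace m1.
apply: (etrans (deriveD q1 t1)); apply: (etrans (f_equal2 +%R Q1 T1)).
by rewrite M1 A_bE mxtraceD addrA.
Qed.

Lemma partial_Pinv_sym l : (partial l (Pinv P) eta)^T = partial l (Pinv P) eta.
Proof.
apply: (derive_sym oO Oeta).
  by move=> y Oy; have [] := posdef_inv (pP Oy).
by apply: diff_derivable; exact: Pinv_diff.
Qed.

Lemma diff_eb_grad_theta l u : 'd (eb_grad l) z0 (0, (u, 0)) = (u^T *m eb_cross) 0 l.
Proof.
rewrite -deriveE// derive_right derive_left.
have -> : (fun t => eb_grad l (eta, (t, 0))) =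
    (fun t => quad (partial l (Pinv P) eta) t) + cst (\tr (Pinv P eta *m partial l P eta)).
  by apply/funext => t; rewrite eb_gradE.
have d1 : derivable (fun t => quad (partial l (Pinv P) eta) t) theta0 u.
  apply: diff_derivable; apply: differentiable_quad; first exact: mx_diff_cst.
  by apply/mx_diffP.
apply: (etrans (deriveD d1 (derivable_cst _ _ _))); rewrite derive_cst addr0.
rewrite derive_quad_var; last exact: partial_Pinv_sym.
rewrite [LHS]mxE [RHS]mxE; apply: eq_bigr => i _; congr (_ * _).
by rewrite [LHS]mxE [RHS]mxE.
Qed.

(** Linearity over the three components. The derivative in [M] is left unevaluated, as only its
    boundedness matters for a term of lower order. *)
Lemma diff_eb_grad l h u M : 'd (eb_grad l) z0 (h, (u, M)) =
  (h *m A_b P theta0 eta + u^T *m eb_cross) 0 l + 'd (eb_grad l) z0 (0, (0, M)).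
Proof.
have -> : (h, (u, M)) = (h, 0) + (0, (u, 0)) + (0, (0, M)) :> Z.
  by rewrite !pairD !addr0 !add0r.
have -> : (h *m A_b P theta0 eta + u^T *m eb_cross) 0 l =
  (h *m A_b P theta0 eta) 0 l + (u^T *m eb_cross) 0 l by rewrite mxE.
rewrite !linearD/= diff_eb_grad_theta.
congr (_ + _ + _).
have -> : (h, 0) = \sum_k h 0 k *: ((e_ k, 0) : Z).
  rewrite [LHS](_ : _ = (\sum_k h 0 k *: e_ k, 0)); last by rewrite -row_sum_delta.
  elim/big_rec2 : _ => // k y z _ <-; rewrite pairZ pairD scaler0 add0r; congr (_, _).
rewrite linear_sum mxE; apply: eq_bigr => k _.
by rewrite linearZ/= diff_eb_grad_eta.
Qed.

End AtPoint.
End Criterion.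

Section MxNorm.
Context {R : realType}.

Lemma normr_trmx m n (A : 'M[R]_(m, n)) : `|A^T| <= `|A|.
Proof. by apply: normr_mx_le => // i j; rewrite mxE normr_entry_le. Qed.

Lemma normr_mulmx m n q (A : 'M[R]_(m, n)) (B : 'M[R]_(n, q)) :
  `|A *m B| <= n%:R * `|A| * `|B|.
Proof.
apply: normr_mx_le => [|i j]; first by rewrite !mulr_ge0.
rewrite mxE (le_trans (ler_norm_sum _ _ _))//.
apply: le_trans (_ : \sum_(k < n) `|A| * `|B| <= _).
  by apply: ler_sum => k _; rewrite normrM ler_pM// normr_entry_le.
by rewrite sumr_const card_ord -[leLHS]mulr_natl mulrA.
Qed.

Lemma normr_pair_le (V W : normedModType R) (v : V) (w : W) : `|(v, w)| <= `|v| + `|w|.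
Proof. by rewrite prod_normE/= ge_max lerDl lerDr !normr_ge0. Qed.

End MxNorm.

(** * Expansion of the estimator *)

Section Expansion.
Context {R : realType} {n p : nat}.
Variables (theta0 : 'cV[R]_n) (Omega : set 'rV[R]_p) (P : 'rV[R]_p -> 'M[R]_n).
Hypotheses (oO : open Omega) (P_C2 : C2_on Omega P).
Hypothesis pP : forall eta, Omega eta -> posdef (P eta).
Variables (eta : 'rV[R]_p) (Oeta : Omega eta).
Local Notation Z := ('rV[R]_p * ('cV[R]_n * 'M[R]_n))%type.
Local Notation A := (A_b P theta0 eta).
Local Notation D := (eb_cross theta0 P eta).
Local Notation g l := (eb_grad P l).
Let z0 : Z := (eta, (theta0, 0)).
Hypothesis g0 : forall l, g l z0 = 0.

Let dg l : differentiable (g l) z0.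
Proof.
by apply: (eb_grad_diff oO P_C2) => //=; rewrite addr0; exact/posdef_unit/pP.
Qed.

(** As the gradient vanishes at both [z0] and [z], its linear part equals minus the Taylor
    remainder. The constant [C] bounds the differential in the direction [M] and is chosen before
    [e]; only the remainder carries the factor [e]. *)
Lemma eb_grad_expansion : exists2 C : R, 0 <= C & forall e : R, 0 < e ->
  \forall z \near z0, (forall l, g l z = 0) ->
    `|(z.1 - eta) *m A + (z.2.1 - theta0)^T *m D| <=
    C * `|z.2.2| + e * (`|z.1 - eta| + `|z.2.1 - theta0| + `|z.2.2|).
Proof.
have /choice[c Hc] (l : 'I_p) : exists c, 0 < c /\ forall x, `|'d (g l) z0 x| <= c * `|x|.
  have [c c0 H] := linear_lipschitz (diff_continuous (dg l)).
  by exists c.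
have c0 l : 0 <= c l by exact: ltW (Hc l).1.
exists (\sum_l c l) => [|e e0]; first by rewrite sumr_ge0.
have near_h : \forall h \near (0 : Z), forall l,
    `|g l (h + z0) - g l z0 - 'd (g l) z0 h| <= e * `|h|.
  exact: (filter_forall _ (fun l => diff_eps e0 (dg l))).
have {near_h} : \forall z \near z0, forall l,
    `|g l (z - z0 + z0) - g l z0 - 'd (g l) z0 (z - z0)| <= e * `|z - z0|.
  by move: near_h; rewrite (near_shift z0) sub0r.
apply: filterS => -[y [t M]] H gz /=.
have zE : (y, (t, M)) - z0 = (y - eta, (t - theta0, M)) by rewrite -[M in RHS]subr0.
have S0 : 0 <= `|y - eta| + `|t - theta0| + `|M| by rewrite !addr_ge0.
apply: normr_mx_le => [|i l]; first by rewrite addr_ge0 ?mulr_ge0 ?sumr_ge0// ltW.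
rewrite (ord1 i); have := H l; rewrite subrK gz g0 subrr sub0r normrN zE.
rewrite (diff_eb_grad theta0 oO P_C2 pP Oeta) => Hl.
set x := fun_of_matrix (_ + _) 0 l in Hl *; set d := ('d _ _ _) in Hl.
have dM : `|d| <= (\sum_l c l) * `|M|.
  apply: (le_trans ((Hc l).2 _)); rewrite ler_pM//.
    by rewrite (bigD1 l)//= lerDl sumr_ge0.
  by rewrite (le_trans (normr_pair_le _ _))// normr0 add0r (le_trans (normr_pair_le _ _))// normr0 add0r.
have -> : x = (x + d) - d by rewrite addrK.
rewrite (le_trans (ler_normB _ _))// [leRHS]addrC lerD//; apply: (le_trans Hl); rewrite ler_pM2l//.
rewrite (le_trans (normr_pair_le _ _))// -addrA lerD2l.
exact: normr_pair_le.
Qed.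

Variables (K : set 'rV[R]_p) (K_compact : compact K) (K_sub : K `<=` Omega).
Hypothesis K_min : forall y, K y -> y != eta ->
  eb_crit theta0 (P eta + 0) < eb_crit theta0 (P y + 0).

Let minimizes (w : 'cV[R]_n * 'M[R]_n) y :=
  forall x, Omega x -> eb_crit w.1 (P y + w.2) <= eb_crit w.1 (P x + w.2).

(** Near a point [y] of [K] other than [eta], the cost at [eta] stays strictly below the cost there
    for all [w] close to [(theta0, 0)], so no minimizer lies nearby; near [eta] the property [Q]
    holds by assumption. Compactness of [K] yields one neighbourhood of [(theta0, 0)] for all
    [y]. *)
Lemma argmin_consistent (Q : Z -> Prop) : (\forall z \near z0, Q z) ->
  \forall w \near (theta0, (0 : 'M[R]_n)), forall y, K y -> minimizes w y -> Q (y, w).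
Proof.
move=> Qz0.
have /compact_near_coveringP cK := K_compact.
have := cK _ (nbhs (theta0, (0 : 'M[R]_n))) (fun w y => minimizes w y -> Q (y, w)) _.
apply => y Ky.
have [->|yn] := eqVneq y eta.
  suff : \forall z \near ((eta, (theta0, 0)) : Z), minimizes z.2 z.1 -> Q (z.1, z.2) by [].
  by apply: filterS Qz0 => -[a b].
suff : \forall z \near ((y, (theta0, 0)) : Z), minimizes z.2 z.1 -> Q (z.1, z.2) by [].
have crit_cont x : Omega x -> {for ((x, (theta0, 0)) : Z), continuous
    (fun z : Z => eb_crit z.2.1 (P z.1 + z.2.2))}.
  by move=> Ox; apply: (eb_crit_continuous oO P_C2) => //=; rewrite addr0; exact/posdef_det_gt0/pP.
have c1 := crit_cont y (K_sub Ky).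
have c2 : {for ((y, (theta0, 0)) : Z), continuous
    (fun z : Z => eb_crit z.2.1 (P eta + z.2.2))}.
  apply: differentiable_continuous.
  apply: (@differentiable_eb_crit _ _ _ (fun z : Z => P eta + z.2.2) (fun z : Z => z.2.1)).
  - apply: mx_diffD; first exact: mx_diff_cst.
    apply/mx_diffP.
    exact: (differentiable_comp (differentiable_snd _) (differentiable_snd _)).
  - apply/mx_diffP.
    exact: (differentiable_comp (differentiable_snd _) (differentiable_fst _)).
  - by rewrite /= addr0; exact/posdef_det_gt0/pP.
have c12 : (fun z : Z => eb_crit z.2.1 (P z.1 + z.2.2) - eb_crit z.2.1 (P eta + z.2.2))
    @ ((y, (theta0, 0)) : Z) --> eb_crit theta0 (P y + 0) - eb_crit theta0 (P eta + 0).
  exact: cvgB c1 c2.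
have gap : 0 < eb_crit theta0 (P y + 0) - eb_crit theta0 (P eta + 0).
  by rewrite subr_gt0; exact: K_min.
apply: (filterS _ (cvgr_gt _ c12 _ gap)) => z /=; rewrite subr_gt0 => lt mz.
by have := mz eta Oeta; rewrite leNgt lt.
Qed.

Hypothesis A_unit : A \in unitmx.

(** Multiplying the expanded first-order condition by [A^-1] leaves [|y - eta|] inside the error
    term. It is bounded by the left-hand side plus a multiple of [|theta - theta0|], and a small
    enough [e1] allows it to be absorbed. *)
Lemma estimator_expansion : exists2 C : R, 0 <= C & forall e : R, 0 < e ->
  \forall w \near (theta0, (0 : 'M[R]_n)), forall y, K y -> minimizes w y ->
    (forall x, Omega x -> posdef (P x + w.2)) ->
    `|(y - eta) + (w.1 - theta0)^T *m (D *m invmx A)| <= C * `|w.2| + e * `|w.1 - theta0|.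
Proof.
have [C C0 HC] := eb_grad_expansion.
pose c := p%:R * `|invmx A| + 1; pose b := n%:R * `|D *m invmx A|.
have b0 : 0 <= b by rewrite mulr_ge0.
have c0 : 0 < c by rewrite ltr_wpDl// mulr_ge0.
exists (2 * c * C + 1) => [|e e0]; first by rewrite addr_ge0// !mulr_ge0// ltW.
(* The first bound makes the terms in [|r|] and [|M|] cost at most half of themselves; the second
   brings the coefficient of [|theta - theta0|] to [e] once the inequality is solved for [|r|]. *)
pose e1 := Num.min (2 * c)^-1 (e / (2 * c * (b + 1))).
have e10 : 0 < e1.
  by rewrite lt_min invr_gt0 divr_gt0 ?mulr_gt0// ltr_wpDl.
have ce1 : 2 * c * e1 <= 1.
  by rewrite -ler_pdivlMl ?mulr_gt0// mulr1 ge_min lexx.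
have ce2 : 2 * c * e1 * (b + 1) <= e.
  have bb : 0 < 2 * c * (b + 1) by rewrite !mulr_gt0// ltr_wpDl.
  by rewrite mulrAC -ler_pdivlMl// mulrC ge_min lexx orbT.
apply: filterS (argmin_consistent (HC e1 e10)) => w Hw y Ky my pd.
have {}Hw := Hw y Ky my; move: w Hw my pd => [t M] /= Hw my pd.
have {}Hw := Hw (fun l => eb_grad_min oO P_C2 l (K_sub Ky) pd my).
set X := (y - eta) *m A + (t - theta0)^T *m D in Hw.
set r := _ + _; have rE : r = X *m invmx A by rewrite mulmxDl mulmxK// -mulmxA.
have rX : `|r| <= c * `|X|.
  rewrite rE (le_trans (normr_mulmx _ _))// mulrAC ler_wpM2r// /c lerDl//.
have hr : `|y - eta| <= `|r| + b * `|t - theta0|.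
  have -> : y - eta = r - (t - theta0)^T *m (D *m invmx A) by rewrite addrK.
  rewrite (le_trans (ler_normB _ _))// lerD2l (le_trans (normr_mulmx _ _))//.
  by rewrite /b mulrAC ler_wpM2l ?mulr_ge0// normr_trmx.
have : `|r| <= c * (C * `|M| + e1 * (`|r| + b * `|t - theta0| + `|t - theta0| + `|M|)).
  apply: (le_trans rX); rewrite ler_wpM2l ?(ltW c0)// (le_trans Hw)// lerD2l ler_wpM2l ?(ltW e10)//.
  by rewrite !lerD.
have u0 : 0 <= `|t - theta0| by []. have M0 : 0 <= `|M| by []. have r0 : 0 <= `|r| by [].
move: (`|t - theta0|) (`|M|) (`|r|) u0 M0 r0 => u m s u0 M0 r0 H.
have H1 : 2 * c * e1 * s <= s by rewrite ler_piMl.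
have H2 : 2 * c * e1 * m <= m by rewrite ler_piMl.
have H3 : 2 * c * e1 * (b + 1) * u <= e * u by rewrite ler_wpM2r.
nra.
Qed.

End Expansion.

(** * Gaussian integrals *)

Section Density.
Local Open Scope ereal_scope.
Context d (T : measurableType d) (R : realType).
Variables (mu nu : {measure set T -> \bar R}) (h : T -> R).
Hypotheses (mh : measurable_fun setT h) (h0 : forall x, (0 <= h x)%R).
Hypothesis nuE : forall A, measurable A -> nu A = \int[mu]_(x in A) (h x)%:E.

Import HBNNSimple.

(** The hypothesis is the case of indicators; simple functions and monotone convergence give the
    rest. *)
Lemma ge0_integral_density (f : T -> \bar R) : measurable_fun setT f ->
  (forall x, 0 <= f x) -> \int[nu]_x f x = \int[mu]_x (f x * (h x)%:E).
Proof.
move=> mf f0; pose f_ := nnsfun_approx measurableT mf.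
have mfn n : measurable_fun setT (fun x => (f_ n x)%:E) by exact/measurable_EFinP.
have fn0 n x : 0 <= (f_ n x)%:E by rewrite lee_fin.
have fn_nd x : {homo (fun n => (f_ n x)%:E) : a b / (a <= b)%N >-> a <= b}.
  by move=> a b ab; rewrite lee_fin; exact/lefP/nd_nnsfun_approx.
have fnf x : (fun n => (f_ n x)%:E) @ \oo --> f x by exact: cvg_nnsfun_approx.
have mhE : measurable_fun setT (EFin \o h) by exact/measurable_EFinP.
transitivity (limn (fun n => \int[nu]_x (f_ n x)%:E)).
  rewrite -monotone_convergence//.
  by apply: eq_integral => x _; apply/esym/cvg_lim.
transitivity (limn (fun n => \int[mu]_x ((f_ n x)%:E * (h x)%:E))); last first.
  rewrite -monotone_convergence//.
  - apply: eq_integral => x _; apply/cvg_lim => //.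
    by apply: cvgeZr => //; exact: fnf.
  - by move=> n; exact: emeasurable_funM.
  - by move=> n x _; rewrite mule_ge0// lee_fin.
  - by move=> x _ a b ab; rewrite lee_wpmul2r ?lee_fin//; exact: fn_nd.
congr (limn _); apply/funext => n.
transitivity (\sum_(k \in range (f_ n)) \int[nu]_x (k * \1_(f_ n @^-1` [set k]) x)%:E).
  under eq_integral do rewrite fimfunE -fsumEFin//.
  rewrite ge0_integral_fsum// => [k|k x _]; last by rewrite nnfun_muleindic_ge0.
  exact/measurable_EFinP/measurable_funM.
transitivity (\sum_(k \in range (f_ n))
    \int[mu]_x ((k * \1_(f_ n @^-1` [set k]) x)%:E * (h x)%:E)); last first.
  rewrite -ge0_integral_fsum//=.
  - apply: eq_integral => x _; rewrite -ge0_mule_fsuml// => [|k]; last by rewrite nnfun_muleindic_ge0.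
    by rewrite fsumEFin// -fimfunE.
  - by move=> k; apply: emeasurable_funM => //; exact/measurable_EFinP/measurable_funM.
  - by move=> k x _; apply: mule_ge0; [rewrite EFinM nnfun_muleindic_ge0|rewrite lee_fin].
apply: eq_fsbigr => k; rewrite inE => -[x _ fxk].
have k0 : (0 <= k)%R by rewrite -fxk.
have mA : measurable (f_ n @^-1` [set k]) by exact: measurable_sfunP.
have mI : measurable_fun setT (EFin \o (\1_(f_ n @^-1` [set k]) : T -> R)).
  by apply/measurable_EFinP; exact: measurable_indic.
under eq_integral do rewrite EFinM.
rewrite ge0_integralZl ?lee_fin//.
rewrite integral_indic// setIT nuE//.
under [in RHS]eq_integral do rewrite EFinM -muleA.
have mIh := emeasurable_funM mI mhE.
rewrite ge0_integralZl ?lee_fin//; last by move=> y _; rewrite mule_ge0 ?lee_fin.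
congr (_ * _); rewrite integral_mkcond; apply: eq_integral => y _.
rewrite patchE indicE; case: ifPn => yA; first by rewrite mul1e.
by rewrite mul0e.
Qed.

End Density.

Section Affine.
Local Open Scope ereal_scope.
Context {R : realType}.
Local Notation leb := (@lebesgue_measure R).
Variables (a c : R).
Hypothesis a0 : a != 0%R.

Let phi (x : measurableTypeR R) : measurableTypeR R := (a * x + c)%R.

Let mphi : measurable_fun setT phi.
Proof. by apply: measurable_funD => //; exact: measurable_funM. Qed.

Let push : {measure set (measurableTypeR R) -> \bar R} :=
  measure_function_pushforward__canonical__measure_function_Measure leb mphi.

Let nu : {measure set (measurableTypeR R) -> \bar R} := mscale (`|a|%:nng)%R push.

Lemma lebesgue_affineE A : measurable A -> leb A = nu A.
Proof.
apply: lebesgue_measure_unique => _ [[u v]] _ <- /=.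
rewrite /nu/= /mscale/= /pushforward.
have [ap|an|/eqP] := ltgtP 0%R a; last by rewrite eq_sym (negbTE a0).
  have -> : phi @^-1` `]u, v] = `]((u - c) / a)%R, ((v - c) / a)%R]%classic.
    apply/seteqP; split => x; rewrite /= !in_itv/= /phi;
      by rewrite ltr_pdivrMr// ler_pdivlMr// ltrBlDr lerBrDr mulrC.
  rewrite !lebesgue_measure_itv/= !lte_fin ltr_pM2r ?invr_gt0// ltrD2r.
  case: ifPn => _; last by rewrite mule0.
  by rewrite -EFinB -EFinM; congr EFin; rewrite gtr0_norm//; field.
(* A negative slope reverses the interval, which becomes closed on the left; its length does not
   depend on this. *)
have -> : phi @^-1` `]u, v] = `[((v - c) / a)%R, ((u - c) / a)%R[%classic.
  apply/seteqP; split => x; rewrite /= !in_itv/= /phi;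
    by rewrite ler_ndivrMr// ltr_ndivlMr// ltrBlDr lerBrDr mulrC andbC.
rewrite !lebesgue_measure_itv/= !lte_fin ltr_nM2r ?invr_lt0// ltrD2r.
case: ifPn => _; last by rewrite mule0.
by rewrite -EFinB -EFinM; congr EFin; rewrite ltr0_norm//; field.
Qed.

Lemma ge0_integral_affine (f : R -> \bar R) : measurable_fun setT f ->
  (forall x, 0 <= f x) ->
  \int[leb]_x f x = `|a|%:E * \int[leb]_x f (a * x + c)%R.
Proof.
move=> mf f0.
rewrite (eq_measure_integral nu) => [|A mA _]; last exact: lebesgue_affineE.
rewrite ge0_integral_mscale//; congr (_ * _).
by rewrite ge0_integral_pushforward.
Qed.

End Affine.

Section Normal.
Local Open Scope ereal_scope.
Context {R : realType} (sigma : R).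
Hypothesis sigma_gt0 : (0 < sigma)%R.
Local Notation leb := (@lebesgue_measure R).
Local Notation gam := (normal_prob 0 sigma).
Local Notation pdf := (normal_pdf 0 sigma).

Let s0 : sigma != 0%R. Proof. by rewrite gt_eqF. Qed.

Lemma ge0_integral_normal (g : R -> \bar R) : measurable_fun setT g ->
  (forall x, 0 <= g x) -> \int[gam]_x g x = \int[leb]_x (g x * (pdf x)%:E).
Proof.
move=> mg g0; apply: (ge0_integral_density (nu := gam)) => //.
  exact: measurable_normal_pdf.
by move=> x; exact: normal_pdf_ge0.
Qed.

(** Rotation invariance of the planar Gaussian density, on which the completion of the square in
    [normal_conv_density] rests. *)
Lemma normal_pdf_mul x y u v : (x ^+ 2 + y ^+ 2 = u ^+ 2 + v ^+ 2)%R ->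
  (pdf x * pdf y = pdf u * pdf v)%R.
Proof.
move=> E; rewrite normal_pdfE// /normal_fun !subr0 mulrACA [in RHS]mulrACA -!expRD.
by congr (_ * expR _)%R; rewrite -!mulrDl -!opprD E.
Qed.

Let mpdf : measurable_fun setT (EFin \o pdf).
Proof. by apply/measurable_EFinP; exact: measurable_normal_pdf. Qed.

Let pdf0 x : 0 <= (pdf x)%:E. Proof. by rewrite lee_fin normal_pdf_ge0. Qed.

Let maff (a c : R) : measurable_fun setT (fun x : R => (a * x + c)%R).
Proof. by apply: measurable_funD => //; exact: measurable_funM. Qed.

Let mpdf_comp d (T : measurableType d) (h : T -> R) k : measurable_fun setT h ->
  measurable_fun setT (fun x => (k * pdf (h x))%:E).
Proof.
move=> mh; apply/measurable_EFinP; apply: measurable_funM => //.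
by apply: (measurableT_comp (measurable_normal_pdf 0 sigma)).
Qed.

Let kpdf0 k x : (0 <= k)%R -> 0 <= (k * pdf x)%:E.
Proof. by move=> k0; rewrite lee_fin mulr_ge0 ?normal_pdf_ge0. Qed.

Lemma ge0_integral_normal_scale (g : R -> \bar R) r : measurable_fun setT g ->
  (forall x, 0 <= g x) -> r != 0%R ->
  \int[gam]_x g (r * x)%R = \int[leb]_z (g z * (`|r|^-1 * pdf (z / r))%:E).
Proof.
move=> mg g0 r0.
have mgr : measurable_fun setT (fun x => g (r * x)%R).
  by apply: (measurableT_comp mg); exact: measurable_funM.
have mfz : measurable_fun setT (fun z => g z * (`|r|^-1 * pdf (z / r))%:E).
  by apply: emeasurable_funM => //; apply: mpdf_comp; exact: measurable_funM.
have fz0 z : 0 <= g z * (`|r|^-1 * pdf (z / r))%:E.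
  by rewrite mule_ge0// kpdf0// invr_ge0.
rewrite ge0_integral_normal// (ge0_integral_affine 0%R r0 mfz fz0).
have mfr := measurableT_comp mfz (maff r 0).
rewrite -ge0_integralZl//.
apply: eq_integral => x _; rewrite addr0 muleCA; congr (_ * _).
rewrite -EFinM; congr EFin; rewrite mulrA mulfV ?normr_eq0// mul1r.
by congr (normal_pdf _ _ _); field.
Qed.

Lemma normal_sym (g : R -> \bar R) : measurable_fun setT g ->
  (forall x, 0 <= g x) -> \int[gam]_x g (- x)%R = \int[gam]_x g x.
Proof.
move=> mg g0; under eq_integral do rewrite -mulN1r.
rewrite ge0_integral_normal_scale ?oppr_eq0 ?oner_eq0// ge0_integral_normal//.
apply: eq_integral => x _; rewrite normrN normr1 invr1 mul1r invrN invr1 mulrN1.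
by rewrite normal_pdfE// /normal_fun !subr0 sqrrN.
Qed.

Lemma normal_absl (g : R -> \bar R) r : measurable_fun setT g ->
  (forall x, 0 <= g x) -> \int[gam]_x g (`|r| * x)%R = \int[gam]_x g (r * x)%R.
Proof.
move=> mg g0; have [r0|r0] := ltP r 0%R; last by rewrite ger0_norm.
rewrite -(normal_sym (g := fun x => g (r * x)%R))//.
  by apply: eq_integral => x _; rewrite ltr0_norm// mulrN mulNr.
apply: (measurableT_comp mg); exact: measurable_funM.
Qed.

(* For [s, r > 0] with [r^2 = s^2 + b^2], completing the square gives
   [((z - b y) / s)^2 + y^2 = (z / r)^2 + (r y / s - b z / (r s))^2]. *)
Lemma normal_conv_density s b z : (s != 0)%R ->
  \int[leb]_y ((`|s|^-1 * pdf ((z - b * y) / s))%:E * (pdf y)%:E) =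
  ((Num.sqrt (s ^+ 2 + b ^+ 2))^-1 * pdf (z / Num.sqrt (s ^+ 2 + b ^+ 2)))%:E.
Proof.
move=> sn0; have s20 : (0 < s ^+ 2)%R by rewrite exprn_even_gt0.
have r20 : (0 < s ^+ 2 + b ^+ 2)%R by rewrite ltr_wpDr ?sqr_ge0.
set r := Num.sqrt _; have r0 : (0 < r)%R by rewrite sqrtr_gt0.
have rE : (r ^+ 2 = s ^+ 2 + b ^+ 2)%R by rewrite sqr_sqrtr// ltW.
have rn0 : r != 0%R by rewrite gt_eqF.
pose a := (r / s)%R; pose c := (- (b * z / (r * s)))%R.
have a0 : a != 0%R by rewrite mulf_neq0 ?invr_eq0.
transitivity (\int[leb]_y ((`|s|^-1 * pdf (z / r))%:E * (pdf (a * y + c))%:E)).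
  apply: eq_integral => y _; rewrite -!EFinM -[(_ * _ * _)%R]mulrA -[in RHS]mulrA.
  congr ((_ * _)%:E).
  apply: normal_pdf_mul; rewrite /a /c.
  have -> : ((z / r) ^+ 2 + (r / s * y + - (b * z / (r * s))) ^+ 2 =
      (z ^+ 2 * s ^+ 2 + (r ^+ 2 * y - b * z) ^+ 2) / (r ^+ 2 * s ^+ 2))%R.
    by field; rewrite sn0 rn0.
  by rewrite rE; field; rewrite sn0 gt_eqF.
have mac : measurable_fun setT (fun y => (pdf (a * y + c))%:E).
  by have := mpdf_comp 1 (maff a c); under boolp.eq_fun do rewrite mul1r.
rewrite ge0_integralZl//; last by rewrite lee_fin mulr_ge0 ?invr_ge0// normal_pdf_ge0.
have := ge0_integral_affine c a0 mpdf pdf0.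
rewrite /= integral_normal_pdf => /esym E.
have -> : \int[leb]_x (pdf (a * x + c))%:E = (`|a|^-1)%:E.
  have := congr1 (fun u => (`|a|^-1)%:E * u) E; rewrite /= muleA -EFinM mulVf ?normr_eq0//.
  by rewrite mul1e mule1.
rewrite -EFinM; congr EFin; rewrite /a normrM normfV (gtr0_norm r0).
by field; rewrite normr_eq0 sn0 rn0.
Qed.

(** For [s != 0] the inner integral is taken against the density of [s X + b y], and exchanging the
    integrals leaves the convolution of two Gaussian densities. For [s = 0] that density does not
    exist, and symmetry of the law replaces [b] by its absolute value. *)
Lemma normal_conv s b (g : R -> \bar R) : measurable_fun setT g ->
  (forall x, 0 <= g x) ->
  \int[gam]_y \int[gam]_x g (s * x + b * y)%R =
  \int[gam]_x g (Num.sqrt (s ^+ 2 + b ^+ 2) * x)%R.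
Proof.
move=> mg g0; have [->|sn0] := eqVneq s 0%R.
  rewrite expr0n/= add0r sqrtr_sqr normal_absl//.
  apply: eq_integral => y _; under eq_integral do rewrite mul0r add0r.
  by rewrite integral_cst//= -[normal_prob _ _ _]/(normal_prob 0 sigma setT) probability_setT mule1.
have s20 : (0 < s ^+ 2)%R by rewrite exprn_even_gt0.
have r20 : (0 < s ^+ 2 + b ^+ 2)%R by rewrite ltr_wpDr ?sqr_ge0.
have rn0 : Num.sqrt (s ^+ 2 + b ^+ 2) != 0%R by rewrite gt_eqF// sqrtr_gt0.
rewrite [RHS]ge0_integral_normal_scale//.
pose k (p : R * R) := g p.2 * ((`|s|^-1 * pdf ((p.2 - b * p.1) / s))%:E * (pdf p.1)%:E).
have m1 : measurable_fun setT (fun p : R * R => (`|s|^-1 * pdf ((p.2 - b * p.1) / s))%:E).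
  apply: mpdf_comp; apply: measurable_funM => //.
  by apply: measurable_funB => //; exact: measurable_funM.
have mk : measurable_fun setT k.
  apply: emeasurable_funM; first exact: (measurableT_comp mg).
  apply: emeasurable_funM => //; exact: (measurableT_comp mpdf).
have k0 p : 0 <= k p by rewrite /k !mule_ge0// kpdf0// invr_ge0.
have m1y (y : R) : measurable_fun setT (fun z : R => (`|s|^-1 * pdf ((z - b * y) / s))%:E).
  by apply: mpdf_comp; apply: measurable_funM => //; exact: measurable_funB.
have m1z (z : R) : measurable_fun setT (fun y : R => (`|s|^-1 * pdf ((z - b * y) / s))%:E * (pdf y)%:E).
  apply: emeasurable_funM => //; apply: mpdf_comp; apply: measurable_funM => //.
  by apply: measurable_funB => //; exact: measurable_funM.
have mz (y : R) : measurable_fun setT (fun z : R => g z * (`|s|^-1 * pdf ((z - b * y) / s))%:E).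
  exact: emeasurable_funM.
have mz0 y z : 0 <= g z * (`|s|^-1 * pdf ((z - b * y) / s))%:E.
  by rewrite mule_ge0// kpdf0// invr_ge0.
have inner y : \int[gam]_x g (s * x + b * y)%R =
    \int[leb]_z (g z * (`|s|^-1 * pdf ((z - b * y) / s))%:E).
  have mh : measurable_fun setT (fun u : R => g (u + b * y)%R).
    by apply: (measurableT_comp mg); exact: measurable_funD.
  apply: (etrans (ge0_integral_normal_scale mh (fun u => g0 _) sn0)).
  rewrite [RHS](ge0_integral_affine (b * y)%R (oner_neq0 R) (mz y) (mz0 y)).
  rewrite normr1 mul1e; apply: eq_integral => x _.
  by rewrite mul1r addrK.
have mG : measurable_fun setT (fun p : R * R => g (s * p.2 + b * p.1)%R).
  by apply: (measurableT_comp mg); apply: measurable_funD; exact: measurable_funM.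
have mI := measurable_fun_fubini_tonelli_F (m2 := gam) _ mG (fun p => g0 _).
rewrite ge0_integral_normal//; last by move=> y; exact: integral_ge0.
transitivity (\int[leb]_y \int[leb]_z k (y, z)).
  apply: eq_integral => y _; rewrite inner -ge0_integralZr//.
  by apply: eq_integral => z _; rewrite /k/= muleA.
  exact: mz.
apply: (etrans (fubini_tonelli (m1 := leb) (m2 := leb) _ mk k0)).
apply: eq_integral => z _; rewrite /k/= ge0_integralZl//.
- by rewrite normal_conv_density// [`|Num.sqrt _|%R]gtr0_norm// sqrtr_gt0.
- exact: m1z.
- by move=> y _; rewrite mule_ge0// kpdf0// invr_ge0.
Qed.

End Normal.

(** * Independence and white Gaussian vectors *)

Section SubSigma.
Local Open Scope ereal_scope.
Context d (T : measurableType d) (R : realType) (Pr : probability T R).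
Variable G : set (set T).
Hypothesis Gm : G `<=` measurable.

Let inj (w : T) : g_sigma_algebraType G := w.

Lemma measurable_sub_sigma d' (T' : measurableType d') (f : T -> T') :
  measurable_fun setT (f : g_sigma_algebraType G -> T') -> measurable_fun setT f.
Proof.
move=> mf _ B mB; rewrite setTI; have := mf measurableT B mB; rewrite setTI.
by apply: smallest_sub => //; exact: sigma_algebra_measurable.
Qed.

Lemma measurable_to_sub_sigma : measurable_fun setT inj.
Proof. exact: (measurable_sub_sigma (@measurable_id _ (g_sigma_algebraType G) setT)). Qed.

HB.instance Definition _ := isMeasurableFun.Build _ _ _ _ inj measurable_to_sub_sigma.

(** The restriction of [Pr] to the generated sigma-algebra, encoded as the law of the identity map
    so that product measures and Tonelli's theorem apply to it. *)
Definition sub_prob : probability (g_sigma_algebraType G) R := distribution Pr inj.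

Lemma ge0_integral_sub_prob (f : T -> \bar R) :
  measurable_fun setT (f : g_sigma_algebraType G -> \bar R) -> (forall w, 0 <= f w) ->
  \int[sub_prob]_w f w = \int[Pr]_w f w.
Proof. by move=> mf f0; exact: (@ge0_integral_distribution _ _ _ _ _ Pr inj f mf f0). Qed.

End SubSigma.

Section IndepFubini.
Local Open Scope ereal_scope.
Context d (T : measurableType d) (R : realType) (Pr : probability T R).
Variables G1 G2 : set (set T).
Hypotheses (G1m : G1 `<=` measurable) (G2m : G2 `<=` measurable).
Hypotheses (G1I : setI_closed G1) (G2I : setI_closed G2) (G1T : G1 setT) (G2T : G2 setT).
Hypothesis G12 : forall A B, G1 A -> G2 B -> Pr (A `&` B) = Pr A * Pr B.

(** For fixed [B] both sides are finite measures in [A] that agree on a pi-system containing the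
    whole space. *)
Lemma indep_extend (H : set (set T)) (B : set T) : H `<=` measurable -> setI_closed H ->
  H setT -> measurable B -> (forall A, H A -> Pr (A `&` B) = Pr A * Pr B) ->
  forall A, <<s H >> A -> Pr (A `&` B) = Pr A * Pr B.
Proof.
move=> Hm HI HT mB HB A sA.
have fB : Pr B \is a fin_num by exact: fin_num_measure.
pose c := NngNum (fine_ge0 (measure_ge0 Pr B)).
rewrite -[LHS]/(mrestr Pr mB A) muleC -[in RHS](fineK fB) -[RHS]/(mscale c Pr A).
apply: (@g_sigma_algebra_measure_unique _ _ _ H Hm (fun=> setT)) => //.
- by rewrite bigcup_const.
- by move=> A' HA'; rewrite /= /mrestr /mscale/= HB// muleC fineK.
- by move=> k; rewrite /= /mrestr setTI ltey_eq fB.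
Qed.

Lemma indep_sigma A B : <<s G1 >> A -> <<s G2 >> B -> Pr (A `&` B) = Pr A * Pr B.
Proof.
move=> sA sB.
have mA : measurable A by apply: smallest_sub sA => //; exact: sigma_algebra_measurable.
rewrite setIC muleC; apply: (indep_extend (H := G2)) => // B' GB'.
rewrite setIC muleC; apply: (indep_extend (H := G1)) => // [|A' GA']; first exact: G2m.
exact: G12.
Qed.

Let diag (w : T) : g_sigma_algebraType G1 * g_sigma_algebraType G2 := (w, w).

Let mdiag : measurable_fun setT diag.
Proof. by apply: measurable_fun_pair; exact: measurable_to_sub_sigma. Qed.

HB.instance Definition _ := isMeasurableFun.Build _ _ _ _ diag mdiag.

(** Independence says that the image of [Pr] under the diagonal map is the product of its two
    restrictions. Freezing one argument by Tonelli then plays the role of conditioning. *)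
Lemma indep_fubini (F : T * T -> \bar R) :
  measurable_fun setT (F : g_sigma_algebraType G1 * g_sigma_algebraType G2 -> \bar R) ->
  (forall p, 0 <= F p) ->
  \int[Pr]_w F (w, w) = \int[Pr]_w \int[Pr]_w' F (w, w').
Proof.
move=> mF F0.
have E X : measurable X -> (sub_prob Pr G1m \x sub_prob Pr G2m) X = distribution Pr diag X.
  apply: product_measure_unique => A B mA mB /=.
  rewrite /pushforward /= -indep_sigma//.
have -> : \int[Pr]_w F (w, w) = \int[distribution Pr diag]_p F p.
  exact/esym/(@ge0_integral_distribution _ _ _ _ _ Pr diag F mF F0).
rewrite -(eq_measure_integral (distribution Pr diag) (fun X mX _ => E X mX)).
rewrite (fubini_tonelli1 _ mF F0) ge0_integral_sub_prob; first last.
- by move=> w; exact: integral_ge0.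
- exact: (measurable_fun_fubini_tonelli_F (m2 := sub_prob Pr G2m) _ mF F0).
apply: eq_integral => w _; rewrite /fubini_F (ge0_integral_sub_prob Pr G2m)//.
exact: measurableT_comp.
Qed.

End IndepFubini.

Section Rectangles.
Context d (T : measurableType d) (R : realType).

(** For finite [I], a pi-system generating the sigma-algebra of the family [X]. *)
Definition rectangles (I : Type) (X : I -> T -> R) : set (set T) :=
  [set A | exists2 C : I -> set R, (forall i, measurable (C i)) &
    A = [set w | forall i, C i (X i w)]].

Lemma rectanglesI (I : Type) (X : I -> T -> R) : setI_closed (rectangles X).
Proof.
move=> A B [C mC ->] [D mD ->]; exists (fun i => C i `&` D i).
  by move=> i; exact: measurableI.
apply/seteqP; split => w /=; first by move=> [HC HD] i; split.
by move=> H; split => i; have [] := H i.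
Qed.

Lemma rectanglesT (I : Type) (X : I -> T -> R) : rectangles X setT.
Proof. by exists (fun=> setT) => //; apply/seteqP; split. Qed.

Lemma rectangles_measurable (I : finType) (X : I -> T -> R) :
  (forall i, measurable_fun setT (X i)) -> rectangles X `<=` measurable.
Proof.
move=> mX A [C mC ->].
rewrite (_ : [set w | _] = \bigcap_(i in [set: I]) (X i @^-1` C i)); last first.
  by apply/seteqP; split => w /= H i; [move=> _; exact: H|exact: H].
apply: fin_bigcap_measurable => // i _.
by have := mX i measurableT _ (mC i); rewrite setTI.
Qed.

Lemma measurable_rectangles (I : eqType) (X : I -> T -> R) i :
  measurable_fun setT (X i : g_sigma_algebraType (rectangles X) -> R).
Proof.
move=> _ B mB; rewrite setTI; apply: sub_sigma_algebra.
exists (fun j => if j == i then B else setT).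
  by move=> j; case: ifP.
apply/seteqP; split => w /= H; last by have := H i; rewrite eqxx.
by move=> j; case: ifPn => // /eqP ->.
Qed.

End Rectangles.

Section GaussianVectors.
Local Open Scope ereal_scope.
Context d (T : measurableType d) (R : realType) (Pr : probability T R).
Variables (sigma : R) (sigma_gt0 : (0 < sigma)%R).
Local Notation gam := (normal_prob 0 sigma).

Lemma ge0_integral_law (X : T -> R) (mX : measurable_fun setT X) (g : R -> \bar R) :
  (forall B, measurable B -> Pr [set w | B (X w)] = gam B) ->
  measurable_fun setT g -> (forall x, 0 <= g x) ->
  \int[Pr]_w g (X w) = \int[gam]_x g x.
Proof.
move=> lX mg g0.
have mX' : measurable_fun setT (X : T -> measurableTypeR R) by exact: mX.
have mg' : measurable_fun setT (g : measurableTypeR R -> \bar R) by exact: mg.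
pose mXm := isMeasurableFun.Build _ _ _ _ (X : T -> measurableTypeR R) mX'.
pose Xf : {mfun T >-> measurableTypeR R} := HB.pack (X : T -> measurableTypeR R) mXm.
rewrite -[LHS](@ge0_integral_distribution _ _ _ _ _ Pr Xf g mg' g0).
by apply: (eq_measure_integral gam) => B mB _; exact: lX.
Qed.

Variables (N : nat) (V : T -> 'cV[R]_N).
Hypothesis gV : white_gaussian Pr sigma V.

Let mV i : measurable_fun setT (fun w => V w i 0%R). Proof. by case: gV. Qed.

(** Coordinates are added one at a time: the new one is independent of the partial sum, and
    [normal_conv] merges the two Gaussian variables into one. *)
Lemma white_gaussian_lincomb (b : 'cV[R]_N) (g : R -> \bar R) :
  measurable_fun setT g -> (forall x, 0 <= g x) ->
  \int[Pr]_w g (\sum_i b i 0 * V w i 0%R)%R =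
  \int[gam]_x g (Num.sqrt (\sum_i b i 0 ^+ 2) * x)%R.
Proof.
move=> mg g0.
(* Partial sums range over the indices below [k] of the fixed type ['I_N], which keeps [V] and its
   law unchanged along the induction. *)
suff H k : (k <= N)%N -> forall g : R -> \bar R, measurable_fun setT g ->
    (forall x, 0 <= g x) ->
    \int[Pr]_w g (\sum_(i < N | (i < k)%N) b i 0 * V w i 0%R)%R =
    \int[gam]_x g (Num.sqrt (\sum_(i < N | (i < k)%N) b i 0 ^+ 2) * x)%R.
  have := H N (leqnn N) g mg g0.
  under eq_integral do (under eq_bigl do rewrite ltn_ord).
  by under [in RHS]eq_bigl do rewrite ltn_ord.
elim: k => [_|k IH kN] {mg g0}g mg g0.
  under eq_integral do rewrite big_pred0//.
  rewrite [in RHS]big_pred0// sqrtr0.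
  under [in RHS]eq_integral do rewrite mul0r.
  transitivity (g 0%R * 1); first by rewrite integral_cst//; congr (_ * _); exact: probability_setT.
  by rewrite integral_cst//; congr (_ * _); apply/esym; exact: (@probability_setT _ _ _ gam).
pose i0 := Ordinal kN.
have split_sum (F : 'I_N -> R) :
    (\sum_(i < N | (i < k.+1)%N) F i = \sum_(i < N | (i < k)%N) F i + F i0)%R.
  rewrite (bigD1 i0) ?ltnS//= addrC; congr (_ + _)%R; apply: eq_bigl => i.
  by rewrite ltnS -val_eqE/= andbC -ltn_neqAle.
pose X (i : {i : 'I_N | (i < k)%N}) w : R := V w (val i) 0%R.
pose Y (_ : unit) w : R := V w i0 0%R.
have mX : rectangles X `<=` measurable by apply: rectangles_measurable => i; exact: mV.
have mY : rectangles Y `<=` measurable by apply: rectangles_measurable => i; exact: mV.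
have XY A B : rectangles X A -> rectangles Y B -> Pr (A `&` B) = Pr A * Pr B.
  move=> [C mC ->] [D mD ->]; have [_ _ indV] := gV.
  (* Mutual independence concerns all [N] coordinates: constraints on the first [k] are completed by
     [setT], and [CD] adds the one on coordinate [k]. *)
  pose C' (i : 'I_N) : set R := if insub i is Some j then C j else setT.
  have mC' i : measurable (C' i) by rewrite /C'; case: insubP.
  pose CD (i : 'I_N) := if i == i0 then D tt else C' i.
  have mCD i : measurable (CD i) by rewrite /CD; case: ifP.
  have C'0 : C' i0 = setT by rewrite /C' insubN//= ltnn.
  have XE : [set w | forall i, C i (X i w)] = [set w | forall i, C' i (V w i 0%R)].
    apply/seteqP; split => w /= H i; rewrite /C' /X.
      by case: insubP => // j _ <-; exact: H.
    by have := H (val i); rewrite /C' valK.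
  have YE : [set w | forall i, D i (Y i w)] = (fun w => V w i0 0%R) @^-1` D tt.
    by apply/seteqP; split => w /= H; [exact: H|case].
  have XYE : [set w | forall i, C i (X i w)] `&` [set w | forall i, D i (Y i w)] =
      [set w | forall i, CD i (V w i 0%R)].
    rewrite XE YE; apply/seteqP; split => w /= => [[HC HD] i|H].
      by rewrite /CD; case: eqP => [->|_].
    split=> [i|]; last by have := H i0; rewrite /CD eqxx.
    by have := H i; rewrite /CD; case: eqP => [->|]; rewrite ?C'0.
  rewrite XYE XE YE (indV _ mCD) (indV _ mC').
  rewrite (bigD1 i0)//= [in RHS](bigD1 i0)//= C'0 preimage_setT probability_setT mul1e.
  rewrite muleC /CD eqxx; congr (_ * _); apply: eq_bigr => i /negbTE.
  by move=> ->.
pose S w := (\sum_(i < N | (i < k)%N) b i 0 * V w i 0%R)%R.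
have mS : measurable_fun setT (S : g_sigma_algebraType (rectangles X) -> R).
  rewrite /S; under [X in measurable_fun _ X]boolp.eq_fun do rewrite big_mkcond.
  apply: measurable_sum => i; case: (boolP (i < k)%N) => ik //.
  apply: measurable_funM => //.
  exact: (@measurable_rectangles _ _ _ _ X (exist _ i ik)).
have mG : measurable_fun setT (fun p : R * R => g (p.1 + b i0 0 * p.2)%R).
  by apply: (measurableT_comp mg); apply: measurable_funD => //; exact: measurable_funM.
have mI := measurable_fun_fubini_tonelli_F (m2 := gam) _ mG (fun p => g0 _).
under eq_integral do rewrite split_sum.
have mF : measurable_fun setT ((fun p : T * T => g (S p.1 + b i0 0 * Y tt p.2)%R) :
    g_sigma_algebraType (rectangles X) * g_sigma_algebraType (rectangles Y) -> \bar R).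
  apply: (measurableT_comp mg); apply: measurable_funD.
    exact: (measurableT_comp mS).
  apply: measurable_funM => //.
  exact: (measurableT_comp (@measurable_rectangles _ _ _ _ Y tt)).
have -> := indep_fubini mX mY (@rectanglesI _ _ _ _ X) (@rectanglesI _ _ _ _ Y)
  (rectanglesT X) (rectanglesT Y)
  XY mF (fun p => g0 _).
transitivity (\int[Pr]_w \int[gam]_y g (S w + b i0 0 * y)%R).
  apply: eq_integral => w _.
  apply: (ge0_integral_law (mV i0) (g := fun y => g (S w + b i0 0 * y)%R)) => //.
    by case: gV => _ + _; apply.
  by apply: (measurableT_comp mg); apply: measurable_funD => //; exact: measurable_funM.
rewrite (IH (ltnW kN) _ mI); last by move=> x; exact: integral_ge0.
set s := Num.sqrt _; have sE : (\sum_(i < N | (i < k.+1)%N) b i 0 ^+ 2 = s ^+ 2 + b i0 0 ^+ 2)%R.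
  by rewrite split_sum sqr_sqrtr// sumr_ge0// => i _; exact: sqr_ge0.
rewrite sE; apply: (etrans _ (normal_conv sigma_gt0 s (b i0 0%R) mg g0)).
have mG' : measurable_fun setT (fun p : R * R => g (s * p.1 + b i0 0 * p.2)%R).
  by apply: (measurableT_comp mg); apply: measurable_funD => //; exact: measurable_funM.
exact: (fubini_tonelli (m1 := gam) (m2 := gam) _ mG' (fun p => g0 _)).
Qed.

(* Conditionally on [X], the random combination [\sum_i b i * V i] is normal. *)
Lemma white_gaussian_random_lincomb (I : finType) (X : I -> T -> R) (b : 'I_N -> T -> R)
    (g : R -> \bar R) :
  (forall i, measurable_fun setT (X i)) ->
  independent_families Pr (fun i w => V w i 0%R) X ->
  (forall i, measurable_fun setT (b i : g_sigma_algebraType (rectangles X) -> R)) ->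
  measurable_fun setT g -> (forall x, 0 <= g x) ->
  \int[Pr]_w g (\sum_i b i w * V w i 0%R)%R =
  \int[Pr]_w \int[gam]_x g (Num.sqrt (\sum_i b i w ^+ 2) * x)%R.
Proof.
move=> mX iXV mb mg g0; pose Y i w := V w i 0%R.
have XY A B : rectangles X A -> rectangles Y B -> Pr (A `&` B) = Pr A * Pr B.
  by move=> [C mC ->] [D mD ->]; rewrite setIC muleC; exact: iXV.
have mF : measurable_fun setT ((fun p : T * T => g (\sum_i b i p.1 * Y i p.2)%R) :
    g_sigma_algebraType (rectangles X) * g_sigma_algebraType (rectangles Y) -> \bar R).
  apply: (measurableT_comp mg); apply: measurable_sum => i; apply: measurable_funM.
    exact: (measurableT_comp (mb i)).
  exact: (measurableT_comp (@measurable_rectangles _ _ _ _ Y i)).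
have mY i : measurable_fun setT (Y i) by exact: mV.
have -> := indep_fubini (rectangles_measurable mX) (rectangles_measurable mY)
  (@rectanglesI _ _ _ _ X) (@rectanglesI _ _ _ _ Y) (rectanglesT X)
  (rectanglesT Y) XY mF (fun p => g0 _).
apply: eq_integral => w _ /=.
have := white_gaussian_lincomb (\col_i b i w) mg g0.
under eq_integral do under eq_bigr do rewrite mxE.
move=> ->; apply: eq_integral => x _.
by under [in LHS]eq_bigr do rewrite mxE.
Qed.

End GaussianVectors.

(** If [Q K] failed, the sets [A] with [Q (K minus A)] would form a proper filter containing [K];
    its cluster point in [K] contradicts the local hypothesis. *)
Lemma compact_induction (X : topologicalType) (K : set X) (Q : set X -> Prop) :
  compact K -> Q set0 -> (forall A B, Q A -> Q B -> Q (A `|` B)) ->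
  (forall A B, B `<=` A -> Q A -> Q B) ->
  (forall x, K x -> exists2 U, nbhs x U & Q U) -> Q K.
Proof.
move=> cK Q0 QU QS Qloc; apply: contrapT => nQK.
pose F : set_system X := [set A | Q (K `\` A)].
have FF : ProperFilter F.
  split.
    by rewrite /F/= setD0.
  split; rewrite /F/=.
  - by rewrite setDT.
  - move=> A B QA QB; apply: QS (QU _ _ QA QB) => x [Kx /not_andP[nA|nB]]; by [left|right].
  - by move=> A B AB; apply: QS => x [Kx nBx]; split => // Ax; exact/nBx/AB.
have [|x [Kx clx]] := cK F FF.
  by rewrite /F/= setDv.
have [U Ux QUx] := Qloc x Kx.
have FU : F (~` U) by apply: QS QUx => y [_ /contrapT].
by have [y [nUy Uy]] := clx _ _ FU Ux.
Qed.

(** * Approximation by trigonometric polynomials *)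

Section Trig.
Context {R : realType} {p : nat}.
Local Notation E := 'rV[R]_p.

(** The phase [b] makes sines available; cosines without phase are even and could not separate [x]
    from [- x]. *)
Inductive trig_poly : (E -> R) -> Prop :=
| trig_cos (a : 'cV[R]_p) (b : R) : trig_poly (fun x => cos ((x *m a) 0 0 + b))
| trig_add f g : trig_poly f -> trig_poly g -> trig_poly (fun x => f x + g x)
| trig_scale c f : trig_poly f -> trig_poly (fun x => c * f x).

Lemma trig_cst c : trig_poly (fun=> c).
Proof.
have -> : (fun=> c) = (fun x : E => c * cos ((x *m (0 : 'cV[R]_p)) 0 0 + 0)).
  by apply/funext => x; rewrite mulmx0 mxE addr0 cos0 mulr1.
exact/trig_scale/trig_cos.
Qed.

Lemma trig_mul f g : trig_poly f -> trig_poly g -> trig_poly (fun x => f x * g x).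
Proof.
move=> tf tg; elim: tf => {f} [a b|f1 f2 _ IH1 _ IH2|c f _ IH].
- elim: tg => {g} [a' b'|g1 g2 _ IH1 _ IH2|c g _ IH].
  + have -> : (fun x : E => cos ((x *m a) 0 0 + b) * cos ((x *m a') 0 0 + b')) =
        (fun x : E => 2^-1 * (cos ((x *m (a + a')) 0 0 + (b + b')) +
                             cos ((x *m (a - a')) 0 0 + (b - b')))).
      apply/funext => x.
      have -> : (x *m (a + a')) 0 0 = (x *m a) 0 0 + (x *m a') 0 0 by rewrite mulmxDr mxE.
      have -> : (x *m (a - a')) 0 0 = (x *m a) 0 0 - (x *m a') 0 0.
        by rewrite mulmxBr [LHS]mxE [X in _ + X = _]mxE.
      set u := (x *m a) 0 0; set v := (x *m a') 0 0.
      have -> : u + v + (b + b') = (u + b) + (v + b') by ring.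
      have -> : u - v + (b - b') = (u + b) - (v + b') by ring.
      by move: (u + b) (v + b') => A B; rewrite cosD cosB; field.
    by apply: trig_scale; apply: trig_add; exact: trig_cos.
  + by under boolp.eq_fun do rewrite mulrDr; exact: trig_add.
  + by under boolp.eq_fun do rewrite mulrCA; exact: trig_scale.
- by under boolp.eq_fun do rewrite mulrDl; exact: trig_add.
- by under boolp.eq_fun do rewrite -mulrA; exact: trig_scale.
Qed.

Lemma trig_bounded f : trig_poly f -> exists2 M : R, 0 < M & forall x, `|f x| <= M.
Proof.
elim => {f} [a b|f g _ [M M0 fM] _ [M' M'0 gM']|c f _ [M M0 fM]].
- by exists 1 => // x; rewrite ler_norml cos_geN1 cos_le1.
- exists (M + M') => [|x]; first exact: addr_gt0.
  by rewrite (le_trans (ler_normD _ _))// lerD.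
- exists ((`|c| + 1) * M) => [|x]; first by rewrite mulr_gt0// ltr_wpDl.
  by rewrite normrM ler_pM// ler_wpDr.
Qed.

Lemma ridge_continuous (a : 'cV[R]_p) : continuous (fun x : E => (x *m a) 0 0).
Proof.
move=> x; apply: differentiable_continuous.
under [X in differentiable X _]boolp.eq_fun do rewrite mxE.
apply: differentiable_bigsum => i.
apply: (@differentiableM _ _ (fun x : E => x 0 i) (cst (a i 0))); last exact: differentiable_cst.
exact: differentiable_coord.
Qed.

Lemma trig_continuous f : trig_poly f -> continuous f.
Proof.
elim => {f} [a b|f g _ cf _ cg|c f _ cf] x.
- apply: (@continuous_comp _ _ _ (fun x : E => (x *m a) 0 0 + b) cos).
    exact: (cvgD (@ridge_continuous a x) (cvg_cst b)).
  exact: continuous_cos.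
- exact: (cvgD (cf x) (cg x)).
- exact: (cvgM (cvg_cst c) (cf x)).
Qed.

(** The approximation is uniform on the whole space, so that convergence of expectations passes to
    these limits with no control of the tails. *)
Definition trig_limit (f : E -> R) :=
  continuous f /\ forall e, 0 < e -> exists2 t, trig_poly t & forall x, `|f x - t x| <= e.

Lemma trig_limit_poly f : trig_poly f -> trig_limit f.
Proof.
move=> tf; split; first exact: trig_continuous.
by move=> e e0; exists f => // x; rewrite subrr normr0 ltW.
Qed.

Lemma trig_limit_bounded f : trig_limit f -> exists2 M : R, 0 < M & forall x, `|f x| <= M.
Proof.
move=> [_ /(_ 1 ltr01)[t /trig_bounded[M M0 tM] ft]]; exists (1 + M) => [|x]; first exact: addr_gt0.
by rewrite -(subrK (t x) (f x)) (le_trans (ler_normD _ _))// lerD.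
Qed.

Lemma trig_limitD f g : trig_limit f -> trig_limit g -> trig_limit (fun x => f x + g x).
Proof.
move=> [cf Hf] [cg Hg]; split; first by move=> x; exact: (cvgD (cf x) (cg x)).
move=> e e0; have e20 : 0 < e / 2 by rewrite divr_gt0.
have [t tt ft] := Hf _ e20; have [s ss gs] := Hg _ e20.
exists (fun x => t x + s x); first exact: trig_add.
move=> x; rewrite opprD addrACA (le_trans (ler_normD _ _))// (splitr e) lerD//.
Qed.

Lemma trig_limitM f g : trig_limit f -> trig_limit g -> trig_limit (fun x => f x * g x).
Proof.
move=> lf lg; have [M M0 fM] := trig_limit_bounded lf.
have [cf Hf] := lf; have [cg Hg] := lg.
split; first by move=> x; exact: (cvgM (cf x) (cg x)).
move=> e e0.
have e1 : 0 < e / (2 * M) by rewrite divr_gt0// mulr_gt0.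
have [s ss gs] := Hg _ e1; have [B B0 sB] := trig_bounded ss.
have e2 : 0 < e / (2 * B) by rewrite divr_gt0// mulr_gt0.
have [t tt ft] := Hf _ e2.
exists (fun x => t x * s x); first exact: trig_mul.
move=> x; have -> : f x * g x - t x * s x = f x * (g x - s x) + (f x - t x) * s x by ring.
rewrite (le_trans (ler_normD _ _))// (splitr e) !normrM lerD//.
  have -> : e / 2 = M * (e / (2 * M)) by field; rewrite gt_eqF.
  by rewrite ler_pM.
have -> : e / 2 = e / (2 * B) * B by field; rewrite gt_eqF.
by rewrite ler_pM.
Qed.

Lemma trig_limit_cst c : trig_limit (fun=> c).
Proof. exact/trig_limit_poly/trig_cst. Qed.

Lemma trig_limitZ c f : trig_limit f -> trig_limit (fun x => c * f x).
Proof. by move=> lf; exact: (trig_limitM (trig_limit_cst c) lf). Qed.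

(* Newton-type iteration for the square root of [t ^+ 2]; it increases to [`|t|]
   on [-1, 1]. *)
Fixpoint abs_iter (n : nat) (t : R) : R :=
  if n is m.+1 then abs_iter m t + 2^-1 * (t * t - abs_iter m t * abs_iter m t) else 0.

(** With [u] the current iterate, the error [d = |t| - u] becomes [d * (1 - (|t| + u) / 2)], at most
    [d * (1 - d / 2)], and this recursion preserves the bound [2 / (n + 2)]. *)
Lemma abs_iterP n t : `|t| <= 1 ->
  [/\ 0 <= abs_iter n t, abs_iter n t <= `|t| & `|t| - abs_iter n t <= 2 / n.+2%:R].
Proof.
move=> t1; elim: n => [|n [u0 ut un]] /=; first by rewrite subr0 divff ?pnatr_eq0.
have tt : t * t = `|t| * `|t| by rewrite -!expr2 real_normK// num_real.
rewrite tt; move: (abs_iter n t) (`|t|) t1 u0 ut un (normr_ge0 t) => u s s1 u0 us un s0.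
split; [nra|nra|].
have n0 : 0 <= n%:R :> R by exact: ler0n.
move: un; rewrite -[n.+3]addn3 -[n.+2]addn2 !natrD; move: (n%:R) n0 => m m0 un.
have d1 : (s - u) * (m + 2) <= 2 by rewrite -ler_pdivlMr// ltr_wpDl.
rewrite ler_pdivlMr; last by rewrite ltr_wpDl.
have sE : s - (u + 2^-1 * (s * s - u * u)) = (s - u) * (1 - (s + u) / 2) by field.
rewrite sE.
have : (s - u) * (1 - (s + u) / 2) <= (s - u) * (1 - (s - u) / 2).
  by rewrite ler_wpM2l ?subr_ge0// lerD2l lerN2 ler_wpM2r// lerD2l; lra.
move=> /(ler_wpM2r (_ : 0 <= m + 3)) H; apply: (le_trans (H _)); first by rewrite addr_ge0.
have : 0 <= s - u <= 1 by apply/andP; split; lra.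
move: (s - u) d1 => d d1 /andP[d0 dd1].
nra.
Qed.

(** Division by a bound [M] brings [f] into [[-1, 1]], where the polynomial iteration converges to
    the absolute value uniformly. *)
Lemma trig_limit_abs f : trig_limit f -> trig_limit (fun x => `|f x|).
Proof.
move=> lf; have [M M0 fM] := trig_limit_bounded lf.
have iterL n : trig_limit (fun x => abs_iter n (M^-1 * f x)).
  elim: n => [|n IH] /=; first exact: trig_limit_cst.
  apply: trig_limitD => //; apply: trig_limitZ; apply: trig_limitD.
    by apply: trig_limitM; exact: trig_limitZ.
  have -> : (fun x => - (abs_iter n (M^-1 * f x) * abs_iter n (M^-1 * f x))) =
    (fun x => -1 * (abs_iter n (M^-1 * f x) * abs_iter n (M^-1 * f x))).
    by apply/funext => x; rewrite mulN1r.
  by apply: trig_limitZ; exact: trig_limitM.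
split.
  by move=> x; exact: (cvg_norm (lf.1 x)).
move=> e e0; have e20 : 0 < e / 2 by rewrite divr_gt0.
have [n Hn] : exists n, M * (2 / n.+2%:R) <= e / 2.
  exists (Num.truncn (4 * M / e)); rewrite mulrA ler_pdivrMr ?ltr0n//.
  have := truncnS_gt (4 * M / e); rewrite ltr_pdivrMr//.
  by rewrite -[_.+2]addn1 natrD; lra.
have [_ /(_ _ e20)[t tt ft]] := trig_limitZ M (iterL n).
exists t => // x.
have f1 : `|M^-1 * f x| <= 1.
  by rewrite normrM normfV (gtr0_norm M0) ler_pdivrMl// mulr1.
have [u0 us un] := abs_iterP n f1.
rewrite -(subrK (M * abs_iter n (M^-1 * f x)) `|f x|) -addrA (le_trans (ler_normD _ _))//.
rewrite (splitr e) lerD// (le_trans _ Hn)//.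
have -> : `|f x| = M * `|M^-1 * f x|.
  by rewrite normrM normfV (gtr0_norm M0) mulrA mulfV ?mul1r// gt_eqF.
by rewrite -mulrBr normrM (gtr0_norm M0) ler_pM2l// ger0_norm ?subr_ge0.
Qed.

Lemma trig_limit_max f g : trig_limit f -> trig_limit g ->
  trig_limit (fun x => Num.max (f x) (g x)).
Proof.
move=> lf lg.
have -> : (fun x => Num.max (f x) (g x)) =
    (fun x => 2^-1 * ((f x + g x) + `|f x + -1 * g x|)).
  apply/funext => x; rewrite mulN1r; case: (leP (f x) (g x)) => h.
    by rewrite ler0_norm ?subr_le0//; lra.
  by rewrite gtr0_norm ?subr_gt0//; lra.
apply/trig_limitZ/trig_limitD; first exact: trig_limitD.
apply: trig_limit_abs; apply: trig_limitD => //; exact: trig_limitZ.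
Qed.

Lemma trig_limit_min f g : trig_limit f -> trig_limit g ->
  trig_limit (fun x => Num.min (f x) (g x)).
Proof.
move=> lf lg.
have -> : (fun x => Num.min (f x) (g x)) =
    (fun x => -1 * Num.max (-1 * f x) (-1 * g x)).
  by apply/funext => x; rewrite !mulN1r oppr_max !opprK.
by apply/trig_limitZ/trig_limit_max; exact: trig_limitZ.
Qed.

Lemma trig_limit_separates (x y : E) (u v : R) : x != y ->
  exists h, [/\ trig_limit h, h x = u & h y = v].
Proof.
move=> xy; have [i xyi] : exists i, x 0 i != y 0 i.
  apply: contrapT => H; move: xy => /eqP; apply; apply/rowP => i.
  by apply: contrapT => /eqP xyi; apply: H; exists i.
pose c := (x 0 i - y 0 i)^-1; have c0 : x 0 i - y 0 i != 0 by rewrite subr_eq0.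
have s1 : sin (1 : R) != 0.
  by rewrite gt_eqF// sin_gt0_pi// ltr01 (lt_le_trans _ (pi_ge2 R))// ltr1n.
(* The function is [v + (u - v) * sin (c * (z_i - y_i)) / sin 1]: the sine vanishes at [y] and
   equals [sin 1] at [x]. The phase [- pi / 2] writes it as a cosine. *)
exists (fun z => v + (u - v) / sin 1 *
  cos ((z *m (c *: delta_mx i 0 : 'cV[R]_p)) 0 0 + (- (c * y 0 i) - pi / 2))).
have cE z : cos ((z *m (c *: delta_mx i 0 : 'cV[R]_p)) 0 0 + (- (c * y 0 i) - pi / 2)) =
    sin (c * (z 0 i - y 0 i)).
  rewrite addrA cosBpihalf -scalemxAr mxE -colE mxE; congr sin; ring.
split; rewrite ?cE.
- apply: trig_limitD; first exact: trig_limit_cst.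
  by apply/trig_limitZ/trig_limit_poly/trig_cos.
- by rewrite mulVf// divfK// addrC subrK.
- by rewrite subrr mulr0 sin0 mulr0 addr0.
Qed.

(* Stone's lattice argument: on a compact set, [f] is squeezed between finite
   minima and maxima of functions interpolating it at two points. *)
Lemma trig_limit_dense (K : set E) (f : E -> R) (M e : R) : compact K -> continuous f ->
  (forall x, `|f x| <= M) -> 0 < e ->
  exists2 h, trig_limit h & (forall x, K x -> `|f x - h x| <= e) /\ (forall x, `|h x| <= M).
Proof.
move=> cK cf fM e0.
have near_lt (h : E -> R) y : trig_limit h -> h y = f y ->
    (\near y, h y < f y + e) /\ (\near y, f y - e < h y).
  move=> [ch _] hy.
  have cd : (fun z => h z - f z) @ y --> 0 by rewrite -(subrr (f y)) -{1}hy; exact: cvgB (ch y) (cf y).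
  split.
    by apply: (filterS _ (cvgr_lt _ cd e e0)) => z /=; rewrite ltrBlDl.
  have e0' : - e < 0 by rewrite oppr_lt0.
  by apply: (filterS _ (cvgr_gt _ cd _ e0')) => z /=; rewrite ltrBrDl.
have interp x y : exists h, [/\ trig_limit h, h x = f x & h y = f y].
  have [->|xy] := eqVneq x y; first by exists (fun=> f y); split => //; exact: trig_limit_cst.
  exact: trig_limit_separates.
have upper x : exists h, [/\ trig_limit h, h x = f x & forall z, K z -> h z < f z + e].
  apply: (compact_induction
    (Q := fun U => exists h, [/\ trig_limit h, h x = f x & forall z, U z -> h z < f z + e]) cK).
  - by exists (fun=> f x); split => //; exact: trig_limit_cst.
  - move=> A B [h [lh hx hA]] [k [lk kx kB]]; exists (fun z => Num.min (h z) (k z)).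
    split; [exact: trig_limit_min|by rewrite hx kx minxx|].
    by move=> z [/hA|/kB] Hz; rewrite gt_min Hz ?orbT.
  - by move=> A B BA [h [lh hx hA]]; exists h; split => // z /BA; exact: hA.
  - move=> y Ky; have [h [lh hx hy]] := interp x y.
    by have [+ _] := near_lt h y lh hy; exists [set z | h z < f z + e] => //; exists h.
have [h [lh hu hl]] : exists h, [/\ trig_limit h, (forall z, K z -> h z < f z + e) &
    forall z, K z -> f z - e < h z].
  apply: (compact_induction (Q := fun U => exists h, [/\ trig_limit h,
    (forall z, K z -> h z < f z + e) & forall z, U z -> f z - e < h z]) cK).
  - exists (fun=> - M); split => // [|z _]; first exact: trig_limit_cst.
    by have := fM z; rewrite ler_norml => /andP[]; lra.
  - move=> A B [h [lh hK hA]] [k [lk kK kB]]; exists (fun z => Num.max (h z) (k z)).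
    split; [exact: trig_limit_max|by move=> z Kz; rewrite gt_max hK// kK|].
    by move=> z [/hA|/kB] Hz; rewrite lt_max Hz ?orbT.
  - by move=> A B BA [h [lh hK hA]]; exists h; split => // z /BA; exact: hA.
  - move=> y Ky; have [h [lh hy hK]] := upper y.
    by have [_ +] := near_lt h y lh hy; exists [set z | f z - e < h z] => //; exists h.
(* Clamping to [[-M, M]] gives the bound outside [K] and does not spoil the approximation on [K],
   since [f] takes its values there. *)
exists (fun z => Num.max (- M) (Num.min M (h z))).
  by apply: trig_limit_max; [exact: trig_limit_cst|apply: trig_limit_min => //; exact: trig_limit_cst].
split=> x.
  move=> Kx; have := hu x Kx; have := hl x Kx; have := fM x; rewrite !ler_norml => /andP[].
  move: (f x) (h x) => a b a1 a2 b1 b2; have MM : - M <= M by lra.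
  case: (leP M b) => H; first by rewrite (max_r MM); apply/andP; split; lra.
  by case: (leP (- M) b) => H2; apply/andP; split; lra.
have M0 : 0 <= M by exact: le_trans (fM x).
by rewrite ler_norml le_max lexx/= ge_max ge_min lexx andbT; lra.
Qed.

End Trig.

(** * Expectations of bounded and of bounded continuous functions *)

Section BoundedConvergence.
Context {d : measure_display} {T : measurableType d} {R : realType}.
Variable Pr : probability T R.

Lemma Rintegral_cst_prob (c : R) : \int[Pr]_x c = c.
Proof. by rewrite Rintegral_cst// [X in fine X]probability_setT mulr1. Qed.

Lemma bounded_integrable (f : T -> R) M :
  measurable_fun setT f -> (forall x, `|f x| <= M) -> Pr.-integrable setT (EFin \o f).
Proof.
move=> mf fM; apply: measurable_bounded_integrable => //.
- by rewrite [ltLHS]probability_setT ltry.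
- exists M; split; first exact: num_real.
  by move=> B MB x _; apply: (le_trans (fM x)); exact: ltW.
Qed.

Lemma bounded_convergence (f_ : nat -> T -> R) (f : T -> R) M :
  (forall k, measurable_fun setT (f_ k)) -> measurable_fun setT f ->
  (forall k x, `|f_ k x| <= M) -> {ae Pr, forall x, f_^~ x @ \oo --> f x} ->
  (fun k => \int[Pr]_x f_ k x) @ \oo --> \int[Pr]_x f x.
Proof.
move=> mf_ mf f_M f_f.
have [|||||If _ H] := @dominated_convergence _ T R Pr setT measurableT
  (fun k x => (f_ k x)%:E) (EFin \o f) (cst M%:E).
- by move=> k; apply/measurable_EFinP.
- exact/measurable_EFinP.
- apply: filterS f_f => x H _; apply/fine_cvgP; split; first exact: nearW.
  exact: H.
- exact: finite_measure_integrable_cst.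
- by apply: aeW => x k _; rewrite lee_fin.
apply/fine_cvg; rewrite fineK; last exact: integrable_fin_num.
exact: H.
Qed.

End BoundedConvergence.

Lemma lipschitz1_continuous (R : realType) (g : R -> R) :
  (forall s t, `|g s - g t| <= `|s - t|) -> continuous g.
Proof.
move=> gL x; apply/cvgrPdist_le => e e0.
apply: filterS (nbhsx_ballx (x : R) e e0) => t /= xt.
by rewrite (le_trans (gL _ _))// ltW.
Qed.

Section BoundedContinuous.
Context {R : realType} {p : nat}.
Local Notation E := 'rV[R]_p.

Lemma borel_measurable_continuous (f : E -> R) :
  continuous f -> measurable_fun setT (f : borel_rV p -> R).
Proof.
move=> cf; apply: (measurability _ (RGenOInfty.measurableE R)).
move=> /= _ [_ [a ->]] <-; rewrite setTI; apply: sub_sigma_algebra.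
rewrite /= preimage_itvoy; apply: (@open_comp _ _ f [set y | a < y]); last exact: open_gt.
by move=> x _; exact: cf.
Qed.

Definition bounded_cont (f : E -> R) := continuous f /\ exists M, forall x, `|f x| <= M.

Lemma bounded_contD f g : bounded_cont f -> bounded_cont g -> bounded_cont (fun x => f x + g x).
Proof.
move=> [cf [M fM]] [cg [B gB]]; split; first by move=> x; exact: (cvgD (cf x) (cg x)).
by exists (M + B) => x; rewrite (le_trans (ler_normD _ _))// lerD.
Qed.

Lemma bounded_cont_cst c : bounded_cont (fun=> c).
Proof. by split; [exact: cst_continuous|exists `|c|]. Qed.

Lemma bounded_contZ c f : bounded_cont f -> bounded_cont (fun x => c * f x).
Proof.
move=> [cf [M fM]]; split; first by move=> x; exact: (cvgM (cvg_cst c) (cf x)).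
by exists (`|c| * M) => x; rewrite normrM ler_wpM2l.
Qed.

Lemma bounded_cont_norm f : bounded_cont f -> bounded_cont (fun x => `|f x|).
Proof.
move=> [cf [M fM]]; split; first by move=> x; exact: (cvg_norm (cf x)).
by exists M => x; rewrite normr_id.
Qed.

Lemma bounded_cont_sum (F : 'I_p -> E -> R) :
  (forall i, bounded_cont (F i)) -> bounded_cont (fun x => \sum_i F i x).
Proof.
move=> bF; elim: (index_enum _) => [|i s IH].
  under boolp.eq_fun do rewrite big_nil.
  exact: bounded_cont_cst.
under boolp.eq_fun do rewrite big_cons.
exact: bounded_contD.
Qed.

Lemma trig_limit_bounded_cont f : trig_limit f -> bounded_cont f.
Proof.
by move=> lf; split; [exact: lf.1|have [M _ fM] := trig_limit_bounded lf; exists M].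
Qed.

Lemma lipschitz_ridge_bounded_cont (a : 'cV[R]_p) (g : R -> R) :
  (forall t, `|g t| <= 1) -> (forall s t, `|g s - g t| <= `|s - t|) ->
  bounded_cont (fun x : E => g ((x *m a) 0 0)).
Proof.
move=> g1 gL; split; last by exists 1.
move=> x; apply: (@continuous_comp _ _ _ (fun x : E => (x *m a) 0 0) g).
  exact: ridge_continuous.
exact: lipschitz1_continuous.
Qed.

Lemma bounded_cont_integrable (P : probability (borel_rV p) R) f :
  bounded_cont f -> P.-integrable setT (EFin \o f).
Proof.
move=> [cf [M fM]]; apply: (@bounded_integrable _ _ _ P f M _ fM).
exact: borel_measurable_continuous.
Qed.

Lemma Rintegral_close (P : probability (borel_rV p) R) f g q :
  bounded_cont f -> bounded_cont g -> bounded_cont q ->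
  (forall x, `|f x - g x| <= q x) ->
  `|\int[P]_x f x - \int[P]_x g x| <= \int[P]_x q x.
Proof.
move=> bf bg bq fgq.
have If := bounded_cont_integrable P bf; have Ig := bounded_cont_integrable P bg.
have bfg : bounded_cont (fun x => f x - g x).
  under boolp.eq_fun do rewrite -mulN1r.
  by apply: bounded_contD => //; exact: bounded_contZ.
rewrite -RintegralB//.
apply: (le_trans (le_normr_Rintegral measurableT (bounded_cont_integrable P bfg))).
apply: le_Rintegral => //; apply: bounded_cont_integrable => //.
exact: bounded_cont_norm.
Qed.

End BoundedContinuous.

(** * The Cramer-Wold device *)

Section CramerWold.
Context {R : realType} {p : nat}.
Local Notation E := 'rV[R]_p.
Variables (nu : nat -> probability (@borel_rV R p) R) (mu : probability (@borel_rV R p) R).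

Let expect_cvg (f : E -> R) := (fun N => \int[nu N]_x f x) @ \oo --> \int[mu]_x f x.

Hypothesis ridge_cvg : forall (a : 'cV[R]_p) (g : R -> R),
  (forall t, `|g t| <= 1) -> (forall s t, `|g s - g t| <= `|s - t|) ->
  expect_cvg (fun x => g ((x *m a) 0 0)).

Lemma expect_cvgD f g : bounded_cont f -> bounded_cont g ->
  expect_cvg f -> expect_cvg g -> expect_cvg (fun x => f x + g x).
Proof.
move=> bf bg cf cg; rewrite /expect_cvg RintegralD//; [|exact: bounded_cont_integrable..].
under boolp.eq_fun do (rewrite RintegralD//; [|exact: bounded_cont_integrable..]).
exact: cvgD cf cg.
Qed.

Lemma expect_cvgZ c f : bounded_cont f -> expect_cvg f -> expect_cvg (fun x => c * f x).
Proof.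
move=> bf cf; rewrite /expect_cvg RintegralZl//; last exact: bounded_cont_integrable.
under boolp.eq_fun do (rewrite RintegralZl//; last exact: bounded_cont_integrable).
exact: (cvgM (cvg_cst c) cf).
Qed.

Lemma cos_lipschitz (s t : R) : `|cos s - cos t| <= `|s - t|.
Proof.
wlog ts : s t / t <= s => [W|].
  by have [/W//|/ltW/W] := leP t s; rewrite distrC [`|t - s|]distrC.
have [c _ ->] : exists2 c, c \in `[t, s]%R & cos s - cos t = - sin c * (s - t).
  apply: MVT_segment => //; apply: continuous_subspaceT => x; exact: continuous_cos.
rewrite normrM normrN ler_piMl// ler_norml sin_geN1 sin_le1//.
Qed.

Lemma trig_expect_cvg f : trig_poly f -> expect_cvg f.
Proof.
elim => {f} [a b|f g tf cf tg cg|c f tf cf].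
- apply: (ridge_cvg (g := fun t => cos (t + b))) => [t|s t].
    by rewrite ler_norml cos_geN1 cos_le1.
  by rewrite (le_trans (cos_lipschitz _ _))// opprD addrACA subrr addr0.
- by apply: expect_cvgD => //; exact/trig_limit_bounded_cont/trig_limit_poly.
- by apply: expect_cvgZ => //; exact/trig_limit_bounded_cont/trig_limit_poly.
Qed.

Lemma expect_cvg_approx f : (forall e, 0 < e -> exists g, expect_cvg g /\
    (\forall N \near \oo, `|\int[nu N]_x f x - \int[nu N]_x g x| <= e) /\
    `|\int[mu]_x f x - \int[mu]_x g x| <= e) -> expect_cvg f.
Proof.
move=> H; apply/cvgrPdist_le => e e0.
have e3 : 0 < e / 3 by rewrite divr_gt0.
have [g [cg [H1 H2]]] := H _ e3.
move/cvgrPdist_le: cg => /(_ _ e3) cg.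
near=> N.
have A1 : `|\int[nu N]_x f x - \int[nu N]_x g x| <= e / 3 by near: N.
have A2 : `|\int[mu]_x g x - \int[nu N]_x g x| <= e / 3.
  by near: N; exact: cg.
move: H2 A1 A2.
move: (\int[nu N]_x f x) (\int[nu N]_x g x) (\int[mu]_x f x) (\int[mu]_x g x) => a b u v.
move=> uv ab vb; have eE : e = e / 3 + (e / 3 + e / 3) by field.
rewrite (le_trans (ler_distD v _ _))// eE lerD//.
by rewrite (le_trans (ler_distD b _ _))// lerD// distrC.
Unshelve. all: by end_near. Qed.

Lemma trig_limit_expect_cvg f : trig_limit f -> expect_cvg f.
Proof.
move=> lf; apply: expect_cvg_approx => e e0; have [_ /(_ _ e0)[t tt ft]] := lf.
have bf := trig_limit_bounded_cont lf.
have bt := trig_limit_bounded_cont (trig_limit_poly tt).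
have bnd (P : probability (@borel_rV R p) R) : `|\int[P]_x f x - \int[P]_x t x| <= e.
  by rewrite -[leRHS](Rintegral_cst_prob P) Rintegral_close//; exact: bounded_cont_cst.
by exists t; split; [exact: trig_expect_cvg|split => //; exact: nearW].
Qed.

Let clip k (t : R) : R := Num.min 1 (`|t| / k.+1%:R).

Let clip_ge0 k t : 0 <= clip k t.
Proof. by rewrite le_min ler01 divr_ge0. Qed.

Let clip_le1 k t : clip k t <= 1.
Proof. by rewrite ge_min lexx. Qed.

Let clip_norm k t : `|clip k t| <= 1.
Proof. by rewrite ger0_norm// ge_min lexx. Qed.

Let clip_lipschitz k s t : `|clip k s - clip k t| <= `|s - t|.
Proof.
have k1 : 1 <= k.+1%:R :> R by rewrite ler1n.
have H : `| `|s| / k.+1%:R - `|t| / k.+1%:R| <= `|s - t|.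
  rewrite -mulrBl normrM normfV [`|k.+1%:R|]ger0_norm// ler_pdivrMr ?ltr0n//.
  by rewrite (le_trans (ler_dist_dist _ _))// ler_peMr.
apply: le_trans H; rewrite /clip; move: (_ / _) (`|t| / _) => u v.
case: (leP 1 u) => ?; case: (leP 1 v) => ?; rewrite ?subrr ?normr0//;
  rewrite ler_norml; apply/andP; split;
  by (have := ler_norm (u - v); have := ler_norm (v - u); rewrite distrC; lra).
Qed.

(** Dominates the indicator of the complement of the ball of radius [k + 1] in the sup norm. Being a
    sum of ridge functions, it has convergent expectations, which is how tightness of the laws
    [nu N] is obtained. *)
Let tail k (x : E) : R := \sum_i clip k (x 0 i).

Let tailE k (x : E) : tail k x = \sum_i clip k ((x *m delta_mx i (0 : 'I_1)) 0 0).
Proof. by apply: eq_bigr => i _; rewrite -colE mxE. Qed.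

Let clip_bounded_cont k (i : 'I_p) :
  bounded_cont (fun x : E => clip k ((x *m delta_mx i (0 : 'I_1)) 0 0)).
Proof. by apply: lipschitz_ridge_bounded_cont. Qed.

Let tail_bounded_cont k : bounded_cont (tail k).
Proof.
have -> : tail k = fun x => \sum_i clip k ((x *m delta_mx i (0 : 'I_1)) 0 0).
  by apply/funext => x; exact: tailE.
exact: bounded_cont_sum.
Qed.

Let tail_cvg k : expect_cvg (tail k).
Proof.
have -> : tail k = fun x => \sum_i clip k ((x *m delta_mx i (0 : 'I_1)) 0 0).
  by apply/funext => x; exact: tailE.
suff : bounded_cont (fun x : E => \sum_(i <- index_enum 'I_p) clip k ((x *m delta_mx i (0 : 'I_1)) 0 0))
    /\ expect_cvg (fun x => \sum_(i <- index_enum 'I_p) clip k ((x *m delta_mx i (0 : 'I_1)) 0 0)).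
  by case.
elim: (index_enum _) => [|i s [bs cs]].
  under boolp.eq_fun do rewrite big_nil.
  split; first exact: bounded_cont_cst.
  exact/trig_expect_cvg/trig_cst.
under boolp.eq_fun do rewrite big_cons.
split; first exact: bounded_contD.
by apply: expect_cvgD => //; exact: ridge_cvg.
Qed.

Let clip_cvg0 (t : R) : (clip^~ t) @ \oo --> (0 : R).
Proof.
have H : (fun k => `|t| / k.+1%:R) @ \oo --> (0 : R).
  rewrite -[X in _ --> X](mulr0 `|t|); apply: cvgM; first exact: cvg_cst.
  exact: cvg_harmonic.
apply: (squeeze_cvgr _ (cvg_cst 0) H).
by apply: nearW => k; rewrite clip_ge0 /clip ge_min lexx orbT.
Qed.

Let tail_ge0 k x : 0 <= tail k x.
Proof. by rewrite sumr_ge0. Qed.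

Let tail_small : (fun k => \int[mu]_x tail k x) @ \oo --> (0 : R).
Proof.
rewrite -[X in _ --> X](Rintegral_cst_prob mu 0).
apply: (@bounded_convergence _ _ _ mu _ _ p%:R) => [k||k x|].
- by apply: borel_measurable_continuous; exact: (tail_bounded_cont k).1.
- exact: measurable_cst.
- rewrite ger0_norm// /tail (le_trans (ler_sum _ (fun i _ => clip_le1 k (x 0 i))))//.
  by rewrite sumr_const card_ord.
- apply: aeW => x; rewrite -[X in _ --> X](@big1 R 0 +%R 'I_p (index_enum _) xpredT (fun=> 0))//.
  by apply: cvg_big => //; exact: add_continuous.
Qed.

(** On a large ball [f] is within [e / 2] of a limit [h] of trigonometric polynomials; outside it
    the difference is at most [2 * M], hence at most [2 * M * tail k]. *)
Theorem cramer_wold f : bounded_cont f -> expect_cvg f.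
Proof.
move=> bf; have [cf [M0 fM0]] := bf; pose M := `|M0| + 1.
have M_gt0 : 0 < M by rewrite ltr_wpDl.
have fM x : `|f x| <= M by rewrite (le_trans (fM0 x))// (le_trans (ler_norm _))// lerDl.
apply: expect_cvg_approx => e e0.
have e2 : 0 < e / 2 by rewrite divr_gt0.
have e4 : 0 < e / (4 * M) by rewrite divr_gt0// mulr_gt0.
(* Under [mu] the tail is kept below half of [e / (4 * M)]; the strict gap lets [nu N] satisfy the
   bound [e / (4 * M)] for large [N]. *)
have [k tk] : exists k, \int[mu]_x tail k x <= e / (8 * M).
  have e8 : 0 < e / (8 * M) by rewrite divr_gt0// mulr_gt0.
  move/cvgrPdist_le: (tail_small) => /(_ _ e8)[k _ Hk].
  exists k; have := Hk k (leqnn k); rewrite sub0r normrN; exact/le_trans/ler_norm.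
have cK : compact [set x : E | `|x| <= k.+1%:R].
  apply: bounded_closed_compact.
    exists k.+1%:R; split; first exact: num_real.
    by move=> B kB x /= xk; rewrite (le_trans xk)// ltW.
  rewrite (_ : [set x | _] = (@Num.norm R E) @^-1` [set t | t <= k.+1%:R])//.
  by apply: preimage_closed; [move=> x _; exact: norm_continuous|exact: closed_le].
have [h lh [fh hM]] := trig_limit_dense cK cf fM e2.
have bh := trig_limit_bounded_cont lh.
have bq : bounded_cont (fun x => e / 2 + 2 * M * tail k x).
  by apply: bounded_contD; [exact: bounded_cont_cst|exact: bounded_contZ].
have t0 x : 0 <= tail k x by exact: tail_ge0.
have fhq x : `|f x - h x| <= e / 2 + 2 * M * tail k x.
  have [xk|xk] := leP `|x| k.+1%:R.
    by rewrite (le_trans (fh x xk))// lerDl !mulr_ge0// ltW.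
  have t1 : 1 <= tail k x.
    rewrite leNgt; apply/negP => tx; move: xk; rewrite ltNge => /negP; apply.
    apply: normr_mx_le => // k' i; rewrite (ord1 k') leNgt; apply/negP => xi.
    move: tx; rewrite ltNge => /negP; apply.
    rewrite /tail (bigD1 i)//= (_ : clip k (x 0 i) = 1) ?lerDl ?sumr_ge0//.
    by rewrite /clip min_l// ler_pdivlMr ?ltr0n// mul1r ltW.
  rewrite (le_trans (ler_normB _ _))//; have := fM x; have := hM x.
  by move: (tail k x) t1 (`|f x|) (`|h x|) => t t1 u v; nra.
have close (P : probability (@borel_rV R p) R) :
    `|\int[P]_x f x - \int[P]_x h x| <= e / 2 + 2 * M * \int[P]_x tail k x.
  apply: (le_trans (Rintegral_close P bf bh bq fhq)).
  have I1 := bounded_cont_integrable P (bounded_cont_cst (p := p) (e / 2)).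
  have I2 := bounded_cont_integrable P (bounded_contZ (2 * M) (tail_bounded_cont k)).
  rewrite (RintegralD measurableT I1 I2) Rintegral_cst_prob.
  by rewrite (RintegralZl (2 * M) measurableT (bounded_cont_integrable P (tail_bounded_cont k))).
exists h; split; first exact: trig_limit_expect_cvg.
have bound t : t <= e / (4 * M) -> e / 2 + 2 * M * t <= e.
  by rewrite ler_pdivlMr ?mulr_gt0// => H; lra.
split; last first.
  rewrite (le_trans (close mu))// bound// (le_trans tk)// ler_pM2l// lef_pV2 ?posrE ?mulr_gt0//.
  by rewrite ler_pM2r// ler_nat.
have : \int[mu]_x tail k x < e / (4 * M).
  rewrite (le_lt_trans tk)// ltr_pM2l// ltf_pV2 ?posrE ?mulr_gt0//.
  by rewrite ltr_pM2r// ltr_nat.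
move=> /(cvgr_lt _ (@tail_cvg k)); apply: filterS => N tN.
by rewrite (le_trans (close (nu N)))// bound// ltW.
Qed.

End CramerWold.

(** * Measurability of random matrices and vectors *)

Section MeasurableMatrices.
Context {d : measure_display} {T : measurableType d} {R : realType}.

Lemma measurable_inv : measurable_fun setT (@GRing.inv R).
Proof.
rewrite -(setvU [set (0 : R)]); apply/measurable_funU.
- exact: (measurableC (@measurable_set1 R 0)).
- exact: (@measurable_set1 R 0).
split; last exact: measurable_fun_set1.
apply: open_continuous_measurable_fun.
  by apply: closed_openC; exact: closed_eq.
by move=> x; rewrite inE /= => /eqP x0; exact: inv_continuous.
Qed.

Definition mx_measurable m n (A : T -> 'M[R]_(m, n)) :=
  forall i j, measurable_fun setT (fun w => A w i j).

Lemma mx_measurable_cst m n (A : 'M[R]_(m, n)) : mx_measurable (fun=> A).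
Proof. by move=> i j; exact: measurable_cst. Qed.

Lemma mx_measurable_scale m n (c : T -> R) (A : T -> 'M[R]_(m, n)) :
  measurable_fun setT c -> mx_measurable A -> mx_measurable (fun w => c w *: A w).
Proof.
by move=> mc mA i j; under boolp.eq_fun do rewrite mxE; exact: measurable_funM.
Qed.

Lemma mx_measurable_mul m n q (A : T -> 'M[R]_(m, n)) (B : T -> 'M[R]_(n, q)) :
  mx_measurable A -> mx_measurable B -> mx_measurable (fun w => A w *m B w).
Proof.
move=> mA mB i j; under boolp.eq_fun do rewrite mxE.
by apply: measurable_sum => k; exact: measurable_funM.
Qed.

Lemma mx_measurable_tr m n (A : T -> 'M[R]_(m, n)) :
  mx_measurable A -> mx_measurable (fun w => (A w)^T).
Proof. by move=> mA i j; under boolp.eq_fun do rewrite mxE; exact: mA. Qed.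

Lemma measurable_det n (A : T -> 'M[R]_n) :
  mx_measurable A -> measurable_fun setT (fun w => \det (A w)).
Proof.
move=> mA; apply: measurable_sum => s; apply: measurable_funM; first exact: measurable_cst.
by apply: measurable_prod => i _; exact: mA.
Qed.

Lemma mx_measurable_adjinv n (A : T -> 'M[R]_n) :
  mx_measurable A -> mx_measurable (fun w => adjinv (A w)).
Proof.
move=> mA; apply: mx_measurable_scale.
  exact: (measurableT_comp measurable_inv (measurable_det mA)).
move=> i j; under boolp.eq_fun do rewrite mxE /cofactor.
apply: measurable_funM; first exact: measurable_cst.
by apply: measurable_det => k l; under boolp.eq_fun do rewrite !mxE; exact: mA.
Qed.

(* The rational boxes form a countable base of the topology. *)
Lemma borel_measurable_entries p (X : T -> 'rV[R]_p) :
  (forall i, measurable_fun setT (fun w => X w 0 i)) ->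
  measurable_fun setT (X : T -> borel_rV p).
Proof.
move=> mX; apply: (@measurability _ _ T (borel_rV p) setT X (@open 'rV[R]_p)) => //.
move=> _ [U oU <-]; rewrite setTI.
pose box (q : 'rV[rat]_p * nat) : set 'rV[R]_p :=
  [set x | forall i, `|ratr (q.1 0 i) - x 0 i| < q.2.+1%:R^-1].
have -> : X @^-1` U = \bigcup_q (if `[< box q `<=` U >] then X @^-1` box q else set0).
  apply/seteqP; split=> [w Uw|w [q _]]; last by case: ifPn => // /asboolP; exact.
  have /nbhs_ballP[e /= e0 eU] : nbhs (X w) U by exact: open_nbhs_nbhs.
  have [k ke] : exists k, k.+1%:R^-1 < e / 2.
    have /cvgrPdist_lt/(_ (e / 2))[|k _ H] := @cvg_harmonic R.
      by rewrite divr_gt0.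
    exists k; have := H k (leqnn k); rewrite sub0r normrN; exact/le_lt_trans/ler_norm.
  have H i : exists q : rat, `|ratr q - X w 0 i| < k.+1%:R^-1 :> R.
    have /rat_in_itvoo[q] : X w 0 i - k.+1%:R^-1 < X w 0 i + k.+1%:R^-1 :> R.
      by rewrite ltrD2l gtrN ?invr_gt0.
    by rewrite in_itv/= => qX; exists q; rewrite ltr_distl.
  have [q qP] := choice H.
  exists (\row_i q i, k) => //; have -> : `[< box (\row_i q i, k) `<=` U >].
    apply/asboolP => x xq; apply: eU; split=> // i j; rewrite (ord1 i) /ball/=.
    have := qP j; have := xq j; rewrite /= mxE; move: (ratr _) (k.+1%:R^-1) ke => t c.
    rewrite !ltr_distl => ? /andP[? ?] /andP[? ?].
    by apply/andP; split; lra.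
  by move=> i /=; rewrite mxE.
apply: countable_bigcupT_measurable => // q; case: ifPn => // _.
have -> : X @^-1` box q = \big[setI/setT]_i
    [set w | `|ratr (q.1 0 i) - X w 0 i| < q.2.+1%:R^-1].
  rewrite -bigcap_seq; apply/seteqP; split=> w H i => [_|]; first exact: H.
  by apply: H; rewrite /= mem_index_enum.
apply: bigsetI_measurable => i _.
have m : measurable_fun setT (fun w => `|ratr (q.1 0 i) - X w 0 i|).
  by apply: measurableT_comp => //; exact: measurable_funB.
have := m measurableT _ (measurable_itv `]-oo, (q.2.+1%:R^-1 : R)[); rewrite setTI.
by congr measurable; apply/seteqP; split=> w /=; rewrite in_itv.
Qed.

Lemma borel_continuous_comp p q (f : 'rV[R]_p -> 'rV[R]_q) (X : T -> 'rV[R]_p) :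
  continuous f -> measurable_fun setT (X : T -> borel_rV p) ->
  measurable_fun setT (f \o X : T -> borel_rV q).
Proof.
move=> cf mX.
have mf : measurable_fun setT (f : borel_rV p -> borel_rV q).
  apply: (@measurability _ _ (borel_rV p) (borel_rV q) setT f (@open 'rV[R]_q)) => //.
  move=> _ [U oU <-]; rewrite setTI; apply: sub_sigma_algebra.
  by apply: open_comp => // x _; exact: cf.
exact: (measurableT_comp mf mX).
Qed.

End MeasurableMatrices.

Section BoundedExpectation.
Context {d : measure_display} {T : measurableType d} {R : realType}.
Variable Pr : probability T R.

Lemma expect_bound (f : T -> R) M : measurable_fun setT f -> (forall x, `|f x| <= M) ->
  `|\int[Pr]_x f x| <= M.
Proof.
move=> mf fM; have If := bounded_integrable Pr mf fM.
apply: (le_trans (le_normr_Rintegral measurableT If)).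
rewrite -[leRHS](Rintegral_cst_prob Pr); apply: le_Rintegral => //.
- apply: (@bounded_integrable _ _ _ Pr _ M); first exact: measurableT_comp.
  by move=> x; rewrite normr_id.
- exact: finite_measure_integrable_cst.
Qed.

(** Adding the bound makes the integrand nonnegative; identities proved for nonnegative functions
    thus transfer to bounded ones of either sign. *)
Lemma integral_shift (f : T -> R) M : measurable_fun setT f -> (forall x, `|f x| <= M) ->
  (\int[Pr]_x (f x + M)%:E)%E = (\int[Pr]_x f x + M)%:E.
Proof.
move=> mf fM; have If := bounded_integrable Pr mf fM.
have Ic : Pr.-integrable setT (EFin \o cst M) by exact: finite_measure_integrable_cst.
have IfM : Pr.-integrable setT (fun x => (f x + M)%:E).
  exact: (integrableD measurableT If Ic).
rewrite -[LHS]fineK; last exact: integrable_fin_num.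
by rewrite -[fine _]/(\int[Pr]_x (f x + M)) (RintegralD measurableT If Ic) Rintegral_cst_prob.
Qed.

End BoundedExpectation.

Section NormalScaleMean.
Context {R : realType} (sigma : R).
Hypothesis sigma_gt0 : 0 < sigma.
Variables (g : R -> R) (M : R).
Hypotheses (cg : continuous g) (gM : forall t, `|g t| <= M).

(** The mean of [h] under the centred normal law of variance [sigma ^+ 2 * v]. The argument is [v]
    itself, the quadratic form whose convergence is known. *)
Definition normal_scale_mean (h : R -> R) (v : R) : R :=
  \int[normal_prob 0 sigma]_x h (Num.sqrt v * x).

Let mg : measurable_fun setT g. Proof. exact: continuous_measurable_fun. Qed.

Let mgs s : measurable_fun setT (fun x : measurableTypeR R => g (s * x)).
Proof. by apply: (measurableT_comp mg); exact: measurable_funM. Qed.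

Lemma normal_scale_mean_bound v : `|normal_scale_mean g v| <= M.
Proof. by apply: expect_bound => // x; exact: gM. Qed.

Lemma normal_scale_mean_continuous : continuous (normal_scale_mean g).
Proof.
move=> v; have vI : v \in `]v - 1, v + 1[%classic.
  by rewrite inE/= in_itv/=; apply/andP; split; lra.
apply: (@continuity_under_integral _ _ _ (normal_prob 0 sigma)
  (fun u x => g (Num.sqrt u * x)) setT measurableT (v - 1) (v + 1) _ _ (cst M) _ _ v vI).
- move=> u _; apply: (@bounded_integrable _ _ _ _ _ M) => // x; exact: gM.
- apply: aeW => x _ u _.
  apply: (@continuous_comp _ _ _ (fun u => Num.sqrt u * x) g); last exact: cg.
  by apply: cvgM; [exact: sqrt_continuous|exact: cvg_cst].
- exact: finite_measure_integrable_cst.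
- by move=> u _; apply: aeW => x _; exact: gM.
Qed.

Context {d : measure_display} {T : measurableType d}.
Variables (Pr : probability T R) (N : nat) (V : T -> 'cV[R]_N).
Hypothesis gV : white_gaussian Pr sigma V.

Let G (t : R) : \bar R := (g t + M)%:E.

Let mG : measurable_fun setT G.
Proof. by apply/measurable_EFinP; exact: measurable_funD. Qed.

Let G0 t : (0 <= G t)%E.
Proof. by rewrite lee_fin; have := gM t; rewrite ler_norml => /andP[+ _]; lra. Qed.

Let mV i : measurable_fun setT (fun w => V w i 0). Proof. by case: gV. Qed.

Lemma expect_lincomb (b : 'cV[R]_N) :
  \int[Pr]_w g (\sum_i b i 0 * V w i 0) = normal_scale_mean g (\sum_i b i 0 ^+ 2).
Proof.
have := white_gaussian_lincomb sigma_gt0 gV b mG G0.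
rewrite /G integral_shift//; last first.
  apply: (measurableT_comp mg); apply: measurable_sum => i.
  by apply: measurable_funM => //; exact: measurable_cst.
by rewrite integral_shift// => -[/addIr].
Qed.

Lemma expect_random_lincomb (I : finType) (X : I -> T -> R) (b : 'I_N -> T -> R) :
  (forall i, measurable_fun setT (X i)) ->
  independent_families Pr (fun i w => V w i 0) X ->
  (forall i, measurable_fun setT (b i : g_sigma_algebraType (rectangles X) -> R)) ->
  \int[Pr]_w g (\sum_i b i w * V w i 0) =
  \int[Pr]_w normal_scale_mean g (\sum_i b i w ^+ 2).
Proof.
move=> mX iXV mb; have := white_gaussian_random_lincomb sigma_gt0 gV mX iXV mb mG G0.
have mbT i : measurable_fun setT (b i).
  by apply: (measurable_sub_sigma _ (mb i)); exact: rectangles_measurable.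
rewrite /G integral_shift//; last first.
  by apply: (measurableT_comp mg); apply: measurable_sum => i; exact: measurable_funM.
under [X in _ = X -> _]eq_integral do rewrite integral_shift//.
rewrite integral_shift; first by move=> [/addIr].
- apply: (measurableT_comp (continuous_measurable_fun normal_scale_mean_continuous)).
  by apply: measurable_sum => i; exact: measurable_funX.
- by move=> w; exact: normal_scale_mean_bound.
Qed.

End NormalScaleMean.

(** * Asymptotics of least squares *)

Section LeastSquares.
Context {R : realType} {N n : nat}.

Definition scaled_gram (Phi : 'M[R]_(N, n)) : 'M[R]_n := N%:R^-1 *: (Phi^T *m Phi).

(** A total form of [sqrt N] times the least squares error, measurable on all samples; [ols_errorE]
    gives the usual expression under full rank. *)
Definition ols_error (Phi : 'M[R]_(N, n)) (V : 'cV[R]_N) : 'cV[R]_n :=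
  (Num.sqrt N%:R)^-1 *: (adjinv (scaled_gram Phi) *m Phi^T *m V).

Definition ols_coef (Phi : 'M[R]_(N, n)) (c : 'cV[R]_n) : 'rV[R]_N :=
  (Num.sqrt N%:R)^-1 *: (c^T *m adjinv (scaled_gram Phi) *m Phi^T).

(** Left uncancelled because a sample matrix may be singular; for invertible symmetric [S] it
    reduces to [quad (invmx S) c]. *)
Definition ols_scale (S : 'M[R]_n) (c : 'cV[R]_n) : R :=
  quad (adjinv S *m S *m (adjinv S)^T) c.

Lemma ols_error_lincomb Phi V c :
  ((ols_error Phi V)^T *m c) 0 0 = \sum_i ols_coef Phi c 0 i * V i 0.
Proof.
rewrite -scalar_trmx trmx_mul trmxK /ols_error -scalemxAr !mulmxA scalemxAl.
by rewrite mxE.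
Qed.

Lemma ols_coef_sqr Phi c : \sum_i ols_coef Phi c 0 i ^+ 2 = ols_scale (scaled_gram Phi) c.
Proof.
have -> : \sum_i ols_coef Phi c 0 i ^+ 2 = (ols_coef Phi c *m (ols_coef Phi c)^T) 0 0.
  by rewrite mxE; apply: eq_bigr => i _; rewrite [_^T _ _]mxE expr2.
rewrite /ols_coef; set B := c^T *m _ *m _.
rewrite linearZ/= -scalemxAr -scalemxAl scalerA -invfM -expr2 sqr_sqrtr//.
rewrite /B /ols_scale /quad; move: (adjinv _) => W.
rewrite /scaled_gram -scalemxAr -scalemxAl -scalemxAr -scalemxAl.
by rewrite !trmx_mul !trmxK !mulmxA.
Qed.

Lemma ols_errorE Phi V : (0 < N)%N -> \rank Phi = n ->
  ols_error Phi V = Num.sqrt N%:R *: (invmx (Phi^T *m Phi) *m Phi^T *m V).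
Proof.
move=> N0 rP; have uG := posdef_unit (posdef_gram rP).
have N0' : N%:R != 0 :> R by rewrite pnatr_eq0 -lt0n.
rewrite /ols_error adjinvE ?unitmxZ ?unitfE ?invr_eq0// invmxZ ?invrK ?unitmxZ ?unitfE ?invr_eq0//.
rewrite -!scalemxAl scalerA -{2}[N%:R]sqr_sqrtr// expr2 mulKf// sqrtr_eq0 -ltNge ltr0n//.
Qed.

End LeastSquares.

Section LeastSquaresAsymptotics.
Context {d : measure_display} {T : measurableType d} {R : realType}.
Variables (Pr : probability T R) (n : nat) (sigma : R).
Hypothesis sigma_gt0 : 0 < sigma.
Variables (Phi : forall N : nat, T -> 'M[R]_(N, n)) (V : forall N : nat, T -> 'cV[R]_N).
Hypothesis Phi_meas : forall N i j, measurable_fun setT (fun w => Phi N w i j).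
Hypothesis V_gauss : forall N, white_gaussian Pr sigma (V N).
Hypothesis V_indep_Phi : forall N, independent_families Pr (fun i w => V N w i 0)
  (fun (ij : 'I_N * 'I_n) w => Phi N w ij.1 ij.2).
Variable Sigma : 'M[R]_n.
Hypothesis A2_Phi : {ae Pr, forall w, (fun N => scaled_gram (Phi N w)) @ \oo --> Sigma}.
Hypothesis A2_Sigma : posdef Sigma.

Let mx_measurable_gram d' (T' : measurableType d') N (F : T' -> 'M[R]_(N, n)) :
  mx_measurable F -> mx_measurable (fun w => scaled_gram (F w)).
Proof.
move=> mF; apply: mx_measurable_scale; first exact: measurable_cst.
by apply: mx_measurable_mul => //; exact: mx_measurable_tr.
Qed.

Let mx_measurable_coef d' (T' : measurableType d') N (F : T' -> 'M[R]_(N, n)) c :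
  mx_measurable F -> mx_measurable (fun w => ols_coef (F w) c).
Proof.
move=> mF; apply: mx_measurable_scale; first exact: measurable_cst.
apply: mx_measurable_mul; last exact: mx_measurable_tr.
apply: mx_measurable_mul; first exact: mx_measurable_cst.
exact/mx_measurable_adjinv/mx_measurable_gram.
Qed.

Lemma measurable_ols_error N (c : 'cV[R]_n) :
  measurable_fun setT (fun w => ((ols_error (Phi N w) (V N w))^T *m c) 0 0).
Proof.
under boolp.eq_fun do rewrite ols_error_lincomb.
apply: measurable_sum => i; apply: measurable_funM; last by case: (V_gauss N).
exact: (@mx_measurable_coef _ _ N (Phi N) c (@Phi_meas N) 0 i).
Qed.

Lemma measurable_adjinv_gram N : mx_measurable (fun w => adjinv (scaled_gram (Phi N w))).
Proof. exact: mx_measurable_adjinv (mx_measurable_gram (@Phi_meas N)). Qed.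

Lemma adjinv_gram_cvg : {ae Pr, forall w,
  (fun N => adjinv (scaled_gram (Phi N w))) @ \oo --> invmx Sigma}.
Proof.
apply: filterS A2_Phi => w H; rewrite -(adjinvE (posdef_unit A2_Sigma)).
apply: (continuous_cvg _ _ H); apply: differentiable_continuous; apply/mx_diffP.
apply: mx_diff_adjinv; last exact: posdef_unit.
by move=> i j; exact: differentiable_coord.
Qed.

Lemma ols_scale_cvg c : {ae Pr, forall w,
  (fun N => ols_scale (scaled_gram (Phi N w)) c) @ \oo --> quad (invmx Sigma) c}.
Proof.
have uS := posdef_unit A2_Sigma.
have -> : quad (invmx Sigma) c = ols_scale Sigma c.
  by rewrite /ols_scale adjinvE// mulVmx// mul1mx (posdef_inv A2_Sigma).1.
have ct : {for Sigma, continuous (fun S : 'M[R]_n => ols_scale S c)}.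
  have di : mx_diff (fun S : 'M[R]_n => S) Sigma by move=> i j; exact: differentiable_coord.
  have da := mx_diff_adjinv di uS.
  apply: differentiable_continuous; apply: differentiable_quad; last exact: mx_diff_cst.
  by apply: mx_diffM; [apply: mx_diffM|apply: mx_diff_tr].
by apply: filterS A2_Phi => w H; exact: (continuous_cvg _ ct H).
Qed.

(** Integrating the noise out first leaves the mean of a bounded continuous function of [ols_scale],
    so almost sure convergence of [ols_scale] suffices. *)
Lemma ols_error_mean_cvg (g : R -> R) M (c : 'cV[R]_n) :
  continuous g -> (forall t, `|g t| <= M) ->
  (fun N => \int[Pr]_w g (((ols_error (Phi N w) (V N w))^T *m c) 0 0)) @ \oo -->
  normal_scale_mean sigma g (quad (invmx Sigma) c).
Proof.
move=> cg gM; have cm : continuous (normal_scale_mean sigma g).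
  exact: (normal_scale_mean_continuous cg gM).
have E N : \int[Pr]_w g (((ols_error (Phi N w) (V N w))^T *m c) 0 0) =
    \int[Pr]_w normal_scale_mean sigma g (ols_scale (scaled_gram (Phi N w)) c).
  under eq_Rintegral do rewrite ols_error_lincomb.
  under [RHS]eq_Rintegral do rewrite -ols_coef_sqr.
  apply: (expect_random_lincomb (b := fun i w => ols_coef (Phi N w) c 0 i)
    sigma_gt0 cg gM (V_gauss N) _ (@V_indep_Phi N)).
    by move=> ij; exact: Phi_meas.
  move=> i; apply: (@mx_measurable_coef _ (g_sigma_algebraType _) N (Phi N) c _ 0 i).
  move=> k l; exact: (@measurable_rectangles _ _ _ _
    (fun (ij : 'I_N * 'I_n) w => Phi N w ij.1 ij.2) (k, l)).
under boolp.eq_fun do rewrite E.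
rewrite -(Rintegral_cst_prob Pr (normal_scale_mean _ _ _)).
apply: (@bounded_convergence _ _ _ Pr _ _ M).
- move=> N; under boolp.eq_fun do rewrite -ols_coef_sqr.
  apply: (measurableT_comp (continuous_measurable_fun cm)).
  apply: measurable_sum => i; apply: measurable_funX.
  exact: (@mx_measurable_coef _ _ N (Phi N) c (@Phi_meas N) 0 i).
- exact: measurable_cst.
- by move=> N w; exact: normal_scale_mean_bound.
- by apply: filterS (ols_scale_cvg c) => w H; apply: (continuous_cvg _ _ H); exact: cm.
Qed.

End LeastSquaresAsymptotics.

(** * Laws of random vectors and Gaussian images *)

Section VectorLaw.
Context {d : measure_display} {T : measurableType d} {R : realType} {p : nat}.
Variable Pr : probability T R.

Lemma law_exists (X : T -> 'rV[R]_p) : measurable_fun setT (X : T -> borel_rV p) ->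
  exists mu : probability (@borel_rV R p) R,
    (forall A, measurable A -> mu A = Pr (X @^-1` A)) /\
    forall f, bounded_cont f -> \int[mu]_x f x = \int[Pr]_w f (X w).
Proof.
move=> mX; pose mXm := isMeasurableFun.Build _ _ _ _ (X : T -> borel_rV p) mX.
pose Xf : {mfun T >-> borel_rV p} := HB.pack (X : T -> borel_rV p) mXm.
exists (distribution Pr Xf); split=> [//|f [cf [M fM]]].
have mf := borel_measurable_continuous cf.
have mfE : measurable_fun setT (EFin \o (f : borel_rV p -> R)) by exact/measurable_EFinP.
congr fine; apply: (@integral_distribution _ _ _ _ _ Pr Xf _ mfE).
apply: (@bounded_integrable _ _ _ Pr (f \o X) M); last by move=> w; exact: fM.
exact: (measurableT_comp mf mX).
Qed.

End VectorLaw.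

Section NormalScaling.
Context {R : realType} (sigma : R).
Hypothesis sigma_gt0 : 0 < sigma.

Lemma normal_pdf_scale (r z : R) : 0 < r ->
  normal_pdf 0 (r * sigma) z = r^-1 * normal_pdf 0 sigma (z / r).
Proof.
move=> r0; have r0' : r != 0 by rewrite gt_eqF.
have s0 : sigma != 0 by rewrite gt_eqF.
rewrite !normal_pdfE ?mulf_neq0// /normal_peak /normal_fun !subr0 mulrA.
congr (_ * expR _); last by field; rewrite r0' s0.
rewrite exprMn -mulrA -mulrnAr sqrtrM ?sqr_ge0// sqrtr_sqr ger0_norm ?ltW//.
by rewrite invfM.
Qed.

Lemma normal_law_scale (r : R) (B : set R) : 0 <= r -> measurable B ->
  (\int[normal_prob 0 sigma]_x (\1_B (r * x) : R)%:E)%E =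
  normal_law 0 (sigma ^+ 2 * r ^+ 2) B.
Proof.
move=> r0 mB; have s0 : sigma != 0 by rewrite gt_eqF.
have mI : measurable_fun setT (fun x : R => (\1_B x : R)%:E).
  by apply/measurable_EFinP; exact: measurable_indic.
have I0 (x : R) : (0 <= (\1_B x : R)%:E)%E by rewrite lee_fin.
rewrite /normal_law mulf_eq0 !sqrf_eq0 (negbTE s0)/=; have [->|rn0] := eqVneq r 0.
  under eq_integral do rewrite mul0r.
  rewrite integral_cst// [X in (_ * X)%E]probability_setT mule1.
  by rewrite diracE indicE.
have rp : 0 < r by rewrite lt_def rn0.
rewrite (ge0_integral_normal_scale sigma mI I0 rn0).
rewrite (gtr0_norm rp) -exprMn sqrtr_sqr gtr0_norm ?mulr_gt0// [(sigma * r)%R]mulrC.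
have <- : (\int[normal_prob 0 (r * sigma)]_x (\1_B x : R)%:E = normal_prob 0 (r * sigma) B)%E.
  by rewrite integral_indic// setIT.
rewrite (ge0_integral_normal (r * sigma) mI I0); apply: eq_integral => x _.
by rewrite normal_pdf_scale.
Qed.

End NormalScaling.

Section GaussianVectorLaw.
Context {d : measure_display} {T : measurableType d} {R : realType}.
Variables (Pr : probability T R) (sigma : R) (N p : nat) (V : T -> 'cV[R]_N).
Hypotheses (sigma_gt0 : 0 < sigma) (gV : white_gaussian Pr sigma V).

(** The law of [V^T B] serves as witness. [B] may be rank deficient, so everything is read on linear
    functionals, whose variance may be 0. *)
Lemma gaussian_image_law (B : 'M[R]_(N, p)) :
  exists mu : probability (@borel_rV R p) R,
    is_gaussian mu 0 (sigma ^+ 2 *: (B^T *m B)) /\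
    forall (g : R -> R) M, continuous g -> (forall t, `|g t| <= M) ->
      forall a, \int[mu]_x g ((x *m a) 0 0) = normal_scale_mean sigma g (quad (B^T *m B) a).
Proof.
have mV i : measurable_fun setT (fun w => V w i 0) by case: gV.
pose X w := (V w)^T *m B.
have mX : measurable_fun setT (X : T -> borel_rV p).
  apply: borel_measurable_entries => i; rewrite /X; under boolp.eq_fun do rewrite mxE.
  apply: measurable_sum => k; apply: measurable_funM; last exact: measurable_cst.
  by under boolp.eq_fun do rewrite mxE; exact: mV.
have Xa a w : (X w *m a) 0 0 = \sum_i (B *m a) i 0 * V w i 0.
  by rewrite /X -mulmxA mxE; apply: eq_bigr => i _; rewrite mxE mulrC.
have [mu [muE muI]] := law_exists Pr mX; exists mu; split.
  split.
  - by rewrite linearZ/= trmx_mul trmxK.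
  - by move=> a; rewrite quadZ mulr_ge0 ?sqr_ge0 ?quad_gram_ge0.
  move=> a A mA; rewrite mul0mx mxE quadZ.
  have mS : measurable_fun setT (fun w => (X w *m a) 0 0).
    under boolp.eq_fun do rewrite Xa.
    by apply: measurable_sum => i; apply: measurable_funM => //; exact: measurable_cst.
  have mXa : measurable_fun setT ((fun x : 'rV[R]_p => (x *m a) 0 0) : borel_rV p -> R).
    by apply: borel_measurable_continuous; exact: ridge_continuous.
  rewrite muE; last by have := mXa measurableT _ mA; rewrite setTI.
  have -> : X @^-1` [set x | A ((x *m a) 0 0)] = [set w | A ((X w *m a) 0 0)] by [].
  have <- : (\int[Pr]_w (\1_A ((X w *m a) 0 0) : R)%:E = Pr [set w | A ((X w *m a) 0%R 0%R)])%E.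
    have mAS : measurable [set w | A ((X w *m a) 0 0)].
      by have := mS measurableT _ mA; rewrite setTI.
    by rewrite (integral_indic Pr measurableT mAS) setIT.
  under eq_integral do rewrite Xa.
  rewrite (white_gaussian_lincomb sigma_gt0 gV (B *m a) (g := fun t => (\1_A t : R)%:E)).
  - rewrite (normal_law_scale sigma_gt0 (sqrtr_ge0 _) mA) -(quad_gram B a).
    by rewrite (sqr_sqrtr (quad_gram_ge0 B a)).
  - by apply/measurable_EFinP; exact: measurable_indic.
  - by move=> x; rewrite lee_fin.
move=> g M cg gM a; rewrite muI.
  under eq_Rintegral do rewrite Xa.
  by rewrite (expect_lincomb sigma_gt0 cg gM gV) -quad_gram.
split; last by exists M => x; exact: gM.
move=> x; apply: (@continuous_comp _ _ _ (fun x : 'rV[R]_p => (x *m a) 0 0) g).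
  exact: ridge_continuous.
exact: cg.
Qed.

End GaussianVectorLaw.

(** * The expansion at a given sample *)

Section SampleExpansion.
Context {R : realType} {n p : nat}.
Variables (theta0 : 'cV[R]_n) (Omega : set 'rV[R]_p) (P : 'rV[R]_p -> 'M[R]_n).
Hypotheses (oO : open Omega) (P_C2 : C2_on Omega P).
Hypothesis pP : forall eta, Omega eta -> posdef (P eta).
Variables (eta : 'rV[R]_p) (eta_min : argmin Omega (W_b P theta0) eta).
Variables (K : set 'rV[R]_p) (K_compact : compact K) (K_sub : K `<=` Omega).
Hypothesis K_min : K `&` argmin Omega (W_b P theta0) = [set eta].
Hypothesis A_unit : A_b P theta0 eta \in unitmx.
Variables (sigma : R) (sigma_gt0 : 0 < sigma).
Let Oeta : Omega eta := eta_min.1.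

(** An upper bound for [sqrt N] times the norm of [sigma ^+ 2 *: invmx (Phi^T *m Phi)] under full
    rank. The sum of absolute entries replaces the norm, which makes measurability immediate. *)
Definition gram_error N (Phi : 'M[R]_(N, n)) : R :=
  sigma ^+ 2 * (\sum_i \sum_j `|adjinv (scaled_gram Phi) i j|) / Num.sqrt N%:R.

Let W_bE y : Omega y -> W_b P theta0 y = eb_crit theta0 (P y + 0).
Proof. by move=> Oy; rewrite /W_b (PinvE pP Oy) addr0. Qed.

Lemma argmin_F_EB N (Phi : 'M[R]_(N, n)) V y : \rank Phi = n ->
  argmin Omega (fun x => F_EB Phi sigma (Phi *m theta0 + V) (P x)) y ->
  let G := invmx (Phi^T *m Phi) in
  forall x, Omega x ->
  eb_crit (theta0 + G *m Phi^T *m V) (P y + sigma ^+ 2 *: G) <=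
  eb_crit (theta0 + G *m Phi^T *m V) (P x + sigma ^+ 2 *: G).
Proof.
move=> rP [Oy ymin] G x Ox; have := ymin x Ox.
rewrite (F_EB_reduce sigma_gt0 rP (pP Oy)) (F_EB_reduce sigma_gt0 rP (pP Ox)) lerD2l.
have -> : G *m Phi^T *m (Phi *m theta0 + V) = theta0 + G *m Phi^T *m V.
  by rewrite mulmxDr -!mulmxA (mulmxA Phi^T) mulKmx//; exact/posdef_unit/posdef_gram.
by [].
Qed.

Lemma gram_norm_le N (Phi : 'M[R]_(N, n)) : (0 < N)%N -> \rank Phi = n ->
  `|sigma ^+ 2 *: invmx (Phi^T *m Phi)| <= gram_error Phi / Num.sqrt N%:R.
Proof.
move=> N0 rP; have uG := posdef_unit (posdef_gram rP).
have N0' : N%:R != 0 :> R by rewrite pnatr_eq0 -lt0n.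
have -> : invmx (Phi^T *m Phi) = N%:R^-1 *: adjinv (scaled_gram Phi).
  rewrite adjinvE ?unitmxZ ?unitfE ?invr_eq0// /scaled_gram.
  by rewrite invmxZ ?unitmxZ ?unitfE ?invr_eq0// invrK scalerA mulVf// scale1r.
rewrite scalerA normrZ ger0_norm ?divr_ge0 ?sqr_ge0//.
have -> : gram_error Phi / Num.sqrt N%:R =
    sigma ^+ 2 / N%:R * \sum_i \sum_j `|adjinv (scaled_gram Phi) i j|.
  by rewrite /gram_error -(mulrA _ _^-1) -invfM -expr2 sqr_sqrtr// mulrAC.
rewrite ler_wpM2l ?divr_ge0 ?sqr_ge0//.
apply: normr_mx_le => [|i j]; first by rewrite !sumr_ge0// => i _; rewrite sumr_ge0.
rewrite (bigD1 i)//= (bigD1 j)//= -addrA lerDl addr_ge0// sumr_ge0// => k _.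
by rewrite sumr_ge0.
Qed.

(** The two smallness conditions place the pair formed by the least squares estimate and
    [sigma^2 G^-1] in a ball of radius [r] about [(theta0, 0)]; the expansion there is multiplied by
    [sqrt N]. Neither [C] nor [r] depends on [N] or on the sample. *)
Lemma sample_expansion : exists2 C : R, 0 <= C & forall e : R, 0 < e ->
  exists2 r : R, 0 < r & forall N (Phi : 'M[R]_(N, n)) V y,
    (0 < N)%N -> \rank Phi = n -> K y ->
    argmin Omega (fun x => F_EB Phi sigma (Phi *m theta0 + V) (P x)) y ->
    gram_error Phi < r -> `|ols_error Phi V| < r * Num.sqrt N%:R ->
    `|Num.sqrt N%:R *: (y - eta) +
      (ols_error Phi V)^T *m (eb_cross theta0 P eta *m invmx (A_b P theta0 eta))|
    <= C * gram_error Phi + e * `|ols_error Phi V|.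
Proof.
have g0 l : eb_grad P l (eta, (theta0, 0)) = 0.
  apply: (eb_grad_min oO P_C2 l Oeta) => y Oy; first by rewrite addr0; exact: pP.
  by rewrite -!W_bE//; exact: eta_min.2.
have Kmin y : K y -> y != eta -> eb_crit theta0 (P eta + 0) < eb_crit theta0 (P y + 0).
  move=> Ky yn; have Oy := K_sub Ky; rewrite -!W_bE// ltNge; apply/negP => le.
  move/eqP: yn; apply; have : (K `&` argmin Omega (W_b P theta0)) y; last by rewrite K_min.
  by split=> //; split=> // x Ox; rewrite (le_trans le)// eta_min.2.
have [C C0 HC] := estimator_expansion oO P_C2 pP Oeta g0 K_compact K_sub Kmin A_unit.
exists C => // e e0; have /nbhs_ballP[r /= r0 Hr] := HC e e0.
exists r => // N Phi V y N0 rP Ky ymin Gr ur.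
have s1 : 1 <= Num.sqrt N%:R :> R by rewrite -[leLHS]sqrtr1 ler_wsqrtr// ler1n.
have s0 : 0 < Num.sqrt N%:R :> R by rewrite (lt_le_trans ltr01).
pose G := invmx (Phi^T *m Phi).
have uE : ols_error Phi V = Num.sqrt N%:R *: (G *m Phi^T *m V) by exact: ols_errorE.
have GV : `|G *m Phi^T *m V| = `|ols_error Phi V| / Num.sqrt N%:R.
  by rewrite uE normrZ gtr0_norm// mulrAC divff ?mul1r// gt_eqF.
have ge0 : 0 <= gram_error Phi.
  rewrite divr_ge0// mulr_ge0 ?sqr_ge0// sumr_ge0// => i _.
  by rewrite sumr_ge0.
have Mle := gram_norm_le N0 rP.
have in_ball : ball (theta0, 0 : 'M[R]_n) r (theta0 + G *m Phi^T *m V, sigma ^+ 2 *: G).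
  split; rewrite -ball_normE /= ?sub0r ?normrN.
    by rewrite opprD addNKr normrN GV ltr_pdivrMr.
  rewrite (le_lt_trans Mle)// (le_lt_trans _ Gr)// ler_pdivrMr// ler_peMr//.
have := Hr _ in_ball y Ky (argmin_F_EB rP ymin).
have pG : posdef (sigma ^+ 2 *: G).
  by apply: posdefZ; [rewrite exprn_gt0|exact/posdef_inv/posdef_gram].
move=> /(_ (fun x Ox => posdefD (pP Ox) pG)) /=.
rewrite (addrAC theta0) subrr add0r => H.
rewrite uE linearZ/= -scalemxAl -scalerDr normrZ gtr0_norm// -uE.
rewrite (le_trans (ler_wpM2l (ltW s0) H))// mulrDr lerD//.
  rewrite mulrCA ler_wpM2l// (le_trans (ler_wpM2l (ltW s0) Mle))//.
  by rewrite mulrCA divff ?mulr1// gt_eqF.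
by rewrite GV mulrCA [Num.sqrt _ * _]mulrC divfK ?gt_eqF.
Qed.

End SampleExpansion.

Section ExpectationComparison.
Context {d : measure_display} {T : measurableType d} {R : realType}.
Variable Pr : probability T R.

Lemma expect_ae_close (f g q : T -> R) M :
  measurable_fun setT f -> measurable_fun setT g -> measurable_fun setT q ->
  (forall w, `|f w| <= M) -> (forall w, `|g w| <= M) -> (forall w, `|q w| <= M) ->
  (forall w, 0 <= q w) ->
  {ae Pr, forall w, `|f w - g w| <= q w} ->
  `|\int[Pr]_w f w - \int[Pr]_w g w| <= \int[Pr]_w q w.
Proof.
move=> mf mg mq fM gM qM q0 fgq.
have If := bounded_integrable Pr mf fM; have Ig := bounded_integrable Pr mg gM.
have Iq := bounded_integrable Pr mq qM.
have mfg : measurable_fun setT (fun w => f w - g w) by exact: measurable_funB.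
have Ifg : Pr.-integrable setT (EFin \o (fun w => f w - g w)).
  apply: (bounded_integrable Pr (M := M + M) mfg) => w.
  by rewrite (le_trans (ler_normB _ _))// lerD.
rewrite -RintegralB//; apply: (le_trans (le_normr_Rintegral measurableT Ifg)).
have Ia := integrable_abse Ifg.
rewrite -lee_fin !fineK ?integrable_fin_num//.
apply: ae_ge0_le_integral => //.
- by apply/measurable_EFinP; exact: measurableT_comp.
- by move=> w _; rewrite lee_fin.
- exact/measurable_EFinP.
- by apply: filterS fgq => w H _; rewrite lee_fin.
Qed.

Lemma integral_bounded_EFin (f : T -> R) M : measurable_fun setT f ->
  (forall w, `|f w| <= M) -> (\int[Pr]_w (f w)%:E)%E = (\int[Pr]_w f w)%:E.
Proof.
by move=> mf fM; rewrite fineK//; exact: (integrable_fin_num _ (bounded_integrable Pr mf fM)).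
Qed.

Lemma expect_seqD (f h : nat -> T -> R) M M' l l' :
  (forall N, measurable_fun setT (f N)) -> (forall N w, `|f N w| <= M) ->
  (forall N, measurable_fun setT (h N)) -> (forall N w, `|h N w| <= M') ->
  (fun N => \int[Pr]_w f N w) @ \oo --> l -> (fun N => \int[Pr]_w h N w) @ \oo --> l' ->
  (fun N => \int[Pr]_w (f N w + h N w)) @ \oo --> l + l'.
Proof.
move=> mf fM mh hM fl hl.
have -> : (fun N => \int[Pr]_w (f N w + h N w)) =
    (fun N => \int[Pr]_w f N w + \int[Pr]_w h N w).
  apply/funext => N; exact: (RintegralD measurableT (bounded_integrable Pr (mf N) (fM N))
    (bounded_integrable Pr (mh N) (hM N))).
exact: cvgD fl hl.
Qed.

Lemma expect_seq_sum (I : Type) (s : seq I) (f : I -> nat -> T -> R) (l : I -> R) :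
  (forall i N, measurable_fun setT (f i N)) -> (forall i N w, `|f i N w| <= 1) ->
  (forall i, (fun N => \int[Pr]_w f i N w) @ \oo --> l i) ->
  (fun N => \int[Pr]_w \sum_(i <- s) f i N w) @ \oo --> \sum_(i <- s) l i.
Proof.
move=> mf f1 fl; elim: s => [|i s IH].
  rewrite big_nil; have -> : (fun N => \int[Pr]_w \sum_(i <- [::]) f i N w) = cst 0.
    apply/funext => N; under eq_Rintegral do rewrite big_nil.
    exact: Rintegral_cst_prob.
  exact: cvg_cst.
rewrite big_cons; have -> : (fun N => \int[Pr]_w \sum_(j <- i :: s) f j N w) =
    (fun N => \int[Pr]_w (f i N w + \sum_(j <- s) f j N w)).
  by apply/funext => N; under eq_Rintegral do rewrite big_cons.
apply: (@expect_seqD _ _ 1 (\sum_(j <- s) 1) _ _ (mf i) (f1 i) _ _ (fl i) IH).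
- by move=> N; exact: measurable_sum.
- by move=> N w; rewrite (le_trans (ler_norm_sum _ _ _))// ler_sum.
Qed.

Lemma expect_indicator (A : set T) : measurable A -> \int[Pr]_w \1_A w = fine (Pr A).
Proof. by move=> mA; rewrite /Rintegral (integral_indic Pr measurableT mA) setIT. Qed.

End ExpectationComparison.

Section Truncation.
Context {R : realType}.

(** A bounded substitute for [e * |t|]: its mean always exists, and it equals 1 exactly where
    [e * |t|] is at least 1. *)
Definition trunc (e t : R) : R := Num.min 1 (e * `|t|).

Lemma trunc_ge0 e t : 0 <= e -> 0 <= trunc e t.
Proof. by move=> e0; rewrite le_min ler01 mulr_ge0. Qed.

Lemma trunc_le1 e t : trunc e t <= 1.
Proof. by rewrite ge_min lexx. Qed.

Lemma trunc_norm e t : 0 <= e -> `|trunc e t| <= 1.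
Proof. by move=> e0; rewrite ger0_norm ?trunc_ge0// trunc_le1. Qed.

Lemma trunc_continuous e : continuous (trunc e).
Proof.
move=> t; apply: (@continuous_min R R (cst (1 : R^o)) (fun t : R => (e * `|t|) : R^o)).
  exact: cvg_cst.
by apply: (@cvgM R R); [exact: cvg_cst|exact: norm_continuous].
Qed.

Lemma trunc_cvg0 (u : nat -> R) e : u @ \oo --> (0 : R) -> (fun k => trunc e (u k)) @ \oo --> (0 : R).
Proof.
move=> u0; have <- : trunc e 0 = 0 by rewrite /trunc normr0 mulr0 min_r.
exact: (continuous_cvg _ (@trunc_continuous e 0) u0).
Qed.

(** The sup norm is traded for a sum of functions of single coordinates, whose means have known
    limits. *)
Lemma trunc_norm_le n (u : 'cV[R]_n) e : 0 < e -> trunc e `|u| <= \sum_i trunc e (u i 0).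
Proof.
move=> e0; rewrite leNgt; apply/negP => H.
have s0 : 0 <= \sum_i trunc e (u i 0) by rewrite sumr_ge0// => i _; rewrite trunc_ge0// ltW.
move: H; rewrite lt_min normr_id => /andP[s1].
rewrite ltNge => /negP; apply.
rewrite -ler_pdivlMl//; apply: normr_mx_le => [|i j].
  by rewrite mulr_ge0// invr_ge0 ltW.
rewrite (ord1 j) ler_pdivlMl//.
have : trunc e (u i 0) <= \sum_i trunc e (u i 0).
  by rewrite (bigD1 i)//= lerDl sumr_ge0// => k _; rewrite trunc_ge0// ltW.
move=> /[dup] H; rewrite {1}/trunc ge_min => /orP[H1|//].
by move: (lt_le_trans s1 H1); rewrite ltxx.
Qed.

End Truncation.

Lemma shift_scale_continuous (R : realType) p (c : R) (eta : 'rV[R]_p) :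
  continuous (fun y : 'rV[R]_p => c *: (y - eta)).
Proof.
move=> y; have c1 : (fun z : 'rV[R]_p => z) @ y --> y by move=> A.
exact: (cvgZ (@cst_continuous _ _ c y) (cvgB c1 (@cst_continuous _ _ eta y))).
Qed.

(** * Projections of the estimation error *)

Section RidgeLimit.
Context {d : measure_display} {T : measurableType d} {R : realType}.
Variables (Pr : probability T R) (n p : nat) (theta0 : 'cV[R]_n) (sigma : R).
Hypothesis sigma_gt0 : 0 < sigma.
Variables (Phi : forall N : nat, T -> 'M[R]_(N, n)) (V : forall N : nat, T -> 'cV[R]_N).
Hypothesis Phi_meas : forall N i j, measurable_fun setT (fun w => Phi N w i j).
Hypothesis Phi_rank : forall N, (n < N)%N -> {ae Pr, forall w, \rank (Phi N w) = n}.
Hypothesis V_gauss : forall N, white_gaussian Pr sigma (V N).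
Hypothesis V_indep_Phi : forall N, independent_families Pr (fun i w => V N w i 0)
  (fun (ij : 'I_N * 'I_n) w => Phi N w ij.1 ij.2).
Variables (Omega : set 'rV[R]_p) (P : 'rV[R]_p -> 'M[R]_n).
Hypotheses (oO : open Omega) (P_C2 : C2_on Omega P).
Hypothesis pP : forall eta, Omega eta -> posdef (P eta).
Variable est : nat -> T -> 'rV[R]_p.
Hypothesis est_meas : forall N, measurable_fun setT (est N : T -> borel_rV p).
Hypothesis est_min : forall N, (n < N)%N -> {ae Pr, forall w,
  argmin Omega (fun eta => F_EB (Phi N w) sigma (Phi N w *m theta0 + V N w) (P eta)) (est N w)}.
Variable Sigma : 'M[R]_n.
Hypothesis A2_Phi : {ae Pr, forall w, (fun N => scaled_gram (Phi N w)) @ \oo --> Sigma}.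
Hypothesis A2_Sigma : posdef Sigma.
Variables (eta : 'rV[R]_p) (eta_min : argmin Omega (W_b P theta0) eta).
Hypothesis A_unit : A_b P theta0 eta \in unitmx.
Variables (K : set 'rV[R]_p) (K_compact : compact K) (K_sub : K `<=` Omega).
Hypothesis K_min : K `&` argmin Omega (W_b P theta0) = [set eta].
Hypothesis K_est : (fun N => Pr [set w | K (est N w)]) @ \oo --> 1%E.

Local Notation DA := (eb_cross theta0 P eta *m invmx (A_b P theta0 eta)).
Let X N w : 'rV[R]_p := Num.sqrt N%:R *: (est N w - eta).
Let u N w := ols_error (Phi N w) (V N w).
Let m N w := gram_error sigma (Phi N w).
Let outside N : set T := [set w | ~ K (est N w)].

Let measurable_outside N : measurable (outside N).
Proof.
have cK : closed K by apply: compact_closed K_compact; exact: norm_hausdorff.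
have mK : measurable (~` K : set (borel_rV p)).
  by apply: sub_sigma_algebra; exact: closed_openC.
by have := @est_meas N measurableT _ mK; rewrite setTI.
Qed.

Let outside_cvg : (fun N => \int[Pr]_w (\1_(outside N) w : R)) @ \oo --> (0 : R).
Proof.
have -> : (fun N => \int[Pr]_w (\1_(outside N) w : R)) =
    (fun N => 1 - fine (Pr [set w | K (est N w)])).
  apply/funext => N; rewrite expect_indicator//.
  have -> : [set w | K (est N w)] = ~` outside N.
    by apply/seteqP; split=> w /=; [move=> Kw /(_ Kw)|move=> /contrapT].
  rewrite probability_setC// fineB//; last exact: fin_num_measure.
  by rewrite opprB addrCA subrr addr0.
rewrite -[X in _ --> X](subrr (1 : R)); apply: cvgB; first exact: cvg_cst.
exact: (fine_cvg K_est).
Qed.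

Let measurable_m N : measurable_fun setT (m N).
Proof.
apply: measurable_funM; last exact: measurable_cst.
apply: measurable_funM; first exact: measurable_cst.
apply: measurable_sum => i; apply: measurable_sum => j.
by apply: measurableT_comp => //; exact: (measurable_adjinv_gram Phi_meas).
Qed.

Let m_cvg : {ae Pr, forall w, (fun N => m N w) @ \oo --> (0 : R)}.
Proof.
have s0 : (fun N => (Num.sqrt N%:R)^-1 : R) @ \oo --> (0 : R).
  have H : (fun N => (Num.sqrt N.+1%:R)^-1 : R) @ \oo --> (0 : R).
    have -> : (fun N => (Num.sqrt N.+1%:R)^-1) = (fun N => Num.sqrt (@harmonic R N)).
      by apply/funext => N; rewrite /harmonic sqrtrV.
    rewrite -[X in _ --> X](sqrtr0 R); apply: (continuous_cvg _ _ (@cvg_harmonic R)).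
    exact: sqrt_continuous.
  by move: H; rewrite (cvg_shiftS (fun N => (Num.sqrt N%:R)^-1 : R)).
apply: filterS (adjinv_gram_cvg A2_Phi A2_Sigma) => w H.
rewrite -[X in _ --> X](mulr0 (sigma ^+ 2 * \sum_i \sum_j `|invmx Sigma i j|)).
apply: cvgM s0; apply: cvgM; first exact: cvg_cst.
apply: cvg_big => [|i _]; first exact: add_continuous.
apply: cvg_big => [|j _]; first exact: add_continuous.
have ce : {for invmx Sigma, continuous (fun A : 'M[R]_n => A i j)} by exact: coord_continuous.
exact: (cvg_norm (continuous_cvg _ ce H)).
Qed.

Let measurable_u N (c : 'cV[R]_n) : measurable_fun setT (fun w => ((u N w)^T *m c) 0 0).
Proof. exact: (measurable_ols_error Phi_meas V_gauss). Qed.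

Let u_entry N w i : u N w i 0 = ((u N w)^T *m delta_mx i (0 : 'I_1)) 0 0.
Proof. by rewrite -colE !mxE. Qed.

Variables (a : 'cV[R]_p) (g : R -> R).
Hypotheses (g1 : forall t, `|g t| <= 1) (gL : forall s t, `|g s - g t| <= `|s - t|).

(** Each summand reaches 1 on one kind of exceptional sample: estimator outside [K], large Gram
    error, large least squares error. The factor 2 then covers any difference of values of [g]. On
    the other samples the truncation of the Gram error and that of the norm of [u] are inactive. *)
Let q H e N w : R := 2 * (\1_(outside N) w + trunc H (m N w) + \sum_i trunc e (u N w i 0)).

Let measurable_q H e N : measurable_fun setT (q H e N).
Proof.
apply: measurable_funM; first exact: measurable_cst.
apply: measurable_funD.
  apply: measurable_funD; first exact: measurable_indic.
  exact: (measurableT_comp (continuous_measurable_fun (@trunc_continuous R H))).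
apply: measurable_sum => i; under boolp.eq_fun do rewrite u_entry.
exact: (measurableT_comp (continuous_measurable_fun (@trunc_continuous R e))).
Qed.

Let ridge_bound e : 0 < e -> exists2 H, 0 <= H & \forall N \near \oo, {ae Pr, forall w,
  `|g ((X N w *m a) 0 0) - g (((u N w)^T *m (- (DA *m a))) 0 0)| <= q H e N w}.
Proof.
move=> e0; pose k := p%:R * `|a|; have k0 : 0 <= k by rewrite mulr_ge0.
have [C C0 HC] := sample_expansion oO P_C2 pP eta_min K_compact K_sub K_min A_unit sigma_gt0.
(* Projecting on [a] multiplies the sup norm of the remainder by at most [k]; division by [k + 1]
   leaves a coefficient below [e]. *)
have e'0 : 0 < e / (k + 1) by rewrite divr_gt0// ltr_wpDl.
have [r r0 Hr] := HC _ e'0.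
(* The part [r^-1] ensures that [H * m < 1] forces [m < r]; the part [k * C] covers the projected
   error term in [m]. *)
exists (r^-1 + k * C) => [|]; first by rewrite addr_ge0 ?invr_ge0 ?mulr_ge0// ltW.
set H := r^-1 + _; have H0 : 0 <= H by rewrite addr_ge0 ?invr_ge0 ?mulr_ge0// ltW.
near=> N.
have nN : (n < N)%N by near: N; exact: nbhs_infty_gt.
(* For such [N], [e * |u| < 1] implies [|u| < r * sqrt N], the second condition of the sample
   expansion. *)
have Nr : 1 <= e * (r * Num.sqrt N%:R).
  have : ((e * r)^-1 ^+ 2) <= N%:R by near: N; exact: nbhs_infty_ger.
  move=> /ler_wsqrtr; rewrite sqrtr_sqr gtr0_norm ?invr_gt0 ?mulr_gt0// => h.
  by rewrite mulrA -ler_pdivrMl ?mulr_gt0// mulr1.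
apply: filterS2 (Phi_rank nN) (est_min nN) => w rw mw.
have ind0 : 0 <= \1_(outside N) w :> R by [].
have tm0 : 0 <= trunc H (m N w) by exact: trunc_ge0.
have tu0 : 0 <= \sum_i trunc e (u N w i 0).
  by rewrite sumr_ge0// => i _; rewrite trunc_ge0// ltW.
have tu := trunc_norm_le (u N w) e0.
have d2 : `|g ((X N w *m a) 0 0) - g (((u N w)^T *m (- (DA *m a))) 0 0)| <= 2.
  by rewrite (le_trans (ler_normB _ _))// [leRHS](_ : 2 = 1 + 1)// lerD.
have big : 1 <= \1_(outside N) w + trunc H (m N w) + \sum_i trunc e (u N w i 0) ->
    `|g ((X N w *m a) 0 0) - g (((u N w)^T *m (- (DA *m a))) 0 0)| <= q H e N w.
  by move=> h; rewrite (le_trans d2)// /q ler_peMr.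
have [Kw|nKw] := pselect (K (est N w)); last first.
  apply: big; rewrite -addrA [X in X + _](_ : _ = 1) ?lerDl ?addr_ge0//.
  by rewrite indicE mem_set.
have [Hm|Hm] := leP 1 (H * `|m N w|).
  by apply: big; rewrite {1}/trunc (min_l Hm) -addrA addrCA lerDl addr_ge0.
have [ue|ue] := leP 1 (e * `|u N w|).
  apply: big; apply: (@le_trans _ _ (\sum_i trunc e (u N w i 0))); last by rewrite lerDr addr_ge0.
  by apply: le_trans tu; rewrite /trunc normr_id min_l.
have m0 : 0 <= m N w.
  rewrite divr_ge0// mulr_ge0 ?sqr_ge0// sumr_ge0// => i _.
  by rewrite sumr_ge0.
have mr : m N w < r.
  move: Hm; rewrite ger0_norm// => Hm; rewrite -(mul1r r) -ltr_pdivrMr//.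
  by rewrite mulrC (le_lt_trans _ Hm)// ler_wpM2r// lerDl mulr_ge0.
have ur : `|u N w| < r * Num.sqrt N%:R.
  by rewrite -(ltr_pM2l e0) (lt_le_trans ue).
have := Hr N (Phi N w) (V N w) (est N w) (leq_ltn_trans (leq0n _) nN) rw Kw mw mr ur.
rewrite -/(u N w) -/(m N w) -/(X N w); set Z := X N w + _ => HZ.
have dZ : (X N w *m a) 0 0 - ((u N w)^T *m (- (DA *m a))) 0 0 = (Z *m a) 0 0.
  by rewrite /Z mulmxDl mulmxN [(- (_ *m _)) 0 0]mxE opprK [RHS]mxE !mulmxA.
rewrite (le_trans (gL _ _))// dZ (le_trans (normr_entry_le _ _ _))//.
rewrite (le_trans (normr_mulmx _ _))// mulrAC -/k.
have kZ : k * `|Z| <= H * m N w + e * `|u N w|.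
  rewrite (le_trans (ler_wpM2l k0 HZ))// mulrDr lerD//.
    by rewrite mulrA ler_wpM2r// lerDr invr_ge0 ltW.
  rewrite mulrA ler_wpM2r// mulrCA -[leRHS]mulr1 ler_wpM2l ?(ltW e0)//.
  by rewrite ler_pdivrMr ?mul1r ?lerDl// ltr_wpDl.
apply: (le_trans kZ).
have tmE : trunc H (m N w) = H * m N w by rewrite /trunc min_r ?(ltW Hm)// ger0_norm.
have tuE : trunc e `|u N w| = e * `|u N w| by rewrite /trunc normr_id min_r// ltW.
rewrite /q -tmE; rewrite tuE in tu.
apply: (@le_trans _ _ (\1_(outside N) w + trunc H (m N w) + \sum_i trunc e (u N w i 0))).
  by rewrite lerD// lerDr.
by rewrite ler_peMl ?ler1n// !addr_ge0.
Unshelve. all: by end_near. Qed.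

Let kappa e : R := \sum_i normal_scale_mean sigma (trunc e) (quad (invmx Sigma) (delta_mx i 0)).

Let q_mean_cvg H e : 0 <= H -> 0 <= e ->
  (fun N => \int[Pr]_w q H e N w) @ \oo --> 2 * kappa e.
Proof.
move=> H0 e0.
have mtm N : measurable_fun setT (fun w => trunc H (m N w)).
  exact: (measurableT_comp (continuous_measurable_fun (@trunc_continuous R H))).
have mtu N i : measurable_fun setT (fun w => trunc e (u N w i 0)).
  under boolp.eq_fun do rewrite u_entry.
  exact: (measurableT_comp (continuous_measurable_fun (@trunc_continuous R e))).
have i1 N w : `|\1_(outside N) w : R| <= 1.
  by rewrite ger0_norm// indicE; case: (_ \in _).
have t1 N w : `|trunc H (m N w)| <= 1 by exact: trunc_norm.
have s1 N w : `|\sum_i trunc e (u N w i 0)| <= \sum_(i < n) 1.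
  by rewrite (le_trans (ler_norm_sum _ _ _))// ler_sum// => i _; exact: trunc_norm.
have c1 : (fun N => \int[Pr]_w trunc H (m N w)) @ \oo --> (0 : R).
  rewrite -[X in _ --> X](Rintegral_cst_prob Pr 0).
  apply: (@bounded_convergence _ _ _ Pr _ _ 1) => //.
  by apply: filterS m_cvg => w; exact: trunc_cvg0.
have c2 : (fun N => \int[Pr]_w \sum_i trunc e (u N w i 0)) @ \oo --> kappa e.
  apply: (@expect_seq_sum _ _ _ Pr _ _ (fun i N w => trunc e (u N w i 0))
    (fun i => normal_scale_mean sigma (trunc e) (quad (invmx Sigma) (delta_mx i 0)))) => [//||i].
    by move=> i N w; exact: trunc_norm.
  have -> : (fun N => \int[Pr]_w trunc e (u N w i 0)) =
      (fun N => \int[Pr]_w trunc e (((u N w)^T *m delta_mx i (0 : 'I_1)) 0 0)).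
    by apply/funext => N; apply: eq_Rintegral => w _; rewrite u_entry.
  apply: (ols_error_mean_cvg sigma_gt0 Phi_meas V_gauss V_indep_Phi A2_Phi A2_Sigma).
    exact: trunc_continuous.
  by move=> t; exact: trunc_norm.
have m1 N : measurable_fun setT (\1_(outside N) : T -> R) by exact: measurable_indic.
have c3 := expect_seqD m1 i1 mtm t1 outside_cvg c1.
have m2 N : measurable_fun setT (fun w => \1_(outside N) w + trunc H (m N w)).
  exact: measurable_funD.
have b2 N w : `|\1_(outside N) w + trunc H (m N w)| <= 1 + 1.
  by rewrite (le_trans (ler_normD _ _))// lerD.
have m3 N : measurable_fun setT (fun w => \sum_i trunc e (u N w i 0)).
  by apply: measurable_sum => i; exact: mtu.
have := expect_seqD m2 b2 m3 s1 c3 c2; rewrite !add0r => c4.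
have -> : (fun N => \int[Pr]_w q H e N w) = (fun N => 2 * \int[Pr]_w
    (\1_(outside N) w + trunc H (m N w) + \sum_i trunc e (u N w i 0))).
  apply/funext => N; apply: (RintegralZl 2 measurableT).
  apply: (bounded_integrable Pr (M := 1 + 1 + \sum_(i < n) 1)).
    exact: measurable_funD.
  by move=> w; rewrite (le_trans (ler_normD _ _))// lerD.
by apply: cvgM c4; exact: cvg_cst.
Qed.

(** [kappa e] is the limiting mean of the truncated coordinates of [u]. Its vanishing with [e] is
    bounded convergence under the Gaussian limit, and it expresses the tightness of [u]. *)
Let kappa_cvg : (fun k => kappa (@harmonic R k)) @ \oo --> (0 : R).
Proof.
rewrite -[X in _ --> X](@big1 R 0 +%R 'I_n (index_enum _) xpredT (fun=> 0))//.
apply: cvg_big => [|i _]; first exact: add_continuous.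
rewrite -[X in _ --> X](Rintegral_cst_prob (normal_prob 0 sigma) 0).
apply: (@bounded_convergence _ _ _ (normal_prob 0 sigma) _ _ 1).
- move=> k; apply: (measurableT_comp (continuous_measurable_fun (@trunc_continuous R _))).
  exact: measurable_funM.
- exact: measurable_cst.
- by move=> k x; apply: trunc_norm; exact: harmonic_ge0.
- apply: aeW => x; set t := Num.sqrt _ * x.
  have -> : (fun k => trunc (@harmonic R k) t) = (fun k => trunc `|t| (@harmonic R k)).
    by apply/funext => k; rewrite /trunc mulrC (ger0_norm (harmonic_ge0 k)).
  exact/trunc_cvg0/cvg_harmonic.
Qed.

Lemma ridge_limit : (fun N => \int[Pr]_w g ((X N w *m a) 0 0)) @ \oo -->
  normal_scale_mean sigma g (quad (invmx Sigma) (DA *m a)).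
Proof.
have cg : continuous g by exact: lipschitz1_continuous.
have mg : measurable_fun setT g by exact: continuous_measurable_fun.
have -> : quad (invmx Sigma) (DA *m a) = quad (invmx Sigma) (- (DA *m a)).
  by rewrite quadN.
have Lc := ols_error_mean_cvg sigma_gt0 Phi_meas V_gauss V_indep_Phi A2_Phi A2_Sigma
  (c := - (DA *m a)) cg g1.
move: Lc; set L := normal_scale_mean _ _ _ => Lc.
have mX N : measurable_fun setT (fun w => (X N w *m a) 0 0).
  have cX : continuous (fun y : 'rV[R]_p => Num.sqrt N%:R *: (y - eta)).
    exact: shift_scale_continuous.
  exact: (measurableT_comp (borel_measurable_continuous (ridge_continuous (a := a)))
    (borel_continuous_comp cX (@est_meas N))).
apply/cvgrPdist_le => e e0; have e3 : 0 < e / 3 by rewrite divr_gt0.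
have e6 : 0 < e / 6 by rewrite divr_gt0.
(* The truncation parameter is fixed first, because [H] depends on it and [N] depends on both. The
   bound is [e / 6] since [kappa] enters with a factor 2. *)
have [k kk] : exists k, kappa (@harmonic R k) <= e / 6.
  move/cvgrPdist_le: kappa_cvg => /(_ _ e6)[k _ Hk].
  by exists k; have := Hk k (leqnn k); rewrite sub0r normrN; exact/le_trans/ler_norm.
have h0 : 0 < @harmonic R k by exact: harmonic_gt0.
have [H H0 bH] := ridge_bound h0.
have /cvgrPdist_le/(_ _ e3) Q := q_mean_cvg H0 (ltW h0).
move/cvgrPdist_le: Lc => /(_ _ e3) Lc.
near=> N.
have B1 : `|\int[Pr]_w g ((X N w *m a) 0 0) - \int[Pr]_w g (((u N w)^T *m (- (DA *m a))) 0 0)|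
    <= \int[Pr]_w q H (@harmonic R k) N w.
  apply: (@expect_ae_close _ _ _ Pr _ _ _ (Num.max 1 (2 * (1 + 1 + \sum_(i < n) 1)))).
  - exact: (measurableT_comp mg).
  - exact: (measurableT_comp mg (@measurable_u N _)).
  - exact: measurable_q.
  - by move=> w; rewrite le_max g1.
  - by move=> w; rewrite le_max g1.
  - move=> w; rewrite le_max normrM ger0_norm// ler_pM2l//; apply/orP; right.
    rewrite (le_trans (ler_normD _ _))// lerD//.
      rewrite (le_trans (ler_normD _ _))// lerD ?trunc_norm//.
      by rewrite ger0_norm// indicE; case: (_ \in _).
    by rewrite (le_trans (ler_norm_sum _ _ _))// ler_sum// => i _; rewrite trunc_norm// ltW.
  - move=> w; rewrite mulr_ge0// !addr_ge0 ?trunc_ge0// sumr_ge0// => i _.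
    by rewrite trunc_ge0// ltW.
  - by near: N.
have B2 : `|2 * kappa (@harmonic R k) - \int[Pr]_w q H (@harmonic R k) N w| <= e / 3 by near: N.
have B3 : `|L - \int[Pr]_w g (((u N w)^T *m (- (DA *m a))) 0 0)| <= e / 3 by near: N.
move: B1 B2 B3; rewrite /u.
move: (\int[Pr]_w g ((X N w *m a) 0 0)) (\int[Pr]_w q H _ N w) (kappa _) kk => x z t tk.
move: (\int[Pr]_w g (_ 0 0)) => y xy zt Ly.
rewrite (le_trans (ler_distD y _ _))// [leRHS](_ : e = e / 3 + (e / 3 + 2 * (e / 6))); last by field.
rewrite lerD// distrC (le_trans xy)//; move: zt; rewrite distrC => /(le_trans (ler_norm _)).
by rewrite lerBlDr => /le_trans; apply; rewrite lerD2l ler_wpM2l.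
Unshelve. all: by end_near. Qed.

End RidgeLimit.

(** The factor 4 of [B_b] comes from the factor 2 in each column of [eb_cross], and symmetry of the
    partials of the inverse kernel removes the transpose. *)
Lemma B_b_crossE (R : realType) n p (theta0 : 'cV[R]_n) (sigma : R) (Sigma : 'M[R]_n)
    (Omega : set 'rV[R]_p) (P : 'rV[R]_p -> 'M[R]_n) (eta : 'rV[R]_p) :
  open Omega -> C2_on Omega P -> (forall x, Omega x -> posdef (P x)) -> Omega eta ->
  let D := eb_cross theta0 P eta in
  B_b P theta0 sigma Sigma eta = sigma ^+ 2 *: (D^T *m invmx Sigma *m D).
Proof.
move=> oO P_C2 pP Oeta D; apply/matrixP => k l; rewrite mxE [RHS]mxE.
have colD j : col j D = 2 *: (partial j (Pinv P) eta *m theta0).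
  by apply/matrixP => i i'; rewrite (ord1 i') [LHS]mxE [LHS]mxE [RHS]mxE.
have -> : (D^T *m invmx Sigma *m D) k l = ((col k D)^T *m invmx Sigma *m col l D) 0 0.
  rewrite tr_col -row_mul [LHS]mxE [RHS]mxE; apply: eq_bigr => i _.
  by rewrite [in RHS]mxE [X in _ = _ * X]mxE.
rewrite !colD [(2 *: _)^T]linearZ/= -scalemxAl -scalemxAl -scalemxAr scalerA mxE.
rewrite trmx_mul (partial_Pinv_sym oO P_C2 pP Oeta k) /quad !mulmxA.
by ring.
Qed.

Theorem theorem3 (R : realType) (d : measure_display) (T : measurableType d)
    (Pr : probability T R) (n p : nat)
    (theta0 : 'cV[R]_n) (sigma : R) (sigma_gt0 : 0 < sigma)
    (* linear regression model Y = Phi theta0 + V *)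
    (Phi : forall N : nat, T -> 'M[R]_(N, n))
    (V : forall N : nat, T -> 'cV[R]_N)
    (Y : forall N : nat, T -> 'cV[R]_N)
    (Phi_meas : forall N i j, measurable_fun setT (fun w => Phi N w i j))
    (Phi_rank : forall N, (n < N)%N -> {ae Pr, forall w, \rank (Phi N w) = n})
    (V_gauss : forall N, white_gaussian Pr sigma (V N))
    (V_indep_Phi : forall N,
       independent_families Pr (fun i w => V N w i 0)
         (fun (ij : 'I_N * 'I_n) w => Phi N w ij.1 ij.2))
    (modelY : forall N w, Y N w = Phi N w *m theta0 + V N w)
    (* kernel matrix *)
    (Omega : set 'rV[R]_p) (P : 'rV[R]_p -> 'M[R]_n)
    (P_C2 : C2_on Omega P)
    (* (A1) *)
    (eta_EB eta_Sy eta_EEB eta_MSEy : nat -> T -> 'rV[R]_p)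
    (eta_EB_meas : forall N,
       measurable_fun setT (eta_EB N : T -> borel_rV p))
    (A1_EB : forall N, (n < N)%N -> {ae Pr, forall w,
       argmin Omega (fun eta => F_EB (Phi N w) sigma (Y N w) (P eta))
         (eta_EB N w) /\ interior Omega (eta_EB N w)})
    (A1_Sy : forall N, (n < N)%N -> {ae Pr, forall w,
       argmin Omega (fun eta => F_Sy (Phi N w) sigma (Y N w) (P eta))
         (eta_Sy N w) /\ interior Omega (eta_Sy N w)})
    (A1_EEB : forall N, (n < N)%N -> {ae Pr, forall w,
       argmin Omega (fun eta => F_EEB (Phi N w) sigma theta0 (P eta))
         (eta_EEB N w) /\ interior Omega (eta_EEB N w)})
    (A1_MSEy : forall N, (n < N)%N -> {ae Pr, forall w,
       argmin Omega (fun eta => F_MSEy (Phi N w) sigma theta0 (P eta))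
         (eta_MSEy N w) /\ interior Omega (eta_MSEy N w)})
    (* (A2) *)
    (Sigma : 'M[R]_n)
    (A2_P : forall eta, Omega eta -> posdef (P eta))
    (A2_Phi : {ae Pr, forall w,
       (fun N : nat => N%:R^-1 *: ((Phi N w)^T *m Phi N w)) @ \oo --> Sigma})
    (A2_Sigma : posdef Sigma)
    (* (A3) *)
    (A3_b : argmin Omega (W_b P theta0) `<=`
              isolated (argmin Omega (W_b P theta0)))
    (A3_y : argmin Omega (W_y P theta0 sigma Sigma) `<=`
              isolated (argmin Omega (W_y P theta0 sigma Sigma)))
    (* (A5) *)
    (A5 : open Omega)
    (* the minimizer of W_b around which eta_EB is considered *)
    (eta_b : 'rV[R]_p) (eta_b_min : argmin Omega (W_b P theta0) eta_b)
    (A_b_unit : A_b P theta0 eta_b \in unitmx)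
    (* eta_EB stays in a compact part of Omega where eta_b is the only
       minimizer of W_b *)
    (K : set 'rV[R]_p) (K_compact : compact K) (K_sub : K `<=` Omega)
    (K_min : K `&` argmin Omega (W_b P theta0) = [set eta_b])
    (K_eta_EB : (fun N : nat => Pr [set w | K (eta_EB N w)]) @ \oo --> 1%E) :
  exists mu : probability (borel_rV p) R,
    is_gaussian mu 0
      (invmx (A_b P theta0 eta_b) *m B_b P theta0 sigma Sigma eta_b
         *m invmx (A_b P theta0 eta_b)) /\
    cvg_in_distribution Pr
      (fun N w => Num.sqrt N%:R *: (eta_EB N w - eta_b)) mu.
Proof.
have Oeta : Omega eta_b := eta_b_min.1.
set DA := eb_cross theta0 P eta_b *m invmx (A_b P theta0 eta_b).
have [L LE] := posdef_factor (posdef_inv A2_Sigma).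
(* The noise vector of size [n] is used, to match the rows of [L]. As [L^T *m L] is [Sigma^-1], the
   image has the covariance of the limit. *)
have [mu [gmu muI]] := gaussian_image_law sigma_gt0 (V_gauss n) (L *m DA).
have gramE : (L *m DA)^T *m (L *m DA) = DA^T *m invmx Sigma *m DA.
  by rewrite trmx_mul -LE !mulmxA.
rewrite gramE in gmu muI.
exists mu; split.
  have -> : invmx (A_b P theta0 eta_b) *m B_b P theta0 sigma Sigma eta_b
      *m invmx (A_b P theta0 eta_b) = sigma ^+ 2 *: (DA^T *m invmx Sigma *m DA).
    rewrite (B_b_crossE theta0 sigma Sigma A5 P_C2 A2_P Oeta) -scalemxAr -scalemxAl.
    by rewrite /DA trmx_mul trmx_inv (A_b_sym theta0 A5 P_C2 A2_P Oeta) !mulmxA.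
  exact: gmu.
pose X N w : 'rV[R]_p := Num.sqrt N%:R *: (eta_EB N w - eta_b).
have mX N : measurable_fun setT (X N : T -> borel_rV p).
  exact: (borel_continuous_comp (@shift_scale_continuous _ _ _ eta_b) (@eta_EB_meas N)).
have est_min N : (n < N)%N -> {ae Pr, forall w,
    argmin Omega (fun eta => F_EB (Phi N w) sigma (Phi N w *m theta0 + V N w) (P eta))
      (eta_EB N w)}.
  by move=> nN; apply: filterS (@A1_EB N nN) => w []; rewrite modelY.
(* The Cramer-Wold device speaks of laws on the parameter space, so the rescaled estimators are
   replaced by their laws [nu N]. *)
have /choice[nu nuP] := fun N => law_exists Pr (mX N).
have ridge (a : 'cV[R]_p) (g : R -> R) :
    (forall t, `|g t| <= 1) -> (forall s t, `|g s - g t| <= `|s - t|) ->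
    (fun N => \int[nu N]_x g ((x *m a) 0 0)) @ \oo --> \int[mu]_x g ((x *m a) 0 0).
  move=> g1 gL; have bg := lipschitz_ridge_bounded_cont a g1 gL.
  have cg : continuous g by exact: lipschitz1_continuous.
  rewrite (muI g 1 cg g1) quad_mul.
  have -> : (fun N => \int[nu N]_x g ((x *m a) 0 0)) =
      (fun N => \int[Pr]_w g ((X N w *m a) 0 0)).
    by apply/funext => N; rewrite (nuP N).2.
  exact: (ridge_limit sigma_gt0 Phi_meas Phi_rank V_gauss V_indep_Phi A5 P_C2 A2_P
    eta_EB_meas est_min A2_Phi A2_Sigma eta_b_min A_b_unit K_compact K_sub K_min K_eta_EB).
move=> f cf [M fM]; have bf : bounded_cont f by split=> //; exists M.
have mf := borel_measurable_continuous cf.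
have lim := cramer_wold ridge bf.
have -> : (fun N => \int[Pr]_w (f (Num.sqrt N%:R *: (eta_EB N w - eta_b)))%:E)%E =
    (fun N => (\int[nu N]_x f x)%:E).
  apply/funext => N; rewrite (nuP N).2//.
  apply: (integral_bounded_EFin Pr (M := M)) => [|w]; last exact: fM.
  exact: (measurableT_comp mf (mX N)).
rewrite (integral_bounded_EFin mu mf fM).
by apply/fine_cvgP; split; [exact: nearW|exact: lim].
Qed.
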